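(* Let $\omega$ be a polynomial of degree $d\ge 2$ with integer coefficients, and let $g$ be a non-constant step function on $\mathbb T=\mathbb R/(2\pi\mathbb Z)$. Then for every $r\in\mathbb Q\setminus\{0\}$ and for a.e. $c\in\mathbb R$, the function $$f(x)=e^{itL_\omega}g(x)\big|_{t=c-rx}=\sum_{n\in\mathbb Z}\widehat g(n)e^{i(c-rx)\omega(n)+inx}$$ belongs to $C^{\alpha}$ (as a function of $x$) for every $\alpha<\frac1{d(2^d+1)}$. Moreover, the maximum of the fractal dimensions of the graphs of the real and imaginary parts of $f$ lies in $\left[2-\frac1{2d},\,2-\frac1{d(2^d+1)}\right]$.
   Context: $\widehat g(n)$ is the $n$-th Fourier coefficient, normalized so that $g(x)=\sum_n\widehat g(n)e^{inx}$. For $\omega:\mathbb Z\to\mathbb R$, $e^{itL_\omega}g(x)=\sum_{n\in\mathbb Z}\widehat g(n)e^{it\omega(n)+inx}$. If $r=k/\ell$ in lowest terms ($\ell\ge1$), then $f$ is $2\pi\ell$-periodic; the series defining $f$ is understood as converging in $L^2$ over a period, and ''$f\in C^\alpha$'' means $f$ agrees a.e. with a Hölder-$\alpha$ function, to which the dimension statement (graph over one period) refers. A step function is a finite linear combination of indicator functions of intervals (arcs). The fractal (upper Minkowski, upper box-counting) dimension of a bounded set $E$ is $\limsup_{\epsilon\to0}\frac{\log\mathcal N(E,\epsilon)}{\log(1/\epsilon)}$, where $\mathcal N(E,\epsilon)$ is the minimum number of $\epsilon$-balls needed to cover $E$. *)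

(* Defs.v *)
From HB Require Import structures.
From mathcomp Require Import all_boot all_order all_algebra finmap.
From mathcomp Require Import all_classical all_reals all_analysis.
From mathcomp Require Import complex.
From mathcomp.analysis.showcase Require Import summability.

Set Implicit Arguments.
Unset Strict Implicit.
Unset Printing Implicit Defensive.

Import Order.TTheory GRing.Theory Num.Theory.
Import numFieldNormedType.Exports.
Import ComplexField.Normc.

Local Open Scope classical_set_scope.
Local Open Scope ring_scope.
Local Open Scope complex_scope.

(* Functions on the torus R / (2 pi l Z) are represented by (2 pi l)-periodic
   functions on R, and complex values by R[i]; normc : R[i] -> R is the complex
   modulus. *)

(* exp(i * theta) *)
Definition expi (R : realType) (theta : R) : R[i] :=
  cos theta +i* sin theta.

Definition cintegral (R : realType) (D : set R) (h : R -> R[i]) : R[i] :=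
  Rintegral lebesgue_measure D (fun x => complex.Re (h x)) +i*
  Rintegral lebesgue_measure D (fun x => complex.Im (h x)).

Definition fourier_coef (R : realType) (g : R -> R[i]) (n : int) : R[i] :=
  (2 * pi)^-1%:C * cintegral `[0, 2 * pi] (fun x => g x * expi (- (n%:~R * x))).

(* The preimage in R of the image of the interval I in R / (2 pi Z). *)
Definition circle_arc (R : realType) (I : interval R) : set R :=
  [set x | exists k : int, x + k%:~R * (2 * pi) \in I].

Definition step_function (R : realType) (g : R -> R[i]) : Prop :=
  exists (m : nat) (a : 'I_m -> R[i]) (I : 'I_m -> interval R),
    forall x, g x = \sum_(j < m) a j * (\1_(circle_arc (I j)) x)%:C.

(* As an integrable function on the torus: g is not a.e. equal to a constant.
   (Indicators of degenerate arcs {x0} are step functions, but vanish a.e.) *)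
Definition nonconstant (R : realType) (g : R -> R[i]) : Prop :=
  ~ exists z : R[i], {ae lebesgue_measure, forall x : R, g x = z}.

(* The n-th term of the series defining e^{i t L_omega} g (x). *)
Definition propagator_term (R : realType) (omega : int -> R) (g : R -> R[i])
    (t x : R) (n : int) : R[i] :=
  fourier_coef g n * expi (t * omega n + n%:~R * x).

(* f is the (unordered) sum of the series \sum_(n in Z) u n in L^2([0, P]; C). *)
Definition L2_sum (R : realType) (P : R) (u : int -> R -> R[i])
    (f : R -> R[i]) : Prop :=
  [/\ measurable_fun `[0, P] (fun x => complex.Re (f x)),
      measurable_fun `[0, P] (fun x => complex.Im (f x)) &
      (\int[lebesgue_measure]_(x in `[0%R, P])
         ((normc (f x - \sum_(n <- (A : {fset int})) u n x) ^+ 2)%:E))%E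
        @[A --> totally] --> 0%E].

Definition hoelder_continuous (R : realType) (alpha : R) (f : R -> R[i]) : Prop :=
  exists C : R, forall x y : R, normc (f x - f y) <= C * `|x - y| `^ alpha.

Definition euclidean_ball (R : realType) (p : R * R) (e : R) : set (R * R) :=
  [set q | Num.sqrt ((q.1 - p.1) ^+ 2 + (q.2 - p.2) ^+ 2) < e].

(* Minimum number of e-balls needed to cover E (+oo if there is no finite
   cover). *)
Definition covering_number (R : realType) (E : set (R * R)) (e : R) : \bar R :=
  ereal_inf [set n%:R%:E | n in
    [set n : nat | exists p : 'I_n -> R * R,
       E `<=` \bigcup_i euclidean_ball (p i) e]].

Definition fractal_dim (R : realType) (E : set (R * R)) : \bar R :=
  limf_esup (fun e : R => lne (covering_number E e) / (ln (1 / e))%:E)%E 0^'+.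

Definition graph_on (R : realType) (D : set R) (h : R -> R) : set (R * R) :=
  [set (x, h x) | x in D].

(* Main.v *)
(* Along the line t = c - r x the n-th term of the series has frequency
   n - r omega(n) in x.  Since n g^(n) is a combination of the exponentials
   exp(-i n y) over the jumps y of g, Abel summation reduces the tails and the
   increments of f to the sums of exp(i ((c - r x) omega(n) + n (x - y))).  The
   leading coefficient is proportional to c - r x, and it determines the linear
   coefficient up to c / r: for almost every c the two are never both close to
   rationals of small denominator, and Weyl differencing bounds the sums over
   n < N by N^(1 - s), uniformly in x, for every s < 1 / (2^d + 1).  So f is
   Hoelder of every exponent below s / d, which gives the upper bound.

   For the lower bound let F be the increment of f over a step of order M^-d.
   On average over a period it is tested against a polynomial T with the
   frequencies n - r omega(n), M < n <= 2 M, whose bounded coefficients undo the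
   increment and single out one jump of g.  The diagonal of the mean of F T tends
   to the size of that jump.  The rest comes from coincidences of frequencies;
   it is O(M^(-1/2)) in L^2 as a function of c, so for almost every c it is small
   for infinitely many M.  The mean of F^2 is O(1 / M), and by the divisor bound
   that of T^4 is O(M^(2 + eps)); Hoelder's inequality shows that the mean of |F|
   is at least M^(-1/2 - eps).  The variation at scale M^-d thus is
   M^(d - 1/2 - eps), and covering the graphs at that scale takes
   M^(2 d - 1/2 - eps) balls. *)

Require Import Defs.
From HB Require Import structures.
From mathcomp Require Import all_boot all_order all_algebra finmap.
From mathcomp Require Import all_classical all_reals all_analysis.
From mathcomp Require Import complex.
From mathcomp Require Import measurable_realfun.
From mathcomp Require Import zify ring lra.
From mathcomp.analysis.showcase Require Import summability.

Set Implicit Arguments.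
Unset Strict Implicit.
Unset Printing Implicit Defensive.

Import Order.TTheory GRing.Theory Num.Theory.
Import numFieldNormedType.Exports.
Import ComplexField.Normc.

Local Open Scope classical_set_scope.
Local Open Scope ring_scope.
Local Open Scope complex_scope.

(** In the first half the difficulty is uniformity in [x]: as [x] moves, the leading coefficient
    [alpha = (c - r x) / (2 pi)] passes through every rational, where Weyl's inequality alone gives
    nothing. With [r = k / l] and the linear coefficient [z = (x - y) / (2 pi)], the combination
    [k z + l alpha] does not contain [x]; requiring it to be Diophantine removes a null set of [c]
    once for all [x], and near a rational of small denominator the linear phase then supplies the
    cancellation. In the second half the trivial bound [O(M)] for the test polynomial would only
    give [1 / M] for the mean increment; the fourth moment is what brings the exponent to 1/2. Since
    [n - r omega(n)] need not be injective, terms with distinct indices can resonate for a given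
    [c]. On such a collision [n - j] is proportional to [omega(n) - omega(j)], so few collisions
    share a frequency in the variable [c], and averaging over [c] disposes of them. Means in [x] are
    taken over finite grids: orthogonality becomes a finite geometric sum, and the grid increments
    are directly those of a variation. *)

(** * Complex modulus, exponentials, geometric sums and Abel summation *)

Section ComplexPreliminaries.
Variable R : realType.
Implicit Types (z w : R[i]) (x y : R).

Lemma normc_ge0 z : 0 <= normc z.
Proof. by case: z => a b; exact: sqrtr_ge0. Qed.

Lemma normcB z w : normc (z - w) = normc (w - z).
Proof. by rewrite -[LHS]normcN opprB. Qed.

Lemma normcD_le z w : normc (z + w) <= normc z + normc w.
Proof. exact: le_normcD. Qed.

Lemma normcB_le z w : normc (z - w) <= normc z + normc w.
Proof. by rewrite (le_trans (normcD_le _ _))// normcN. Qed.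

Lemma normcB_trans z w t : normc (z - w) <= normc (z - t) + normc (t - w).
Proof. by rewrite (le_trans _ (normcD_le _ _))// addrA subrK. Qed.

Lemma normc_sum (I : Type) (s : seq I) (P : pred I) (F : I -> R[i]) :
  normc (\sum_(i <- s | P i) F i) <= \sum_(i <- s | P i) normc (F i).
Proof.
elim/big_rec2: _ => [|i x z _ h]; first by rewrite normc0.
by rewrite (le_trans (normcD_le _ _))// lerD2l.
Qed.

Lemma normcX z n : normc (z ^+ n) = normc z ^+ n.
Proof. by elim: n => [|n IH]; rewrite ?expr0 ?normc1// !exprS normcM IH. Qed.

Lemma sqr_normcE z : normc z ^+ 2 = complex.Re z ^+ 2 + complex.Im z ^+ 2.
Proof. by case: z => a b; rewrite sqr_sqrtr// addr_ge0 ?sqr_ge0. Qed.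

Lemma normc_real x : normc x%:C = `|x|.
Proof. by rewrite /= expr0n /= addr0 sqrtr_sqr. Qed.

Lemma normc_nat n : normc (n%:R : R[i]) = n%:R.
Proof. by rewrite -(rmorph_nat (real_complex R)) normc_real ger0_norm. Qed.

Lemma normc_conj z : normc z^*%C = normc z.
Proof. by case: z => a b; rewrite /= sqrrN. Qed.

Lemma mulc_conj z : z * z^*%C = (normc z ^+ 2)%:C.
Proof.
rewrite sqr_normcE; case: z => a b /=; simpc.
by congr (_ +i* _); ring.
Qed.

Lemma normc_Re_le z : `|complex.Re z| <= normc z.
Proof.
by rewrite -sqrtr_sqr; case: z => a b /=; rewrite ler_wsqrtr// lerDl sqr_ge0.
Qed.

Lemma normc_Im_le z : `|complex.Im z| <= normc z.
Proof.
by rewrite -sqrtr_sqr; case: z => a b /=; rewrite ler_wsqrtr// lerDr sqr_ge0.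
Qed.

Lemma normc_le_ReIm z : normc z <= `|complex.Re z| + `|complex.Im z|.
Proof.
rewrite -(ler_pXn2r (n := 2)) ?nnegrE ?normc_ge0 ?addr_ge0//.
rewrite sqr_normcE sqrrD !real_normK ?num_real// lerD2r lerDl.
by rewrite mulrn_wge0// mulr_ge0.
Qed.

Lemma expiD x y : expi (x + y) = expi x * expi y.
Proof.
rewrite /expi cosD sinD; apply/eqP; rewrite eq_complex /=.
by apply/andP; split; apply/eqP; ring.
Qed.

Lemma expi0 : expi (0 : R) = 1.
Proof. by rewrite /expi cos0 sin0. Qed.

Lemma expiN x : expi (- x) = (expi x)^*%C.
Proof. by rewrite /expi cosN sinN. Qed.

Lemma normc_expi x : normc (expi x) = 1.
Proof. by rewrite /expi /= cos2Dsin2 sqrtr1. Qed.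

Lemma expiNK x : expi (- x) * expi x = 1.
Proof. by rewrite -expiD addNr expi0. Qed.

Lemma expiMn x n : expi (x *+ n) = expi x ^+ n.
Proof. by elim: n => [|n IH]; rewrite ?mulr0n ?expi0// mulrS expiD IH exprS. Qed.

Lemma expiM_nat x n : expi (n%:R * x) = expi x ^+ n.
Proof. by rewrite mulr_natl expiMn. Qed.

Lemma expi_2pi_nat n : expi (2 * pi * n%:R : R) = 1.
Proof.
rewrite mulrC expiM_nat mulr_natl /expi cos2pi sin2pi; exact: expr1n.
Qed.

Lemma expi_2pi_int (k : int) : expi (2 * pi * k%:~R : R) = 1.
Proof.
case: k => n; first exact: expi_2pi_nat.
by rewrite NegzE mulrNz mulrN expiN expi_2pi_nat conjc1.
Qed.

Lemma expi_period x (k : int) : expi (x + 2 * pi * k%:~R) = expi x.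
Proof. by rewrite expiD expi_2pi_int mulr1. Qed.

Lemma sqr_normc_expiB1 x : normc (expi x - 1) ^+ 2 = 4 * sin (x / 2) ^+ 2.
Proof.
have hx : x = (x / 2) *+ 2 by rewrite -mulr_natr divfK ?pnatr_eq0.
rewrite sqr_normcE /= subr0 [in X in cos X]hx [in X in sin X]hx.
rewrite cos_mulr2n sin_mulr2n.
have := cos2sin2 (x / 2); set co := cos _; set si := sin _ => h.
rewrite (_ : (co * si *+ 2) ^+ 2 = 4 * co ^+ 2 * si ^+ 2); last by ring.
by rewrite h; ring.
Qed.

Lemma normc_expiB1 x : normc (expi x - 1) = 2 * `|sin (x / 2)|.
Proof.
apply: (pexpIrn (n := 2)); rewrite ?nnegrE ?normc_ge0 ?mulr_ge0//.
by rewrite sqr_normc_expiB1 exprMn real_normK ?num_real//; ring.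
Qed.

Lemma normc_expi_le2 x y : normc (expi x - expi y) <= 2.
Proof. by rewrite (le_trans (normcB_le _ _))// !normc_expi. Qed.

Lemma sin_le_id x : 0 <= x -> sin x <= x.
Proof.
rewrite le_eqVlt => /predU1P[<-|x0]; first by rewrite sin0.
have [|c /itvP cx] := @MVT _ sin cos 0 x x0 (fun y _ => is_derive_sin y).
  by apply: continuous_subspaceT => y; exact: continuous_sin.
rewrite sin0 !subr0 => ->; rewrite -[leRHS]mul1r ler_wpM2r ?cos_le1// ltW//.
Qed.

Lemma abs_sin_le x : `|sin x| <= `|x|.
Proof.
wlog x0 : x / 0 <= x => [H|].
  have [/H//|/ltW x0] := leP 0 x.
  by rewrite -normrN -sinN -[leRHS]normrN H// oppr_ge0.
rewrite [leRHS]ger0_norm// ler_norml sin_le_id// andbT.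
have [x1|x1] := leP x 1.
  rewrite (@le_trans _ _ 0)// ?oppr_le0// sin_ge0_pi// x0/=.
  by rewrite (le_trans x1)// (le_trans _ (pi_ge2 R))// ler1n.
by rewrite (@le_trans _ _ (-1)) ?sin_geN1// lerN2 ltW.
Qed.

Lemma normc_expiB1_le x : normc (expi x - 1) <= `|x|.
Proof.
rewrite normc_expiB1 (le_trans (ler_wpM2l _ (abs_sin_le _)))//.
by rewrite normrM (@ger0_norm _ 2^-1) ?invr_ge0//; lra.
Qed.

Lemma normc_expiB_le x y : normc (expi x - expi y) <= `|x - y|.
Proof.
rewrite (_ : expi x - expi y = expi y * (expi (x - y) - 1)).
  by rewrite normcM normc_expi mul1r normc_expiB1_le.
by rewrite mulrBr -expiD mulr1 addrCA subrr addr0.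
Qed.

(** On [[0, 1]] the mean value theorem gives [sin y >= y / 2], because [cos] is at least 1/2 there.
    Beyond 1 the sine increases and [pi / 2 < 2], so [sin x >= sin 1 >= 1/2 >= x / 4]. *)
Lemma sin_ge_quarter x : 0 <= x <= pi / 2 -> x / 4 <= sin x.
Proof.
have half y : 0 <= y <= 1 -> y / 2 <= sin y.
  move=> /andP[y0 y1]; case: (ltgtP 0 y) y0 => // [y0 _|<- _]; last first.
    by rewrite mul0r sin0.
  have [|c /itvP cy] := @MVT _ sin cos 0 y y0 (fun t _ => is_derive_sin t).
    by apply: continuous_subspaceT => t; exact: continuous_sin.
  rewrite sin0 !subr0 => ->; rewrite mulrC ler_wpM2r// ?(ltW y0)//.
  have c1 : 0 <= c <= 1 by rewrite cy/= (le_trans _ y1)// cy.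
  have c2 : cos c = 1 - 2 * sin (c / 2) ^+ 2.
    rewrite [in LHS](_ : c = (c / 2) *+ 2).
      by rewrite cos_mulr2n cos2sin2; ring.
    by rewrite -mulr_natr divfK ?pnatr_eq0.
  have s1 : sin (c / 2) <= c / 2 by apply: sin_le_id; lra.
  have s0 : 0 <= sin (c / 2) by apply: sin_ge0_pi; have := pi_ge2 R; lra.
  have : sin (c / 2) ^+ 2 <= (1 / 2) ^+ 2.
    by rewrite ler_pXn2r ?nnegrE//; lra.
  by rewrite c2; lra.
move=> /andP[x0 xpi]; have [x1|x1] := leP x 1.
  by rewrite (le_trans _ (half x _)) ?x0//; lra.
have pi2 := pi_ge2 R; have pi4 := pihalf_lt2 R.
rewrite (@le_trans _ _ (sin 1))//; first by have := half 1; lra.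
by rewrite ltW// ltr_sin// in_itv/=; lra.
Qed.

(** The modulus is [2 |sin (pi x)|]; subtracting the floor reduces to [0 <= x < 1], and the half
    beyond 1/2 is reflected to [1 - x]. *)
Lemma normc_expiB1_ge x delta :
  (forall k : int, delta <= `|x - k%:~R|) -> delta <= normc (expi (2 * pi * x) - 1).
Proof.
move=> h; set y := x - (Num.floor x)%:~R.
have -> : expi (2 * pi * x) = expi (2 * pi * y).
  rewrite -[x in LHS](subrK (Num.floor x)%:~R) mulrDr expiD expi_2pi_int.
  by rewrite mulr1.
have y0 : 0 <= y by rewrite subr_ge0 floor_le.
have y1 : y < 1 by rewrite ltrBlDl -intrD1 floorD1_gt.
have hy : delta <= y by have := h (Num.floor x); rewrite ger0_norm.
have hy1 : delta <= 1 - y.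
  have := h (Num.floor x + 1); rewrite intrD1 opprD addrA -/y.
  by rewrite ler0_norm ?opprB// subr_le0 ltW.
have pi2 := pi_ge2 R.
rewrite normc_expiB1 (_ : 2 * pi * y / 2 = y * pi); last by field.
have [yh|yh] := leP y (1 / 2).
  have ypi : y <= y * pi / 2 by rewrite -mulrA ler_peMr//; lra.
  have yle : y * pi <= 1 / 2 * pi by rewrite ler_wpM2r//; lra.
  have := @sin_ge_quarter (y * pi); have := ler_norm (sin (y * pi)).
  by lra.
have -> : sin (y * pi) = sin ((1 - y) * pi).
  rewrite (_ : (1 - y) * pi = pi - y * pi); last by ring.
  by rewrite sinB sinpi cospi mul0r sub0r mulN1r opprK.
have ypi : 1 - y <= (1 - y) * pi / 2 by rewrite -mulrA ler_peMr//; lra.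
have yle : (1 - y) * pi <= 1 / 2 * pi by rewrite ler_wpM2r//; lra.
have := @sin_ge_quarter ((1 - y) * pi); have := ler_norm (sin ((1 - y) * pi)).
by lra.
Qed.

Lemma geometric_expi_le x n :
  normc (\sum_(i < n) expi (i%:R * x)) * normc (expi x - 1) <= 2.
Proof.
rewrite -normcM mulrC.
under eq_bigr do rewrite expiM_nat.
by rewrite -subrX1 -expiM_nat -expi0 normc_expi_le2.
Qed.

(* min N (2 / |e^{ix} - 1|), avoiding the division by 0. *)
Definition geom_bound (N : nat) x : R :=
  if normc (expi x - 1) * N%:R <= 2 then N%:R else 2 / normc (expi x - 1).

Lemma geom_bound_ge0 N x : 0 <= geom_bound N x.
Proof. by rewrite /geom_bound; case: ifP => // _; rewrite divr_ge0 ?normc_ge0. Qed.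

Lemma geom_bound_le N x : geom_bound N x <= N%:R.
Proof.
rewrite /geom_bound; case: ifP => [//|/negbT]; rewrite -ltNge => h.
have p : 0 < normc (expi x - 1).
  rewrite lt0r normc_ge0 andbT; apply/eqP => p; move: h.
  by rewrite p mul0r => h; lra.
by rewrite ler_pdivrMr// ltW// mulrC.
Qed.

Lemma geom_boundN N x : geom_bound N (- x) = geom_bound N x.
Proof.
suff e : normc (expi (- x) - 1) = normc (expi x - 1) by rewrite /geom_bound e.
rewrite -[LHS]mul1r -(normc_expi x) -normcM mulrBr mulr1 -expiD subrr expi0.
by rewrite normcB.
Qed.

Lemma geom_bound_le_inv N x delta : 0 < delta ->
  delta <= normc (expi x - 1) -> geom_bound N x <= 2 / delta.
Proof.
move=> d0 h; have p : 0 < normc (expi x - 1) by rewrite (lt_le_trans d0).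
rewrite (@le_trans _ _ (2 / normc (expi x - 1)))//.
  by rewrite /geom_bound; case: ifP => // h'; rewrite ler_pdivlMr// mulrC.
by rewrite ler_pM2l// lef_pV2 ?posrE.
Qed.

Lemma arithmetic_phase_le (L N : nat) a x : (L <= N)%N ->
  normc (\sum_(i < L) expi (a + i%:R * x)) <= geom_bound N x.
Proof.
move=> LN; under eq_bigr do rewrite expiD.
rewrite -mulr_sumr normcM normc_expi mul1r /geom_bound.
case: ifP => [_|/negbT].
  rewrite (le_trans (normc_sum _ _ _))//.
  under eq_bigr do rewrite normc_expi.
  by rewrite sumr_const card_ord ler_nat.
rewrite -ltNge => h; have p : 0 < normc (expi x - 1).
  rewrite lt0r normc_ge0 andbT; apply/eqP => p; move: h.
  by rewrite p mul0r => h; lra.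
by rewrite ler_pdivlMr// geometric_expi_le.
Qed.

Lemma abel_summation (u w : nat -> R[i]) (N M : nat) : (N <= M)%N ->
  \sum_(N <= i < M) w i * u i =
  w M * (\sum_(i < M) u i) - w N * (\sum_(i < N) u i)
  - \sum_(N <= i < M) (w i.+1 - w i) * (\sum_(j < i.+1) u j).
Proof.
move=> /subnK <-; elim: (M - N)%N => [|k IH].
  by rewrite add0n !big_geq// subr0 subrr.
rewrite addSn !big_nat_recr ?leq_addl//= IH.
rewrite !(big_ord_recr (k + N))/=; ring.
Qed.

Lemma normc_abel (u w : nat -> R[i]) (N M : nat) : (N <= M)%N ->
  normc (\sum_(N <= i < M) w i * u i) <=
  normc (w M) * normc (\sum_(i < M) u i)
  + normc (w N) * normc (\sum_(i < N) u i)
  + \sum_(N <= i < M) normc (w i.+1 - w i) * normc (\sum_(j < i.+1) u j).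
Proof.
move=> NM; rewrite abel_summation// (le_trans (normcB_le _ _))//.
rewrite lerD//; first by rewrite (le_trans (normcB_le _ _))// !normcM.
by rewrite (le_trans (normc_sum _ _ _))// ler_sum// => i _; rewrite normcM.
Qed.

End ComplexPreliminaries.

Lemma ler_sum_subset (R : numDomainType) (I : eqType) (s1 s2 : seq I) (F : I -> R) :
  uniq s1 -> {subset s1 <= s2} -> (forall i, 0 <= F i) ->
  \sum_(i <- s1) F i <= \sum_(i <- s2) F i.
Proof.
move=> + + F0; elim: s1 s2 => [|x s IH] s2 /=.
  by move=> _ _; rewrite big_nil sumr_ge0.
move=> /andP[xs us] sub; have xs2 : x \in s2 by rewrite sub// mem_head.
rewrite (big_rem x xs2) big_cons lerD2l IH// => y ys.
have := sub y; rewrite in_cons ys orbT => /(_ isT).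
rewrite (perm_mem (perm_to_rem xs2)) in_cons => /orP[/eqP yx|//].
by rewrite -yx ys in xs.
Qed.

(** * The divisor bound *)

Section DivisorBound.
Local Open Scope nat_scope.

Lemma size_divisors_pfactor p a m : prime p -> ~~ (p %| m) -> 0 < m ->
  size (divisors (p ^ a * m)) <= a.+1 * size (divisors m).
Proof.
move=> pp pm m0.
have -> : a.+1 * size (divisors m)
    = size [seq p ^ i * e | i <- iota 0 a.+1, e <- divisors m].
  by rewrite size_allpairs size_iota.
have pa0 : 0 < p ^ a * m by rewrite muln_gt0 expn_gt0 prime_gt0.
apply: uniq_leq_size; first exact: divisors_uniq.
move=> e; rewrite -dvdn_divisors// => ed.
have e0 : 0 < e by rewrite (dvdn_gt0 pa0).
have [e' ce' ee] := pfactor_coprime pp e0.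
set i := logn p e in ee; rewrite ee in ed.
apply/allpairsP; exists (i, e'); split => /=; last by rewrite mulnC.
- change (i \in iota 0 a.+1); rewrite mem_iota add0n ltnS -(dvdn_Pexp2l i a (prime_gt1 pp)).
  have cm : coprime (p ^ i) m by rewrite coprimeXl// prime_coprime.
  by rewrite -(Gauss_dvdl _ cm) (dvdn_trans _ ed)// dvdn_mull.
- rewrite -dvdn_divisors// -(@Gauss_dvdr _ (p ^ a)).
    by rewrite (dvdn_trans _ ed)// dvdn_mulr.
  by rewrite coprime_sym coprimeXl.
Qed.

(** Write [a + 1 <= k (a %/ k + 1) <= k 2^(a %/ k)] and raise to the power [k]. *)
Lemma expn_succ_le k a : 0 < k -> (a.+1) ^ k <= k ^ k * 2 ^ a.
Proof.
move=> k0; rewrite (@leq_trans ((k * 2 ^ (a %/ k)) ^ k))//.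
  rewrite leq_exp2r// (@leq_trans (k * (a %/ k).+1))//.
    by rewrite mulnC ltn_ceil.
  by rewrite leq_mul2l ltn_expl ?orbT.
by rewrite expnMn leq_mul2l -expnM leq_exp2l// leq_divM orbT.
Qed.

(** The smallest prime [p] of [m] is split off with its full power [p^a], at the cost of
    [(a + 1)^k]. This is at most [2^(a k) <= p^a] when [p >= 2^k], and at most [k^k p^a] otherwise,
    so only primes below [2^k] cost a factor [k^k]. The lower bound [b] on the prime factors limits
    how many of them are still to come; the truncated [2^k - b] is 0 once they are exhausted. *)
Lemma divisors_exp_le k b m : 0 < k -> 0 < m ->
  (forall p, prime p -> p %| m -> b <= p) ->
  size (divisors m) ^ k <= (k ^ k) ^ (2 ^ k - b) * m.
Proof.
move=> k0; have K0 : 0 < k ^ k by rewrite expn_gt0 k0.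
elim/ltn_ind: m b => m IH b m0 hb.
have [m1|m1] := leqP m 1.
  have -> : m = 1 by apply/eqP; rewrite eqn_leq m1.
  by rewrite exp1n muln1 expn_gt0 K0.
have pp := pdiv_prime m1; set p := pdiv m in pp.
have pm : p %| m := pdiv_dvd m.
have bp : b <= p := hb _ pp pm.
have [m' cm' em] := pfactor_coprime pp m0; set a := logn p m in em.
have a0 : 0 < a by rewrite logn_gt0 mem_primes pp m0.
have m'0 : 0 < m' by move: m0; rewrite em muln_gt0 => /andP[].
have m'm : m' < m by rewrite em ltn_Pmulr// -{1}(expn0 p) ltn_exp2l// prime_gt1.
have {}IH : size (divisors m') ^ k <= (k ^ k) ^ (2 ^ k - p.+1) * m'.
  apply: IH => // q pq qm'; rewrite ltn_neqAle; apply/andP; split.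
    by apply/eqP => pq'; move: cm'; rewrite prime_coprime// pq' qm'.
  by rewrite pdiv_min_dvd ?prime_gt1// em dvdn_mulr.
have hsz : size (divisors m) <= a.+1 * size (divisors m').
  by rewrite {1}em mulnC size_divisors_pfactor// -prime_coprime.
rewrite (@leq_trans ((a.+1 * size (divisors m')) ^ k)) ?leq_exp2r//.
rewrite expnMn (@leq_trans (a.+1 ^ k * ((k ^ k) ^ (2 ^ k - p.+1) * m')))//.
  by rewrite leq_mul2l IH orbT.
rewrite [X in _ <= _ * X]em; have [pB|pB] := ltnP p (2 ^ k).
  rewrite (@leq_trans ((k ^ k * p ^ a) * ((k ^ k) ^ (2 ^ k - p.+1) * m')))//.
    rewrite leq_mul2r (leq_trans (expn_succ_le _ k0)) ?orbT//.
    by rewrite leq_mul2l leq_exp2r ?prime_gt1// orbT.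
  rewrite (_ : _ * _ = (k ^ k) ^ (2 ^ k - p.+1).+1 * (m' * p ^ a)); last first.
    by rewrite expnS; lia.
  by rewrite leq_mul2r leq_pexp2l ?orbT// subnSK// leq_sub2l.
rewrite (eqP (_ : 2 ^ k - p.+1 == 0)) ?subn_eq0 ?(leq_trans pB)// expn0 mul1n.
rewrite (@leq_trans (p ^ a * m'))//.
  rewrite leq_mul2r (@leq_trans ((2 ^ a) ^ k)) ?orbT//.
    by rewrite leq_exp2r// ltn_expl.
  by rewrite -expnM mulnC expnM leq_exp2r.
by rewrite mulnC leq_pmull// expn_gt0 K0.
Qed.

End DivisorBound.

(** The [k]-th root of the preceding estimate, with [1 / k <= eps]. *)
Lemma divisor_bound (R : realType) (eps : R) : 0 < eps -> exists C : R, 0 < C /\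
  forall m : nat, (0 < m)%N -> (size (divisors m))%:R <= C * m%:R `^ eps.
Proof.
move=> eps0; pose k := (Num.truncn eps^-1).+1.
have k0 : (0 : R) < k%:R by rewrite ltr0n.
have keps : k%:R^-1 <= eps.
  rewrite -[eps]invrK lef_pV2 ?posrE ?invr_gt0//.
  by rewrite ltW// truncnS_gt.
pose K : R := ((k ^ k) ^ (2 ^ k))%:R.
have K0 : 0 < K by rewrite ltr0n !expn_gt0.
exists (K `^ k%:R^-1); split; first by rewrite powR_gt0.
move=> m m0; set t := size _.
have h : t%:R ^+ k <= K * m%:R :> R.
  rewrite -natrX /K -natrM ler_nat -[(2 ^ k)%N]subn0.
  exact: divisors_exp_le.
have -> : t%:R = (t%:R ^+ k) `^ k%:R^-1 :> R.
  by rewrite -powR_mulrn// -powRrM mulfV ?lt0r_neq0// powRr1.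
rewrite (@le_trans _ _ ((K * m%:R) `^ k%:R^-1))//.
  by rewrite ge0_ler_powR ?nnegrE ?invr_ge0 ?exprn_ge0 ?mulr_ge0// ltW.
rewrite powRM ?(ltW K0)// ler_wpM2l ?powR_ge0// ler_powR//.
by rewrite ler1n.
Qed.

(** * Van der Corput's inequality and Weyl differencing *)

Section WeylDifferencing.
Variable R : realType.

(** Pairs [m < n] are grouped by the difference [h = n - m]. *)
Lemma sum_nat_lt_convol (V : zmodType) (F : nat -> nat -> V) L :
  \sum_(n < L) \sum_(m < n) F n m =
  \sum_(1 <= h < L) \sum_(n < L - h) F (n + h)%N n.
Proof.
elim: L => [|L IH]; first by rewrite big_ord0 big_geq.
rewrite big_ord_recr /= IH; case: L {IH} => [|L].
  by rewrite big_ord0 addr0 !big_geq.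
rewrite [RHS]big_nat_recr//= subSnn big_ord1 add0n.
have -> : \sum_(m < L.+1) F L.+1 m = F L.+1 0%N + \sum_(1 <= m < L.+1) F L.+1 m.
  by rewrite -(big_mkord xpredT (F L.+1)) big_ltn.
rewrite addrA addrAC; congr (_ + _).
under [in RHS]eq_big_nat => h /andP[h0 hL] do
  rewrite subSn ?(ltnW hL)// big_ord_recr /= subnK ?(ltnW hL)//.
rewrite big_split /=; congr (_ + _).
rewrite big_nat_rev/= -[in RHS](addn0 1%N).
by apply: eq_big_nat => h /andP[h0 hL]; congr (F _ _); lia.
Qed.

Lemma sqr_normc_sum (z : nat -> R[i]) L :
  (normc (\sum_(n < L) z n) ^+ 2)%:C = \sum_(n < L) (normc (z n) ^+ 2)%:C
   + \sum_(n < L) \sum_(m < n) z n * (z m)^*%C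
   + (\sum_(n < L) \sum_(m < n) z n * (z m)^*%C)^*%C.
Proof.
elim: L => [|L IH].
  rewrite !big_ord0 normc0 expr0n/=.
  by apply/eqP; rewrite eq_complex/= !oppr0 !addr0 !eqxx.
rewrite !big_ord_recr/= -!mulc_conj.
have -> : \sum_(m < L) z L * (z m)^*%C = z L * (\sum_(m < L) z m)^*%C.
  by rewrite -mulr_sumr rmorph_sum.
move: IH; rewrite -mulc_conj.
set A := \sum_(n < L) z n; set B := \sum_(n < L) _; set D := \sum_(n < L) _.
have cD (u v : R[i]) : (u + v)^*%C = u^*%C + v^*%C by exact: rmorphD.
have cM (u v : R[i]) : (u * v)^*%C = u^*%C * v^*%C by exact: rmorphM.
by move=> IH; rewrite !cD cM conjcK mulrDr !mulrDl IH; ring.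
Qed.

(* van der Corput *)
Lemma sqr_normc_sum_le (z : nat -> R[i]) L : (forall n, normc (z n) = 1) ->
  normc (\sum_(n < L) z n) ^+ 2 <=
  L%:R + 2 * \sum_(1 <= h < L) normc (\sum_(n < L - h) z (n + h)%N * (z n)^*%C).
Proof.
move=> z1; set U := \sum_(n < L) \sum_(m < n) z n * (z m)^*%C.
have -> : normc (\sum_(n < L) z n) ^+ 2 = normc (normc (\sum_(n < L) z n) ^+ 2)%:C.
  by rewrite normc_real ger0_norm// sqr_ge0.
rewrite sqr_normc_sum -/U (le_trans (normcD_le _ _))// normc_conj.
have hU : normc U <= \sum_(1 <= h < L) normc (\sum_(n < L - h) z (n + h)%N * (z n)^*%C).
  by rewrite /U (sum_nat_lt_convol (fun n m => z n * (z m)^*%C)) normc_sum.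
have h1 : normc (\sum_(n < L) (normc (z n) ^+ 2)%:C) <= L%:R.
  rewrite (le_trans (normc_sum _ _ _))//.
  under eq_bigr do rewrite z1 expr1n normc1.
  by rewrite sumr_const card_ord.
have := normcD_le (\sum_(n < L) (normc (z n) ^+ 2)%:C) U.
by move: hU h1; set a := normc U; set b := \sum_(_ <= _ < _) _; lra.
Qed.

Lemma sqr_sum_le (n : nat) (a : nat -> R) :
  (\sum_(i < n) a i) ^+ 2 <= n%:R * \sum_(i < n) a i ^+ 2.
Proof.
elim: n => [|n IH]; first by rewrite !big_ord0 mulr0 expr0n.
rewrite !big_ord_recr /= -natr1; move: IH.
have [->|n0] := posnP n; first by rewrite !big_ord0 !add0r mul1r.
set s := \sum_(i < n) a i; set t := \sum_(i < n) _ => IH.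
have nR : 0 < n%:R :> R by rewrite ltr0n.
rewrite -subr_ge0 -(pmulr_rge0 _ nR).
have : 0 <= (s - n%:R * a n) ^+ 2 by exact: sqr_ge0.
have : 0 <= n%:R * t - s ^+ 2 by rewrite subr_ge0.
move=> h1 h2; have := mulr_ge0 (ltW nR) h1.
by lra.
Qed.

(** The power mean inequality with exponent [2^k], by [k] applications of Cauchy-Schwarz. *)
Lemma exp2_sum_le k (n : nat) (a : nat -> R) : (forall i, 0 <= a i) ->
  (\sum_(i < n) a i) ^+ (2 ^ k) <= n%:R ^+ (2 ^ k).-1 * \sum_(i < n) a i ^+ (2 ^ k).
Proof.
elim: k a => [|k IH] a a0.
  by rewrite expn0 expr1 expr0 mul1r lexx.
rewrite expnS exprM (@le_trans _ _ ((n%:R * \sum_(i < n) a i ^+ 2) ^+ (2 ^ k)))//.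
  rewrite ler_pXn2r ?nnegrE ?expn_gt0 ?sqr_ge0 ?mulr_ge0 ?sqr_sum_le ?sumr_ge0//.
  by move=> i _; rewrite sqr_ge0.
rewrite exprMn (_ : (2 * 2 ^ k).-1 = (2 ^ k + (2 ^ k).-1)%N); last first.
  by rewrite -subn1; have := expn_gt0 2 k; lia.
rewrite exprD -mulrA ler_wpM2l ?exprn_ge0//.
rewrite (le_trans (IH (fun i => a i ^+ 2) _))// => [i|]; first exact: sqr_ge0.
by rewrite ler_wpM2l ?exprn_ge0// ler_sum// => i _; rewrite -exprM.
Qed.

Lemma exp2_add_le k (x y : R) : 0 <= x -> 0 <= y ->
  (x + y) ^+ (2 ^ k) <= 2 ^+ (2 ^ k) * (x ^+ (2 ^ k) + y ^+ (2 ^ k)).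
Proof.
move=> x0 y0; have := @exp2_sum_le k 2 (fun i => if i is 0%N then x else y).
rewrite !big_ord_recr !big_ord0/= !add0r => /(_ _)/le_trans; apply.
  by case.
rewrite ler_wpM2r ?addr_ge0 ?exprn_ge0//.
by rewrite ler_weXn2l ?ler1n// leq_pred.
Qed.

(* The (k+1)-st differences of [phi] with steps h_0, ..., h_k = 1 are equal to
   beta * h_0 * ... * h_(k-1). *)
Fixpoint diff_const (k : nat) (beta : R) (phi : nat -> R) : Prop :=
  match k with
  | 0 => forall n, phi n.+1 - phi n = beta
  | k'.+1 => forall h, diff_const k' (h%:R * beta) (fun n => phi (n + h)%N - phi n)
  end.

(** The differencing steps enter only through products, and a product [j = m h] arises from at most
    as many pairs as [j] has divisors. *)
Lemma sum_mul_divisors_le (G : nat -> R) (T N M : nat) : (forall j, 0 <= G j) ->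
  (forall j, (0 < j <= M * N)%N -> (size (divisors j) <= T)%N) ->
  \sum_(1 <= h < N.+1) \sum_(1 <= m < M.+1) G (m * h)%N <=
  T%:R * \sum_(1 <= j < (M * N).+1) G j.
Proof.
move=> G0 hT.
rewrite (@le_trans _ _ (\sum_(1 <= h < N.+1) \sum_(1 <= j < (M * N).+1) (h %| j)%N%:R * G j))//.
  rewrite big_seq [leRHS]big_seq ler_sum// => h.
  rewrite mem_index_iota => /andP[h0 hN].
  rewrite (_ : \sum_(1 <= m < M.+1) _ = \sum_(j <- [seq m * h | m <- index_iota 1 M.+1]%N) (h %| j)%N%:R * G j).
    apply: ler_sum_subset.
    - rewrite map_inj_uniq ?iota_uniq// => a b /eqP; rewrite eqn_pmul2r//.
      by move/eqP.
    - move=> _ /mapP[m + ->]; rewrite !mem_index_iota => /andP[m0 mM].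
      by rewrite muln_gt0 m0 h0/= ltnS leq_mul.
    - by move=> j; rewrite mulr_ge0.
  by rewrite big_map; apply: eq_bigr => m _; rewrite dvdn_mull// mul1r.
rewrite exchange_big/= mulr_sumr big_seq [leRHS]big_seq ler_sum// => j.
rewrite mem_index_iota => /andP[j0 jM].
rewrite -mulr_suml ler_wpM2r// -natr_sum ler_nat (leq_trans _ (hT j _)) ?j0//.
rewrite -big_mkcond/= sum1_count -size_filter uniq_leq_size ?filter_uniq ?iota_uniq// => h.
by rewrite mem_filter -dvdn_divisors// => /andP[].
Qed.

Fixpoint weyl_const (k : nat) : R :=
  if k is k'.+1 then 2 ^+ (2 ^ k') + 4 ^+ (2 ^ k') * weyl_const k' else 1.

Lemma weyl_const_ge0 k : 0 <= weyl_const k.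
Proof. by elim: k => //= k IH; rewrite addr_ge0 ?mulr_ge0 ?exprn_ge0. Qed.

(** Induction on the degree. Squaring by van der Corput replaces the phase by its differences with
    step [h], whose constant is [h beta]. The remaining power [2^k] passes inside the sum over [h]
    by the power mean inequality, and the multiples [m h] that result are collected at the cost of
    one factor [T]. Differencing shortens the sums, so one length bound [N] serves throughout. *)
Theorem weyl_differencing k (beta : R) (phi : nat -> R) (N L T : nat) :
  (L <= N)%N -> (0 < N)%N -> diff_const k beta phi ->
  (forall j, (0 < j <= N ^ k)%N -> (size (divisors j) <= T)%N) ->
  normc (\sum_(n < L) expi (phi n)) ^+ (2 ^ k) <=
  weyl_const k * N%:R ^+ (2 ^ k - k.+1) *
  (N%:R ^+ k + T%:R ^+ k * \sum_(1 <= m < (N ^ k).+1) geom_bound N (m%:R * beta)).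
Proof.
move=> + N0; have NR : 1 <= N%:R :> R by rewrite ler1n.
elim: k beta phi L => [|k IH] beta phi L LN /=.
  move=> hphi _; rewrite expn0 expr1 !expr0 !mul1r big_nat1 mul1r.
  have e n : phi n = phi 0 + n%:R * beta.
    elim: n => [|n IH]; first by rewrite mul0r addr0.
    by rewrite -(subrK (phi n) (phi n.+1)) hphi IH -natr1; ring.
  under eq_bigr do rewrite e.
  by rewrite (le_trans (arithmetic_phase_le _ _ LN))// lerDr.
move=> hphi hT; set p := (2 ^ k)%N.
have T1 : (1 <= T)%N by have := hT 1%N; rewrite expn_gt0 N0/= => /(_ isT).
have pk : (k.+1 <= p)%N by rewrite ltn_expl.
set S := \sum_(n < L) _.
pose Sh h := normc (\sum_(n < L - h) expi (phi (n + h)%N - phi n)).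
set B := N%:R ^+ k.+1 + _.
have hS2 : normc S ^+ 2 <= N%:R + 2 * \sum_(1 <= h < L) Sh h.
  rewrite (le_trans (sqr_normc_sum_le _ (fun n => normc_expi (phi n))))//.
  rewrite lerD ?ler_nat// ler_wpM2l// le_eqVlt; apply/orP; left; apply/eqP.
  apply: eq_bigr => h _; congr normc; apply: eq_bigr => n _.
  by rewrite -expiN -expiD.
have hSh h : (0 < h <= N)%N -> Sh h ^+ p <= weyl_const k * N%:R ^+ (p - k.+1) *
    (N%:R ^+ k + T%:R ^+ k * \sum_(1 <= m < (N ^ k).+1) geom_bound N (m%:R * (h%:R * beta))).
  move=> /andP[h0 hN]; apply: (IH _ (fun n => phi (n + h)%N - phi n) (L - h)%N) => // [|j /andP[j0 jN]].
    by rewrite (leq_trans (leq_subr _ _)).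
  by apply: hT; rewrite j0/= (leq_trans jN)// leq_pexp2l.
have C0 := weyl_const_ge0 k.
have hsum : \sum_(1 <= h < L) Sh h ^+ p <= weyl_const k * N%:R ^+ (p - k.+1) * B.
  rewrite (@le_trans _ _ (\sum_(1 <= h < N.+1) Sh h ^+ p))//.
    apply: ler_sum_subset; first exact: iota_uniq.
      by move=> h; rewrite !mem_index_iota => /andP[-> /leq_trans]/=; apply; rewrite ltnW.
    by move=> h; rewrite exprn_ge0 ?normc_ge0.
  rewrite (@le_trans _ _ (\sum_(1 <= h < N.+1) weyl_const k * N%:R ^+ (p - k.+1) *
    (N%:R ^+ k + T%:R ^+ k * \sum_(1 <= m < (N ^ k).+1) geom_bound N (m%:R * (h%:R * beta)))))//.
    by rewrite big_seq [leRHS]big_seq ler_sum// => h; rewrite mem_index_iota ltnS; exact: hSh.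
  rewrite -mulr_sumr ler_wpM2l ?mulr_ge0 ?exprn_ge0// big_split/=.
  rewrite lerD//; first by rewrite sumr_const_nat subn1/= exprSr mulr_natr.
  rewrite -mulr_sumr exprSr -mulrA ler_wpM2l ?exprn_ge0//.
  have := @sum_mul_divisors_le (fun j => geom_bound N (j%:R * beta)) T N (N ^ k).
  rewrite -expnSr => /(_ _ hT) H; rewrite (le_trans _ (H _))//.
    apply: ler_sum => h _; apply: ler_sum => m _.
    by rewrite natrM mulrA.
  by move=> j; exact: geom_bound_ge0.
rewrite expnS exprM (@le_trans _ _ ((N%:R + 2 * \sum_(1 <= h < L) Sh h) ^+ p))//.
  rewrite ler_pXn2r ?nnegrE ?expn_gt0 ?sqr_ge0 ?addr_ge0 ?mulr_ge0 ?sumr_ge0//.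
  by move=> h _; exact: normc_ge0.
rewrite (le_trans (exp2_add_le _ _ _)) ?mulr_ge0 ?sumr_ge0//.
  by move=> h _; exact: normc_ge0.
(* Exponent of [N]: [p - 1] comes from the power mean over the steps [h], and [p - (k + 1)] from the
   induction hypothesis; by [pk] the subtractions are not truncated. *)
have e1 : (2 * p - k.+2 = p.-1 + (p - k.+1))%N by lia.
have e2 : 2 ^+ p * 2 ^+ p = 4 ^+ p :> R by rewrite -exprMn; congr (_ ^+ _); ring.
have B1 : N%:R ^+ k.+1 <= B.
  rewrite lerDl mulr_ge0 ?exprn_ge0// sumr_ge0// => m _; exact: geom_bound_ge0.
have hL : (\sum_(1 <= h < L) Sh h) ^+ p <=
    N%:R ^+ p.-1 * (weyl_const k * N%:R ^+ (p - k.+1) * B).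
  rewrite (@le_trans _ _ (N%:R ^+ p.-1 * \sum_(1 <= h < L) Sh h ^+ p))//; last first.
    by rewrite ler_wpM2l ?exprn_ge0.
  rewrite !big_add1 !big_mkord /p (le_trans (@exp2_sum_le k L.-1 (fun i => Sh i.+1) _))//.
    by move=> i; exact: normc_ge0.
  rewrite ler_wpM2r ?sumr_ge0// => [i _|]; first by rewrite exprn_ge0 ?normc_ge0.
  by rewrite lerXn2r ?nnegrE// ler_nat (leq_trans (leq_pred _)).
have hN : N%:R ^+ p <= N%:R ^+ p.-1 * (N%:R ^+ (p - k.+1) * B).
  rewrite (@le_trans _ _ (N%:R ^+ p.-1 * (N%:R ^+ (p - k.+1) * N%:R ^+ k.+1)))//.
    rewrite -!exprD ler_weXn2l//; lia.
  by rewrite !ler_wpM2l ?exprn_ge0.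
rewrite e1 exprD exprMn.
set X := N%:R ^+ p.-1 in hL hN *; set Y := N%:R ^+ (p - k.+1) in hL hN *.
rewrite mulrDr [X in _ + X]mulrA e2.
rewrite (_ : _ * (X * Y) * B = 2 ^+ p * (X * (Y * B)) + 4 ^+ p * (X * (weyl_const k * Y * B))); last by ring.
by rewrite lerD// ler_wpM2l ?exprn_ge0.
Qed.

End WeylDifferencing.

(** * Dirichlet's approximation theorem *)

Section DirichletApproximation.
Variable R : realType.

(** Pigeonhole: the fractional parts of [0, alpha, ..., Q alpha] are [Q + 1] points in [Q] intervals
    of length [1 / Q]. *)
Lemma dirichlet_exists (alpha : R) (Q : nat) : (0 < Q)%N ->
  exists q : nat, exists a : int, (0 < q <= Q)%N /\ `|q%:R * alpha - a%:~R| <= Q%:R^-1.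
Proof.
move=> Q0; have QR : 0 < Q%:R :> R by rewrite ltr0n.
pose y (i : nat) := i%:R * alpha - (Num.floor (i%:R * alpha))%:~R.
have y0 i : 0 <= y i by rewrite subr_ge0 floor_le.
have y1 i : y i < 1 by rewrite ltrBlDl -intrD1 floorD1_gt.
have tr i : (Num.truncn (y i * Q%:R) < Q)%N.
  by rewrite truncn_lt_nat ?mulr_ge0// gtr_pMl.
pose b (i : 'I_Q.+1) := Ordinal (tr i).
have /injectivePn[i [j ij]] : ~~ injectiveb b.
  apply/negP => /injectiveP/leq_card; rewrite !card_ord; lia.
move=> /(congr1 val)/= bij.
wlog lt_ij : i j ij bij / (i < j)%N => [H|].
  have := ij; rewrite -val_eqE neq_ltn => /orP[h|h]; first exact: (H i j).
  by apply: (H j i) => //; rewrite eq_sym.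
exists (j - i)%N, (Num.floor (j%:R * alpha) - Num.floor (i%:R * alpha)); split.
  by rewrite subn_gt0 lt_ij/= (leq_trans (leq_subr _ _))// -ltnS ltn_ord.
rewrite natrB ?(ltnW lt_ij)// rmorphB/=.
rewrite (_ : _ - _ = y j - y i); last by rewrite /y; ring.
rewrite -[Q%:R^-1]mul1r ler_pdivlMr// -(ger0_norm (ltW QR)) -normrM mulrBl.
have yi : 0 <= y i * Q%:R by rewrite mulr_ge0.
have yj : 0 <= y j * Q%:R by rewrite mulr_ge0.
have := truncn_itv yi; have := truncn_itv yj.
rewrite bij -natr1 => /andP[h1 h2] /andP[h3 h4].
by rewrite ler_norml; apply/andP; split; lra.
Qed.

(** For the least denominator [q] that works, dividing out a common factor of [a] and [q] would give
    a smaller one with no larger error. *)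
Lemma dirichlet_coprime (alpha : R) (Q : nat) : (0 < Q)%N ->
  exists q : nat, exists a : int, [/\ (0 < q <= Q)%N, coprimez a q &
    `|q%:R * alpha - a%:~R| <= Q%:R^-1].
Proof.
move=> Q0; have QR : 0 < Q%:R :> R by rewrite ltr0n.
pose P q := (0 < q)%N && `[< exists a : int, `|q%:R * alpha - a%:~R| <= Q%:R^-1 >].
have exP : exists q, P q.
  have [q [a [/andP[q0 _] h]]] := dirichlet_exists alpha Q0.
  by exists q; rewrite /P q0; apply/asboolP; exists a.
case: (ex_minnP exP) => q /andP[q0 /asboolP[a ha]] qmin.
exists q, a; split => //.
  have [q' [a' [/andP[q'0 q'Q] h]]] := dirichlet_exists alpha Q0.
  rewrite q0 (leq_trans (qmin _ _) q'Q)// /P q'0; apply/asboolP; by exists a'.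
rewrite /coprimez; set g := gcdn `|a| q.
have g0 : (0 < g)%N by rewrite gcdn_gt0 q0 orbT.
have [q' eq'] : exists q', q = (q' * g)%N by apply/dvdnP; exact: dvdn_gcdr.
have [a' ea'] : exists a' : int, a = a' * g%:Z.
  by apply/dvdzP; rewrite /dvdz; exact: dvdn_gcdl.
have q'0 : (0 < q')%N by move: q0; rewrite eq' muln_gt0 => /andP[].
have gR : 1 <= g%:R :> R by rewrite ler1n.
have : (q <= q')%N.
  apply: qmin; rewrite /P q'0; apply/asboolP; exists a'.
  rewrite (le_trans _ ha)// eq' ea' natrM rmorphM/= -[g%:~R]/(g%:R).
  rewrite [X in _ <= `|X|](_ : _ = (q'%:R * alpha - a'%:~R) * g%:R); last by ring.
  rewrite normrM (@ger0_norm _ g%:R)//.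
  by rewrite ler_peMr.
rewrite {1}eq' => h; have : (g <= 1)%N.
  by rewrite -(leq_pmul2l q'0) muln1.
by rewrite /gcdz -/g; lia.
Qed.

End DirichletApproximation.

(** * Sums of geometric bounds along multiples of a real number *)

Section GeometricBoundSums.
Variable R : realType.

(** The index is a residue modulo [q]. Since [0.-1 = 0] and [0^-1 = 0], the terms [v = 0] and
    [v = 1] vanish, and for [q >= 2] this is the harmonic number of index [q - 2]. *)
Definition harm (q : nat) : R := \sum_(v < q) (v.-1)%:R^-1.

Lemma harm_ge0 q : 0 <= harm q.
Proof. by rewrite sumr_ge0// => i _; rewrite invr_ge0. Qed.

Lemma harm_le_ln q : (0 < q)%N -> harm q <= 1 + ln q%:R.
Proof.
have H p : harm p.+3 <= 1 + ln p.+1%:R.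
  elim: p => [|p IH].
    by rewrite /harm !big_ord_recr big_ord0 /= !invr0 ln1 invr1; lra.
  rewrite /harm big_ord_recr /= (le_trans (lerD IH (lexx _)))// -addrA lerD2l.
  have p1 : 0 < p.+1%:R :> R by rewrite ltr0n.
  have p2 : 0 < p.+2%:R :> R by rewrite ltr0n.
  have p1' : 1 + p.+1%:R = p.+2%:R :> R by rewrite -[p.+2]add1n natrD.
  rewrite -lerBrDl -lerN2 opprB -ln_div ?posrE//.
  rewrite (_ : p.+1%:R / p.+2%:R = 1 + - p.+2%:R^-1).
    by rewrite le_ln1Dx// ltrN2 invf_lt1// ltr1n.
  rewrite (_ : p.+1%:R = p.+2%:R - 1); last by rewrite -p1' addrAC subrr add0r.
  by rewrite mulrBl mulfV ?lt0r_neq0// mul1r.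
case: q => [//|[_|[_|q _]]].
- by rewrite /harm big_ord1/= invr0 ln1; lra.
- rewrite /harm !big_ord_recr big_ord0/= !invr0.
  by have := @ln_ge0 R 2; rewrite ler1n => /(_ isT); lra.
- rewrite (le_trans (H q))// lerD2l ler_ln ?posrE ?ltr0n// ler_nat.
  by lia.
Qed.

(** Over [q] consecutive indices the numbers [q (m0 + i) alpha] lie, up to an error in [(-1, 2)], at
    integers that run once through all residues modulo [q]. Residues next to a multiple of [q] get
    the trivial bound [N]; the others form a harmonic sum from each end. *)
Lemma block_bound (alpha : R) (q : nat) (a : int) (N m0 : nat) :
  (0 < q)%N -> coprimez a q -> `|q%:R * alpha - a%:~R| <= q%:R^-1 ->
  \sum_(i < q) geom_bound N (2 * pi * ((m0 + i)%:R * alpha)) <=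
  4 * N%:R + 4 * q%:R * harm q.
Proof.
move=> q0 cop ha; have natE (u : nat) : (1 < u)%N -> (u + 3 <= q)%N ->
    (u.-1)%:R = u%:R - 1 :> R /\ ((q.-1 - u).-1)%:R = q%:R - u%:R - 2 :> R.
  move=> u2 uq; split; first by rewrite -subn1 natrB// (ltn_trans _ u2).
  by rewrite (_ : (q.-1 - u).-1 = (q - u - 2)%N) ?natrB//; lia.
have intN1 (z : int) : z < 0 -> z%:~R <= -1 :> R.
  by move=> h; rewrite -[-1]/((-1)%:~R) ler_int; lia.
have qR : 0 < q%:R :> R by rewrite ltr0n.
have qz : (0 < q%:Z)%R by [].
pose w : int := Num.floor (q%:R * (m0%:R * alpha)).
pose eta := q%:R * (m0%:R * alpha) - w%:~R.
have eta0 : 0 <= eta by rewrite subr_ge0 floor_le.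
have eta1 : eta < 1 by rewrite ltrBlDl -intrD1 floorD1_gt.
pose vz (i : nat) : int := ((w + i%:Z * a) %% q%:Z)%Z.
have vz0 i : 0 <= vz i by rewrite modz_ge0//; lia.
have vzq i : vz i < q by rewrite ltz_pmod.
have vn i : (`|vz i| < q)%N by have := vz0 i; have := vzq i; lia.
pose v (i : 'I_q) : 'I_q := Ordinal (vn i).
have vinj : injective v.
  move=> i j /(congr1 val)/= vij; apply/eqP.
  have {vij} : vz i == vz j by have := vz0 i; have := vz0 j; lia.
  rewrite /vz eqz_mod_dvd (_ : _ - _ = (i%:Z - j%:Z) * a); last by ring.
  rewrite Gauss_dvdzl; last by rewrite coprimez_sym.
  move=> /dvdzP[k hk]; rewrite -val_eqE/=; have jq := ltn_ord j; have iq := ltn_ord i.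
  have : k = 0.
    have [k1|k1|//] := ltgtP k 0.
      have h : k * q%:Z <= - q%:Z by nia.
      by lia.
    have h : q%:Z <= k * q%:Z by nia.
    by lia.
  by move=> k0; move: hk; rewrite k0; lia.
(* The trivial bound is kept for the residues 0, 1, [q - 2], [q - 1]. Any other [u] stays, after the
   error, at distance at least [u - 1] from 0 and [q - u - 2] from [q], and the inverse of the
   minimum is at most the sum of the inverses. *)
pose b (u : nat) : R := ((u < 2) || (q < u + 3))%N%:R * N%:R
  + 2 * q%:R * (u.-1)%:R^-1 + 2 * q%:R * ((q.-1 - u).-1)%:R^-1.
have key (i : 'I_q) : geom_bound N (2 * pi * ((m0 + i)%:R * alpha)) <= b (v i).
  rewrite /b; set u := nat_of_ord (v i).
  have uz : u%:Z = vz i by rewrite /u /= gez0_abs.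
  case: (boolP ((u < 2) || (q < u + 3))%N) => [_|].
    rewrite mul1r (le_trans (geom_bound_le _ _))// -addrA lerDl.
    by rewrite addr_ge0// !mulr_ge0// invr_ge0.
  rewrite negb_or -!leqNgt => /andP[u2 uq]; rewrite mul0r add0r.
  set A := (u.-1)%:R; set B := ((q.-1 - u).-1)%:R.
  have A0 : 1 <= A by rewrite ler1n; lia.
  have B0 : 1 <= B by rewrite ler1n; lia.
  pose delta : R := Num.min A B / q%:R.
  have m0' : 0 < Num.min A B by rewrite lt_min; apply/andP; split; lra.
  have d0 : 0 < delta by rewrite divr_gt0.
  have hd : delta <= normc (expi (2 * pi * ((m0 + i)%:R * alpha)) - 1).
    apply: normc_expiB1_ge => k.
    pose e := eta + i%:R * (q%:R * alpha - a%:~R).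
    have e1 : -1 < e < 2.
      have : `|i%:R * (q%:R * alpha - a%:~R)| < 1.
        rewrite normrM ger0_norm// (le_lt_trans (ler_wpM2l _ ha))//.
        by rewrite ltr_pdivrMr// mul1r ltr_nat.
      by rewrite ltr_norml /e => /andP[h1 h2]; apply/andP; split; lra.
    pose K : int := ((w + i%:Z * a) %/ q%:Z)%Z - k.
    have eq1 : q%:R * ((m0 + i)%:R * alpha - k%:~R) = u%:R + e + q%:R * K%:~R.
      have := divz_eq (w + i%:Z * a) q%:Z; rewrite -/(vz i) -uz.
      move=> /(congr1 (fun z : int => z%:~R : R)).
      rewrite !rmorphD !rmorphM/= -!pmulrn => h.
      rewrite /e /eta /K ?natrD ?rmorphB ?rmorphN/=; move: h; set dd := (_ %/ _)%Z.
      by move=> h; lra.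
    rewrite ler_pdivrMr// -[X in _ * X](ger0_norm (ltW qR)) -normrM mulrC eq1.
    have [hA hB] := natE u u2 uq; rewrite -/A in hA; rewrite -/B in hB.
    have [K0|K0] := leP 0 K.
      have : 0 <= q%:R * K%:~R :> R by rewrite mulr_ge0// ler0z.
      rewrite ge_min; move=> h; apply/orP; left.
      by rewrite (le_trans _ (ler_norm _))// hA; lra.
    have : q%:R * K%:~R <= - q%:R :> R.
      have := intN1 K K0.
      by rewrite -[X in _ -> _ <= X]mulrN1 ler_pM2l.
    rewrite ge_min; move=> h; apply/orP; right.
    by rewrite -normrN (le_trans _ (ler_norm _))// hB; lra.
  rewrite (le_trans (geom_bound_le_inv _ d0 hd))//.
  rewrite /delta invf_div mulrA -mulrDr ler_wpM2l ?mulr_ge0//.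
  have AV : 0 <= A^-1 by rewrite invr_ge0; lra.
  have BV : 0 <= B^-1 by rewrite invr_ge0; lra.
  by rewrite /Num.min; case: ifP => _; lra.
rewrite (le_trans (ler_sum _ (fun i _ => key i)))//.
have -> : \sum_(i < q) b (v i) = \sum_(u < q) b u by rewrite [RHS](reindex_inj vinj).
rewrite /b !big_split/=.
rewrite -mulr_suml -!mulr_sumr.
have -> : \sum_(u < q) ((q.-1 - u).-1)%:R^-1 = harm q.
  rewrite /harm (reindex_inj rev_ord_inj)/=; apply: eq_bigr => u _.
  by congr (_%:R^-1); have := ltn_ord u; lia.
rewrite -[\sum_(u < q) (u.-1)%:R^-1]/(harm q).
have h4 : \sum_(u < q) ((u < 2) || (q < u + 3))%N%:R <= 4 :> R.
  rewrite -(big_mkord xpredT (fun u : nat => ((u < 2) || (q < u + 3))%N%:R : R)).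
  rewrite -natr_sum ler_nat -big_mkcond/= sum1_count -size_filter.
  rewrite (@uniq_leq_size _ _ [:: 0; 1; q.-1; q.-2]%N)//.
    by rewrite filter_uniq// iota_uniq.
  move=> u; rewrite mem_filter mem_index_iota !inE => /andP[h1 h2].
  by move: h1; lia.
have := harm_ge0 q; have := ler0n R N; nra.
Qed.

Lemma sum_geom_bound_le (alpha : R) (q : nat) (a : int) (N H : nat) :
  (0 < q)%N -> coprimez a q -> `|q%:R * alpha - a%:~R| <= q%:R^-1 ->
  \sum_(1 <= m < H.+1) geom_bound N (2 * pi * (m%:R * alpha)) <=
  (H%:R / q%:R + 1) * (4 * N%:R + 4 * q%:R * harm q).
Proof.
move=> q0 cop ha; have qR : 0 < q%:R :> R by rewrite ltr0n.
set G := fun m : nat => geom_bound N (2 * pi * (m%:R * alpha)).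
have G0 m : 0 <= G m by exact: geom_bound_ge0.
have hB B : \sum_(1 <= m < (B * q).+1) G m <= B%:R * (4 * N%:R + 4 * q%:R * harm q).
  elim: B => [|B IH]; first by rewrite mul0n big_geq// mul0r.
  rewrite (big_cat_nat (n := (B * q).+1))//=; last by rewrite ltnS leq_mul2r leqnSn orbT.
  rewrite -natr1 mulrDl mul1r lerD//.
  rewrite mulSn addnC -addSn -[X in \sum_(X <= _ < _) _]add0n big_addn addKn big_mkord.
  have := @block_bound alpha q a N (B * q).+1 q0 cop ha.
  by under eq_bigr do rewrite addnC.
rewrite (@le_trans _ _ (\sum_(1 <= m < ((H %/ q).+1 * q).+1) G m))//.
  apply: ler_sum_subset => //; first exact: iota_uniq.
  move=> m; rewrite !mem_index_iota => /andP[-> mH]/=.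
  by rewrite ltnS (leq_trans _ (ltnW (ltn_ceil H q0))).
rewrite (le_trans (hB _))// ler_wpM2r//.
  by rewrite addr_ge0 ?mulr_ge0 ?harm_ge0.
by rewrite -natr1 lerD2r ler_pdivlMr// -natrM ler_nat leq_divM.
Qed.

End GeometricBoundSums.

(** * Iterated differences of polynomials *)

Section PolynomialPhases.
Variable R : realType.

Lemma diff_const_ext k (beta : R) phi psi : phi =1 psi ->
  diff_const k beta phi -> diff_const k beta psi.
Proof. by move=> /funext ->. Qed.

(** By the Taylor expansion in Hasse derivatives, [p(n + h) - p(n)] is a polynomial in [n] of lower
    degree whose leading coefficient is that of [p] multiplied by [h] and by the degree; iterating
    produces the factorial. *)
Lemma diff_const_horner k (p : {poly R}) : (size p <= k.+2)%N ->
  diff_const k (k.+1`!%:R * p`_k.+1) (fun n => p.[n%:R]).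
Proof.
elim: k p => [|k IH] p sp /=.
  move=> n; rewrite !(horner_coef_wide _ sp) !big_ord_recr !big_ord0/= -natr1.
  by rewrite (_ : 1`! = 1%N)// !expr0 !expr1; ring.
move=> h; pose q := \sum_(1 <= i < k.+3) h%:R ^+ i *: p^`N(i).
have sN i : (size p^`N(i) <= k.+3 - i)%N.
  apply/leq_sizeP => j hj; rewrite coef_nderivn nth_default ?mul0rn//.
  by rewrite (leq_trans sp)//; lia.
have sq : (size q <= k.+2)%N.
  rewrite /q (leq_trans (size_sum _ _ _))//.
  apply/bigmax_leqP_seq => i; rewrite mem_index_iota => /andP[i0 _] _.
  rewrite (leq_trans (size_scale_leq _ _))// (leq_trans (sN i))//; lia.
have cq : q`_k.+1 = h%:R * k.+2%:R * p`_k.+2.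
  rewrite /q coef_sum big_ltn// big_nat big1 => [|i /andP[i1 i2]].
    rewrite addr0 coefZ expr1 coef_nderivn add1n bin1.
    by rewrite -mulr_natr; ring.
  by rewrite coefZ nth_default ?mulr0// (leq_trans (sN i))//; lia.
have := IH q sq; rewrite cq.
rewrite (_ : k.+1`!%:R * _ = h%:R * (k.+2`!%:R * p`_k.+2)); last first.
  by rewrite (factS k.+1) natrM; ring.
apply: diff_const_ext => n.
rewrite natrD (nderiv_taylor_wide (mulrC _ _) sp).
rewrite -(big_mkord xpredT (fun i => p^`N(i).[n%:R] * h%:R ^+ i)) big_ltn//.
rewrite nderivn0 expr0 mulr1 addrAC subrr add0r /q horner_sum.
by apply: eq_bigr => i _; rewrite hornerZ mulrC.
Qed.

End PolynomialPhases.

(** * Exponential sums with a polynomial phase *)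

Section ExponentialSums.
Variable R : realType.

Lemma powR_addr (a b c : R) : 0 < a -> a `^ (b + c) = a `^ b * a `^ c.
Proof. by move=> a0; rewrite powRD// (lt0r_neq0 a0) implybT. Qed.

Lemma ln_le_powR (x eps : R) : 1 <= x -> 0 < eps -> ln x <= eps^-1 * x `^ eps.
Proof.
move=> x1 e0; have x0 : 0 < x by rewrite (lt_le_trans ltr01).
rewrite mulrC ler_pdivlMr// mulrC -ln_powR.
have : ln (1 + (x `^ eps - 1)) <= x `^ eps - 1.
  by apply: le_ln1Dx; rewrite ltrBrDl addrN powR_gt0.
by rewrite addrC subrK; lra.
Qed.

Lemma poly_abs_le (p : {poly R}) (m : nat) : (size p <= m.+1)%N ->
  exists C : R, 0 <= C /\ forall x y, 1 <= y -> `|x| <= y -> `|p.[x]| <= C * y ^+ m.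
Proof.
move=> sp; exists (\sum_(i < m.+1) `|p`_i|); split; first exact: sumr_ge0.
move=> x y y1 xy; rewrite (horner_coef_wide _ sp) (le_trans (ler_norm_sum _ _ _))//.
rewrite mulr_suml ler_sum// => i _; rewrite normrM ler_wpM2l// normrX.
have y0 : 0 <= y by rewrite (le_trans ler01).
rewrite (@le_trans _ _ (y ^+ i))//; first by rewrite lerXn2r// nnegrE.
by rewrite ler_weXn2l// -ltnS.
Qed.

Lemma poly_diff_le (p : {poly R}) (m : nat) : (size p <= m.+2)%N ->
  exists C : R, 0 <= C /\ forall n N : nat, (n < N)%N ->
    `|p.[n.+1%:R] - p.[n%:R]| <= C * N%:R ^+ m.
Proof.
move=> sp; pose q := \sum_(1 <= i < m.+2) p^`N(i).
have sq : (size q <= m.+1)%N.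
  rewrite /q (leq_trans (size_sum _ _ _))//.
  apply/bigmax_leqP_seq => i; rewrite mem_index_iota => /andP[i0 _] _.
  apply/leq_sizeP => j hj; rewrite coef_nderivn nth_default ?mul0rn//.
  by rewrite (leq_trans sp)//; lia.
have [C [C0 hC]] := poly_abs_le sq; exists C; split => // n N nN.
rewrite (_ : _ - _ = q.[n%:R]); last first.
  rewrite -natr1 (nderiv_taylor_wide (mulrC _ _) sp).
  rewrite -(big_mkord xpredT (fun i => p^`N(i).[n%:R] * 1 ^+ i)) big_ltn//.
  rewrite nderivn0 expr0 mulr1 addrAC subrr add0r /q horner_sum.
  by apply: eq_bigr => i _; rewrite expr1n mulr1.
by apply: hC; rewrite ?ger0_norm ?ler1n ?ler_nat ?(ltnW nN)// (leq_ltn_trans _ nN).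
Qed.

Lemma dvdz_horner_sub (W : {poly int}) (x y : int) : (x - y %| W.[x] - W.[y])%Z.
Proof.
have /factor_theorem[q hq] : root (W - (W.[y])%:P) y.
  by rewrite rootE !hornerE subrr.
have := congr1 (fun p => p.[x]) hq; rewrite !hornerE => ->.
by rewrite dvdz_mull.
Qed.

Lemma horner_map_nat (W : {poly int}) n :
  (map_poly intr W).[n%:R] = (W.[n%:Z])%:~R :> R.
Proof. by rewrite -[n%:R]/(n%:Z%:~R) horner_map. Qed.

(** Multiplication by [e^{2 pi i q z}] shifts the summand by [q] places, so the sum times
    [e^{2 pi i q z} - 1] telescopes to two blocks of [q] terms. *)
Lemma periodic_coef_sum_le (F : nat -> R[i]) (z delta : R) (q L : nat) :
  (forall n, F (n + q)%N = F n) -> (forall n, normc (F n) <= 1) -> 0 < delta ->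
  (forall j : int, delta <= `|q%:R * z - j%:~R|) ->
  normc (\sum_(n < L) F n * expi (2 * pi * (n%:R * z))) <= 2 * q%:R / delta.
Proof.
move=> Fq F1 d0 hd; set E := \sum_(n < L) _.
rewrite ler_pdivlMr// (le_trans (ler_wpM2l (normc_ge0 _) (normc_expiB1_ge hd)))//.
pose G n := F n * expi (2 * pi * (n%:R * z)).
have hG n : G n * expi (2 * pi * (q%:R * z)) = G (n + q)%N.
  rewrite /G Fq -[LHS]mulrA -expiD natrD; congr (_ * expi _); ring.
have -> : normc E * normc (expi (2 * pi * (q%:R * z)) - 1) =
    normc (\sum_(n < q) G (n + L)%N - \sum_(n < q) G n).
  rewrite -normcM; congr normc; rewrite mulrBr mulr1 /E mulr_suml.
  under eq_bigr do rewrite -/(G _) hG.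
  apply/eqP; rewrite subr_eq addrAC eq_sym subr_eq; apply/eqP.
  rewrite -[\sum_(n < L) _ * _]/(\sum_(n < L) G n).
  rewrite -[X in _ = X + _]/(\sum_(n < L) G (n + q)%N).
  rewrite [LHS]addrC [RHS]addrC.
  have split m1 m2 : \sum_(n < m1) G n + \sum_(n < m2) G (n + m1)%N = \sum_(n < m1 + m2) G n.
    rewrite big_split_ord/=; congr (_ + _); apply: eq_bigr => n _.
    by rewrite addnC.
  by rewrite !split addnC.
have G1 n : normc (G n) <= 1 by rewrite normcM normc_expi mulr1.
rewrite (le_trans (normcB_le _ _))//.
have h m : normc (\sum_(n < q) G (n + m)%N) <= q%:R.
  rewrite (le_trans (normc_sum _ _ _))// (le_trans (ler_sum _ (fun i _ => G1 _)))//.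
  by rewrite sumr_const card_ord.
have := h L; have := h 0%N; under eq_bigr do rewrite addn0.
lra.
Qed.

(** Write [alpha = a / q + beta]. The phase [a W(n) / q] is [q]-periodic modulo 1, so together with
    the linear phase it has bounded partial sums when [q z] stays away from the integers. The
    remaining factor [e^{2 pi i beta W(n)}] has variation [O(|beta| N^(m + 1))] and is removed by
    Abel summation. *)
Lemma expsum_small_q (W : {poly int}) m : (size W <= m.+2)%N ->
  exists C : R, 0 <= C /\ forall (alpha z delta : R) (q : nat) (a : int) (N L : nat),
    (L <= N)%N -> (0 < q)%N -> 0 < delta ->
    (forall j : int, delta <= `|q%:R * z - j%:~R|) ->
    normc (\sum_(n < L) expi (2 * pi * (alpha * (W.[n%:Z])%:~R + n%:R * z))) <=
    2 / delta * (q%:R + C * `|q%:R * alpha - a%:~R| * N%:R ^+ m.+1).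
Proof.
move=> sW; pose p : {poly R} := map_poly intr W.
have sp : (size p <= m.+2)%N by rewrite (leq_trans (size_poly _ _)).
have [C [C0 hC]] := poly_diff_le sp.
exists (2 * pi * C); split; first by rewrite !mulr_ge0 ?pi_ge0.
move=> alpha z delta q a N L LN q0 d0 hd.
have qR : 0 < q%:R :> R by rewrite ltr0n.
pose beta := alpha - a%:~R / q%:R.
pose F n : R[i] := expi (2 * pi * (a%:~R / q%:R * (W.[n%:Z])%:~R)).
pose u n := F n * expi (2 * pi * (n%:R * z)).
pose w n : R[i] := expi (2 * pi * (beta * (W.[n%:Z])%:~R)).
have Fq n : F (n + q)%N = F n.
  have /dvdzP[e he] := dvdz_horner_sub W (n + q)%N%:Z n%:Z.
  rewrite /F -[W.[(n + q)%N%:Z]](subrK W.[n%:Z]) he.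
  rewrite (_ : (n + q)%N%:Z - n%:Z = q%:Z); last by rewrite PoszD addrC addKr.
  rewrite (_ : 2 * pi * _ = 2 * pi * (a%:~R / q%:R * (W.[n%:Z])%:~R) + 2 * pi * (a * e)%:~R).
    by rewrite expi_period.
  rewrite rmorphD !rmorphM/= -!pmulrn; field; exact: lt0r_neq0.
have hE M : normc (\sum_(n < M) u n) <= 2 * q%:R / delta.
  by apply: periodic_coef_sum_le => // n; rewrite normc_expi.
have -> : \sum_(n < L) expi (2 * pi * (alpha * (W.[n%:Z])%:~R + n%:R * z)) =
    \sum_(0 <= n < L) w n * u n.
  rewrite big_mkord; apply: eq_bigr => n _; rewrite /w /u /F -!expiD; congr expi.
  by rewrite /beta; ring.
rewrite (le_trans (normc_abel _ _ _))// big_ord0 normc0 mulr0 addr0 normc_expi mul1r.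
have hw n : (n < L)%N -> normc (w n.+1 - w n) <= 2 * pi * (`|beta| * (C * N%:R ^+ m)).
  move=> nL; rewrite (le_trans (normc_expiB_le _ _))// -mulrBr normrM.
  rewrite [X in X * _]ger0_norm ?mulr_ge0 ?pi_ge0// ler_wpM2l ?mulr_ge0 ?pi_ge0//.
  rewrite -mulrBr normrM ler_wpM2l//.
  have := hC n N (leq_trans nL LN).
  by rewrite /p !horner_map_nat.
set B := 2 * q%:R / delta in hE *.
have B0 : 0 <= B by rewrite (le_trans _ (hE 0%N))// normc_ge0.
have -> : 2 / delta * (q%:R + 2 * pi * C * `|q%:R * alpha - a%:~R| * N%:R ^+ m.+1) =
    B + N%:R * (2 * pi * (`|beta| * (C * N%:R ^+ m)) * B).
  rewrite (_ : q%:R * alpha - a%:~R = q%:R * beta); last first.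
    by rewrite /beta; field; rewrite lt0r_neq0.
  rewrite normrM (@ger0_norm _ q%:R)// exprS /B; ring.
rewrite lerD//.
rewrite (@le_trans _ _ (\sum_(0 <= i < L) (2 * pi * (`|beta| * (C * N%:R ^+ m)) * B)))//.
  rewrite big_nat [leRHS]big_nat ler_sum// => i /andP[_ iL].
  by rewrite ler_pM ?normc_ge0// hw.
rewrite sumr_const_nat subn0 -[leLHS]mulr_natl ler_wpM2r ?ler_nat//.
have p0 := pi_ge0 R; have n0 : 0 <= N%:R ^+ m :> R by exact: exprn_ge0.
by apply: mulr_ge0 => //; apply: mulr_ge0; apply: mulr_ge0 => //; apply: mulr_ge0.
Qed.

(** Weyl's inequality. For [q] between [N^kappa] and [N^(k + 1 - kappa)], each of the four terms of
    [(N^k / q + 1) (N + q log q)] is [O(N^(k + 1 - kappa))] up to a logarithm. *)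
Lemma expsum_large_q (W : {poly int}) k (kappa eps : R) :
  size W = k.+2 -> (0 < k)%N -> 0 < eps -> 0 <= kappa <= 1 ->
  exists C : R, 0 <= C /\ forall (alpha z : R) (q : nat) (a : int) (N L : nat),
    (L <= N)%N -> (0 < N)%N -> (0 < q)%N -> coprimez a q ->
    `|q%:R * alpha - a%:~R| <= q%:R^-1 ->
    N%:R `^ kappa <= q%:R -> q%:R <= N%:R `^ (k.+1%:R - kappa) ->
    normc (\sum_(n < L) expi (2 * pi * (alpha * (W.[n%:Z])%:~R + n%:R * z)))
      ^+ (2 ^ k) <= C * N%:R `^ ((2 ^ k)%:R - kappa + eps).
Proof.
move=> sW k0 e0 /andP[kap0 kap1]; pose p : {poly R} := map_poly intr W.
(* The losses are [k] factors [T], each [O(N^(k eps1))], and one logarithm [O(N^eps1)]: the exponent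
   [(k^2 + 1) eps1] in all. *)
pose eps1 := eps / (k ^ 2 + 1)%:R.
have e10 : 0 < eps1 by rewrite divr_gt0// ltr0n addn1.
have [D [D0 hD]] := divisor_bound e10.
pose A : int := W`_k.+1.
pose B0 := (k.+1`! * `|A|)%N.
pose Hc : R := 1 + k.+1%:R / eps1.
have Hc0 : 0 <= Hc by rewrite addr_ge0// divr_ge0// ltW.
have wc0 := weyl_const_ge0 R k.
exists (weyl_const R k * (1 + D ^+ k * (16 * Hc * (B0%:R + 1)))).
split.
  apply: mulr_ge0 => //; apply: addr_ge0 => //; apply: mulr_ge0.
    by rewrite exprn_ge0// ltW.
  by apply: mulr_ge0; [exact: mulr_ge0|exact: addr_ge0].
move=> alpha z q a N L LN N0 q0 cop ha qlo qhi.
have NR : 1 <= N%:R :> R by rewrite ler1n.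
have NR0 : 0 < N%:R :> R by rewrite ltr0n.
have qR : 1 <= q%:R :> R by rewrite ler1n.
have qR0 : 0 < q%:R :> R by rewrite ltr0n.
have N1 e : 0 <= e -> 1 <= N%:R `^ e :> R.
  by move=> e1; rewrite -[leLHS](powRr0 N%:R) ler_powR.
pose P : {poly R} := 2 * pi * alpha *: p + 2 * pi * z *: 'X.
have sP : (size P <= k.+2)%N.
  rewrite (leq_trans (size_polyD _ _))// geq_max; apply/andP; split.
    by rewrite (leq_trans (size_scale_leq _ _))// (leq_trans (size_poly _ _))// sW.
  by rewrite (leq_trans (size_scale_leq _ _))// size_polyX.
have cP : P`_k.+1 = 2 * pi * alpha * A%:~R.
  rewrite coefD !coefZ coefX coef_map_id0 ?rmorph0//= (_ : (k.+1 == 1)%N = false).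
    by rewrite mulr0 addr0.
  by rewrite eqSS eqn0Ngt k0.
have eP n : P.[n%:R] = 2 * pi * (alpha * (W.[n%:Z])%:~R + n%:R * z).
  by rewrite hornerD !hornerZ hornerX /p horner_map_nat; ring.
have := diff_const_horner sP; rewrite cP => hdiff.
pose Tr : R := D * N%:R `^ (k%:R * eps1).
have Tr0 : 0 <= Tr by rewrite mulr_ge0 ?powR_ge0// ltW.
pose T := Num.truncn Tr.
have TTr : T%:R <= Tr by have /andP[] := truncn_itv Tr0.
have hT j : (0 < j <= N ^ k)%N -> (size (divisors j) <= T)%N.
  move=> /andP[j0 jN]; rewrite truncn_ge_nat// (le_trans (hD j j0))//.
  rewrite ler_wpM2l ?(ltW D0)// powRrM powR_mulrn//.
  by rewrite ge0_ler_powR ?nnegrE ?exprn_ge0 ?(ltW e10)// -natrX ler_nat.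
have := weyl_differencing LN N0 hdiff hT.
under eq_bigr do rewrite eP.
move=> /le_trans; apply.
set GS := \sum_(1 <= m < _) _.
have A0 : A != 0.
  have : lead_coef W != 0 by rewrite lead_coef_eq0 -size_poly_eq0 sW.
  by rewrite lead_coefE sW.
have B00 : (0 < B0)%N by rewrite muln_gt0 fact_gt0 absz_gt0.
have hA : A%:~R = `|A|%N%:R :> R \/ A%:~R = - `|A|%N%:R :> R.
  by case: A {A0 B0 B00 cP hdiff GS} => n; [left|right; rewrite NegzE mulrNz].
pose G j := geom_bound N (2 * pi * (j%:R * alpha)).
have GS1 : GS = \sum_(1 <= m < (N ^ k).+1) G (m * B0)%N.
  apply: eq_bigr => m _; rewrite /G /B0 !natrM; case: hA => ->; last first.
    by rewrite -geom_boundN; congr geom_bound; ring.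
  by congr geom_bound; ring.
(* Up to sign and the factor [2 pi], the constant of the differences is [B0 alpha]. The multiples of
   [B0] are completed to all integers up to [N^k B0], so that the approximation of [alpha] itself
   can be used. *)
have GS2 : GS <= \sum_(1 <= j < (N ^ k * B0).+1) G j.
  rewrite GS1 -(big_map (fun m => m * B0)%N xpredT G).
  apply: ler_sum_subset.
  - rewrite map_inj_uniq ?iota_uniq// => u v /eqP; rewrite eqn_pmul2r//.
    by move/eqP.
  - move=> _ /mapP[m + ->]; rewrite !mem_index_iota => /andP[m0 mM].
    by rewrite muln_gt0 m0 B00/= ltnS leq_mul2r -ltnS mM orbT.
  - by move=> j; exact: geom_bound_ge0.
have {GS2}GS3 := le_trans GS2 (sum_geom_bound_le N (N ^ k * B0) q0 cop ha).
pose X : R := N%:R `^ (k.+1%:R - kappa).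
pose Y : R := N%:R `^ eps1.
have Y1 : 1 <= Y by rewrite N1// ltW.
have kX (e : R) : e <= k%:R -> N%:R `^ e <= X.
  by move=> ek; rewrite ler_powR// -natr1; lra.
have qN : q%:R <= N%:R `^ k.+1%:R :> R.
  by rewrite (le_trans qhi)// ler_powR// gerBl.
have harmY : harm R q <= Hc * Y.
  rewrite (le_trans (harm_le_ln R q0))// mulrDl mul1r lerD//.
  have : ln q%:R <= ln (N%:R `^ k.+1%:R) :> R.
    by rewrite ler_ln// posrE powR_gt0.
  move=> /le_trans; apply; rewrite ln_powR -mulrA ler_wpM2l//.
  exact: ln_le_powR.
have NX : N%:R <= X.
  by rewrite -[leLHS]powRr1 ?(ltW NR0)//; apply: kX; rewrite ler1n.
have NkX : N%:R ^+ k <= X by rewrite -powR_mulrn ?(ltW NR0)//; exact: kX.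
have NqX : N%:R ^+ k.+1 / q%:R <= X.
  rewrite ler_pdivrMr// -powR_mulrn ?(ltW NR0)//.
  have -> : N%:R `^ k.+1%:R = X * N%:R `^ kappa by rewrite -powR_addr// subrK.
  by rewrite ler_wpM2l// powR_ge0.
have X0 : 0 <= X by rewrite powR_ge0.
have Hc1 : 1 <= Hc by rewrite lerDl divr_ge0// ltW.
have HY1 : 1 <= Hc * Y by rewrite -[leLHS]mulr1 ler_pM.
have bR : 0 <= B0%:R :> R by [].
have GS4 : GS <= 16 * Hc * (B0%:R + 1) * (Y * X).
  rewrite (le_trans GS3)//.
  rewrite (@le_trans _ _ (((N ^ k * B0)%:R / q%:R + 1) * (4 * N%:R + 4 * q%:R * (Hc * Y))))//.
    by rewrite ler_wpM2l ?addr_ge0 ?divr_ge0// lerD2l ler_wpM2l.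
  rewrite natrM natrX.
  rewrite (_ : _ * _ = 4 * (B0%:R * (N%:R ^+ k.+1 / q%:R)) + 4 * (B0%:R * ((Hc * Y) * N%:R ^+ k)) + 4 * N%:R
     + 4 * (q%:R * (Hc * Y))); last first.
    by rewrite exprS; field; rewrite lt0r_neq0.
  set h := Hc * Y in HY1 *.
  rewrite (_ : 16 * Hc * _ * _ = 16 * (B0%:R * (h * X)) + 16 * (h * X)); last by rewrite /h; ring.
  have X1 : X <= h * X by rewrite ler_peMl.
  have t1 : B0%:R * (N%:R ^+ k.+1 / q%:R) <= B0%:R * (h * X).
    by rewrite ler_wpM2l// (le_trans NqX).
  have t2 : B0%:R * (h * N%:R ^+ k) <= B0%:R * (h * X).
    by rewrite !ler_wpM2l// (le_trans _ HY1).
  have t3 : q%:R * h <= h * X.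
    by rewrite mulrC ler_wpM2l// (le_trans _ HY1).
  have h0 : 0 <= h := le_trans ler01 HY1.
  have t4 : 0 <= B0%:R * (h * X) by apply: mulr_ge0 => //; exact: mulr_ge0.
  have NhX := le_trans NX X1.
  by move: NhX X0 X1 t1 t2 t3 t4; clear; lra.
pose Z : R := N%:R `^ eps.
have ZE : N%:R `^ (k%:R * eps1) ^+ k * Y = Z.
  rewrite -powR_mulrn ?powR_ge0// -powRrM -powR_addr//; congr (_ `^ _).
  rewrite /eps1 natrD natrX; field.
  by rewrite lt0r_neq0// (lt_le_trans ltr01)// lerDr sqr_ge0.
have Z1 : 1 <= Z by rewrite N1// ltW.
have GS0 : 0 <= GS by rewrite sumr_ge0// => m _; exact: geom_bound_ge0.
pose K : R := 16 * Hc * (B0%:R + 1).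
have K0 : 0 <= K by rewrite !mulr_ge0// addr_ge0.
have fin : N%:R ^+ k + T%:R ^+ k * GS <= (1 + D ^+ k * K) * (Z * X).
  rewrite mulrDl mul1r lerD//; first by rewrite (le_trans NkX)// ler_peMl.
  rewrite (@le_trans _ _ (Tr ^+ k * (K * (Y * X))))//.
    by rewrite ler_pM ?exprn_ge0// lerXn2r// nnegrE.
  by rewrite /Tr exprMn -ZE le_eqVlt; apply/orP; left; apply/eqP; ring.
rewrite (le_trans (ler_wpM2l _ fin))//; first by rewrite mulr_ge0 ?exprn_ge0.
rewrite (_ : N%:R `^ ((2 ^ k)%:R - kappa + eps) = N%:R ^+ (2 ^ k - k.+1) * (Z * X)).
  by rewrite le_eqVlt; apply/orP; left; apply/eqP; rewrite /K; ring.
rewrite /Z /X -powR_mulrn ?(ltW NR0)// -!powR_addr//; congr (_ `^ _).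
rewrite natrB; last exact: ltn_expl.
rewrite [eps + _]addrC !addrA subrK; reflexivity.
Qed.

Definition diophantine (xi : R) : Prop := forall eps : R, 0 < eps ->
  exists c : R, 0 < c /\ forall (q : nat) (j : int), (0 < q)%N ->
    c * q%:R `^ (- (1 + eps)) <= `|q%:R * xi - j%:~R|.

(* For alpha close to a rational of small denominator q, the linear phase z is
   determined by alpha up to a Diophantine number, hence q z is far from the
   integers and the sum cancels; for large q this is Weyl's inequality.  The
   exponent 1 / (2 ^ d + 1) balances the two cases. *)
Theorem expsum_bound (W : {poly int}) k (kk ll : int) (xi s' : R) :
  size W = k.+2 -> (0 < k)%N -> kk != 0 -> diophantine xi ->
  0 <= s' -> s' < 1 / (2 ^+ k.+1 + 1) ->
  exists C : R, 0 <= C /\ forall alpha z : R, kk%:~R * z = xi - ll%:~R * alpha ->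
    forall N L : nat, (L <= N)%N -> (0 < N)%N ->
    normc (\sum_(n < L) expi (2 * pi * (alpha * (W.[n%:Z])%:~R + n%:R * z)))
      <= C * N%:R `^ (1 - s').
Proof.
move=> sW k0 kk0 dio s'0; set s := 1 / _ => s's.
have P4 : 4 <= 2 ^+ k.+1 :> R.
  by rewrite (_ : 4 = 2 ^+ 2) ?ler_weXn2l ?ler1n//; ring.
have sE : 2 ^+ k.+1 * s = 1 - s.
  rewrite /s; move: P4; set p := 2 ^+ k.+1 => P4.
  by field; rewrite lt0r_neq0//; lra.
have s0 : 0 < s by rewrite divr_gt0//; lra.
have s1 : s <= 1 / 5 by rewrite ler_pM2l// lef_pV2 ?posrE; lra.
pose P := (2 ^ k)%N; pose kap := P%:R * s.
have kap2 : 2 * kap = 1 - s by rewrite /kap /P natrX -sE exprS; ring.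
pose eps := s - s'; have e0 : 0 < eps by rewrite subr_gt0.
have [c [c0 hc]] := dio eps e0.
have sW' : (size W <= k.+2)%N by rewrite sW.
have [C1 [C10 h1]] := expsum_small_q sW'.
have kap01 : 0 <= kap <= 1 by lra.
have [C2 [C20 h2]] := expsum_large_q sW k0 e0 kap01.
have kapeps : kap * eps <= eps.
  by rewrite -[leRHS]mul1r ler_wpM2r ?(ltW e0)//; have /andP[] := kap01.
have kkR : 1 <= `|kk%:~R| :> R.
  by rewrite -intr_norm -[1]/(1%:~R) ler_int; move: kk0; clear; lia.
(* Beyond this threshold the error [ll (q alpha - a)] takes at most half of the Diophantine lower
   bound; up to it the trivial bound [S <= N <= N1] serves. *)
pose N1 : R := (4 * `|ll%:~R| / c) ^+ 2.
have N10 : 0 <= N1 by exact: sqr_ge0.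
pose Csm : R := 4 * `|kk%:~R| / c * (1 + 2 * C1).
have Csm0 : 0 <= Csm.
  by rewrite mulr_ge0 ?divr_ge0 ?mulr_ge0 ?addr_ge0 ?mulr_ge0 ?(ltW c0).
exists (N1 + (C2 + 1) + Csm); split; first by rewrite !addr_ge0.
move=> alpha z hz N L LN N0; set S := normc _.
have NR : 1 <= N%:R :> R by rewrite ler1n.
have NR0 : 0 < N%:R :> R by rewrite ltr0n.
have Npow0 e : 0 <= N%:R `^ e :> R by exact: powR_ge0.
have SN : S <= N%:R.
  rewrite (le_trans (normc_sum _ _ _))//.
  under eq_bigr do rewrite normc_expi.
  by rewrite sumr_const card_ord ler_nat.
have Npos : 1 <= N%:R `^ (1 - s').
  by rewrite -[leLHS](powRr0 N%:R) ler_powR//; lra.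
rewrite !mulrDl.
have t1 : 0 <= N1 * N%:R `^ (1 - s') by rewrite mulr_ge0.
have t2 : 0 <= C2 * N%:R `^ (1 - s') by rewrite mulr_ge0.
have t3 : 0 <= Csm * N%:R `^ (1 - s') by rewrite mulr_ge0.
have [NN1|NN1] := leP N%:R N1.
  have : N1 <= N1 * N%:R `^ (1 - s') by rewrite ler_peMr.
  by move: (Npow0 (1 - s')) SN; lra.
(* Dirichlet's theorem at the level [X] gives [q <= N^(k + 1 - kap)], as Weyl's inequality requires,
   and [|q alpha - a| N^(k + 1) = O(N^kap)], as the case of small [q] requires. *)
pose X : R := N%:R `^ (k.+1%:R - kap).
have X1 : 1 <= X.
  rewrite -[leLHS](powRr0 N%:R) ler_powR//.
  have : 1 <= k.+1%:R :> R by rewrite ler1n.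
  by lra.
pose Q := Num.truncn X.
have X0 : 0 <= X by lra.
have /andP[QX XQ] := truncn_itv X0; rewrite -/Q in QX XQ.
have Q0 : (0 < Q)%N by rewrite truncn_gt0.
have QR : 1 <= Q%:R :> R by rewrite ler1n.
have [q [a [/andP[q0 qQ] cop ha]]] := dirichlet_coprime alpha Q0.
have qR : 1 <= q%:R :> R by rewrite ler1n.
have qQR : q%:R <= Q%:R :> R by rewrite ler_nat.
have qR0 : 0 < q%:R :> R by rewrite ltr0n.
have QR0 : 0 < Q%:R :> R by rewrite ltr0n.
have Xpos : 0 < X by rewrite powR_gt0.
have kkpos : 0 < `|kk%:~R| :> R by rewrite (lt_le_trans ltr01).
have [qbig|qsmall] := leP (N%:R `^ kap) q%:R.
  have ha' : `|q%:R * alpha - a%:~R| <= q%:R^-1.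
    by rewrite (le_trans ha)// lef_pV2 ?posrE.
  have := h2 alpha z q a N L LN N0 q0 cop ha' qbig (le_trans qQR QX).
  rewrite -/S => hS.
  suff : S <= (C2 + 1) * N%:R `^ (1 - s').
    have N1X : 0 <= N1 * N%:R `^ (1 - s') by [].
    by move: N1X t3; rewrite mulrDl mul1r; clear; lra.
  have P0 : (0 < P)%N by rewrite expn_gt0.
  rewrite -(ler_pXn2r P0) ?nnegrE ?normc_ge0 ?mulr_ge0 ?addr_ge0//.
  rewrite (le_trans hS)// exprMn ler_pM//.
    rewrite (@le_trans _ _ (C2 + 1)) ?lerDl// -[leLHS]expr1 ler_weXn2l//.
    by rewrite lerDr.
  rewrite -powR_mulrn// -powRrM ler_powR//.
  have : 1 <= P%:R :> R by rewrite ler1n.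
  rewrite -/P /kap /eps; move: e0; rewrite /eps; clear.
  by move=> e0 P1; have := mulr_ge0 (ltW e0) (_ : 0 <= P%:R - 1); nra.
pose delta : R := c / (2 * `|kk%:~R|) * N%:R `^ (- (kap * (1 + eps))).
have Nneg0 e : 0 < N%:R `^ e :> R by rewrite powR_gt0.
have d0 : 0 < delta by rewrite mulr_gt0// divr_gt0// mulr_gt0.
have QX2 : Q%:R^-1 <= 2 * X^-1.
  rewrite -[leLHS]mul1r ler_pdivrMr// mulrAC ler_pdivlMr//.
  by move: XQ QR; rewrite -natr1; clear; lra.
(* If [q z] were close to [j], then [q xi] would be close to the integer [ll a + kk j], against the
   Diophantine bound. *)
have hd (j : int) : delta <= `|q%:R * z - j%:~R|.
  have h := hc q (ll * a + kk * j) q0.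
  have e1 : q%:R * xi - (ll * a + kk * j)%:~R =
      kk%:~R * (q%:R * z - j%:~R) + ll%:~R * (q%:R * alpha - a%:~R).
    have -> : xi = kk%:~R * z + ll%:~R * alpha by rewrite hz subrK.
    by rewrite rmorphD !rmorphM/=; ring.
  have h3 : c * N%:R `^ (- (kap * (1 + eps))) <= c * q%:R `^ (- (1 + eps)).
    rewrite ler_pM2l// !powRN lef_pV2 ?posrE ?powR_gt0//.
    by rewrite powRrM ge0_ler_powR ?nnegrE ?(ltW qsmall)// addr_ge0// ltW.
  have h4 : `|ll%:~R| * Q%:R^-1 <= c / 2 * N%:R `^ (- (kap * (1 + eps))).
    have h5 : 4 * `|ll%:~R| / c <= N%:R `^ (1 / 2).
      rewrite -(ler_pXn2r (n := 2)) ?nnegrE//; last first.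
        by rewrite divr_ge0 ?mulr_ge0// ltW.
      rewrite -/N1 -powR_mulrn// -powRrM (_ : 1 / 2 * 2%:R = 1); last by clear; lra.
      by rewrite powRr1 ?ltW.
    have h6 : `|ll%:~R| <= c / 4 * N%:R `^ (1 / 2).
      by move: h5; rewrite ler_pdivrMr//; clear; lra.
    rewrite (le_trans (ler_wpM2l _ QX2))//.
    rewrite (le_trans (ler_wpM2r _ h6)) ?mulr_ge0 ?invr_ge0//.
    rewrite /X -powRN [leLHS](_ : _ = c / 2 * (N%:R `^ (1 / 2) * N%:R `^ (- (k.+1%:R - kap)))); last first.
      by field.
    rewrite ler_wpM2l ?divr_ge0 ?(ltW c0)// -powR_addr// ler_powR//.
    have k2 : 2 <= k.+1%:R :> R by rewrite ler_nat ltnS.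
    by move: kapeps s'0 s0 s1 kap2 k2; rewrite /eps; clear; lra.
  have h7 : `|q%:R * xi - (ll * a + kk * j)%:~R| <=
      `|kk%:~R| * `|q%:R * z - j%:~R| + `|ll%:~R| * Q%:R^-1.
    rewrite e1 (le_trans (ler_normD _ _))// !normrM lerD2l ler_wpM2l//.
  have h8 : c / 2 * N%:R `^ (- (kap * (1 + eps))) <= `|kk%:~R| * `|q%:R * z - j%:~R|.
    by move: h h3 h4 h7; clear; lra.
  by rewrite /delta invfM mulrA mulrAC ler_pdivrMr// [leRHS]mulrC.
have := h1 alpha z delta q a N L LN q0 d0 hd; rewrite -/S => hS.
suff : S <= Csm * N%:R `^ (1 - s').
  by move: (Npow0 (1 - s')) t1 t2; clear; lra.
rewrite (le_trans hS)//.
have h9 : q%:R + C1 * `|q%:R * alpha - a%:~R| * N%:R ^+ k.+1 <= (1 + 2 * C1) * N%:R `^ kap.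
  rewrite mulrDl mul1r lerD ?(ltW qsmall)// -mulrA [2 * C1]mulrC -mulrA ler_wpM2l//.
  rewrite (le_trans (ler_wpM2r _ (le_trans ha QX2))) ?exprn_ge0//.
  rewrite -mulrA ler_wpM2l// /X -powRN -powR_mulrn// -powR_addr//.
  by rewrite opprB subrK.
rewrite (le_trans (ler_wpM2l _ h9)) ?divr_ge0 ?(ltW d0)//.
have -> : 2 / delta * ((1 + 2 * C1) * N%:R `^ kap) =
    Csm * (N%:R `^ (kap * (1 + eps)) * N%:R `^ kap).
  rewrite /delta powRN /Csm; field.
  by rewrite !lt0r_neq0// ?powR_gt0.
rewrite ler_wpM2l// -powR_addr// ler_powR//.
by move: kapeps kap2; rewrite /eps; clear; lra.
Qed.

End ExponentialSums.

(** * Step functions on the circle *)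

Section StepFunctions.
Variable R : realType.
Implicit Types (h : R -> R[i]) (x a : R).

(* Off finitely many points of the period, h is a combination of indicators of
   half-lines. *)
Definition piecewise_constant h : Prop :=
  exists (c : R[i]) (ps : seq (R * R[i])) (E : seq R), forall x,
    0 < x -> x < 2 * pi -> x \notin E ->
    h x = c + \sum_(p <- ps) p.2 * (x < p.1)%R%:R.

Lemma piecewise_constant_cst (c : R[i]) : piecewise_constant (fun=> c).
Proof. by exists c, [::], [::] => x _ _ _; rewrite big_nil addr0. Qed.

Lemma piecewise_constantD h1 h2 : piecewise_constant h1 -> piecewise_constant h2 ->
  piecewise_constant (fun x => h1 x + h2 x).
Proof.
move=> [c1 [p1 [E1 H1]]] [c2 [p2 [E2 H2]]].
exists (c1 + c2), (p1 ++ p2), (E1 ++ E2) => x x0 x1.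
rewrite mem_cat negb_or => /andP[xE1 xE2].
by rewrite H1// H2// big_cat/= addrACA.
Qed.

Lemma piecewise_constantZ (z : R[i]) h : piecewise_constant h ->
  piecewise_constant (fun x => z * h x).
Proof.
move=> [c [ps [E H]]]; exists (z * c), [seq (p.1, z * p.2) | p <- ps], E => x x0 x1 xE.
rewrite H// mulrDr big_map mulr_sumr; congr (_ + _).
by apply: eq_bigr => p _; rewrite mulrA.
Qed.

Lemma piecewise_constant_sum (I : Type) (s : seq I) (F : I -> R -> R[i]) :
  (forall i, piecewise_constant (F i)) ->
  piecewise_constant (fun x => \sum_(i <- s) F i x).
Proof.
move=> H; elim: s => [|i s IH].
  have := piecewise_constant_cst 0; congr piecewise_constant.
  by apply/funext => x; rewrite big_nil.
have := piecewise_constantD (H i) IH; congr piecewise_constant.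
by apply/funext => x; rewrite big_cons.
Qed.

Lemma piecewise_constant_eq h1 h2 (E : seq R) :
  (forall x, 0 < x -> x < 2 * pi -> x \notin E -> h1 x = h2 x) ->
  piecewise_constant h2 -> piecewise_constant h1.
Proof.
move=> H12 [c [ps [E2 H]]]; exists c, ps, (E ++ E2) => x x0 x1.
by rewrite mem_cat negb_or => /andP[xE1 xE2]; rewrite H12// H.
Qed.

Lemma piecewise_constant_lt a : piecewise_constant (fun x => (x < a)%R%:R).
Proof. by exists 0, [:: (a, 1)], [::] => x _ _ _; rewrite big_seq1 mul1r add0r. Qed.

Let p2 : 0 < 2 * pi :> R. Proof. by rewrite mulr_gt0 ?pi_gt0. Qed.

Lemma int_shift_lt x a : exists k : int, x + k%:~R * (2 * pi) < a.
Proof.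
exists (- (Num.floor ((x - a) / (2 * pi)) + 1)).
rewrite mulrNz mulNr ltrBlDr -ltrBlDl -ltr_pdivrMr//.
exact: floorD1_gt.
Qed.

Lemma int_shift_gt x a : exists k : int, a < x + k%:~R * (2 * pi).
Proof.
exists (Num.floor ((a - x) / (2 * pi)) + 1).
by rewrite -ltrBlDl -ltr_pdivrMr// floorD1_gt.
Qed.

(** A nonempty unbounded interval covers the whole circle. A bounded one is translated so that its
    left end [a'] lies in [[0, 2 pi)]; off its endpoints, only a point of the period or its shift by
    [2 pi] can then lie in it. The endpoints go into the exceptional set, so their inclusion is
    irrelevant. *)
Lemma piecewise_constant_arc (I : interval R) :
  piecewise_constant (fun x => (\1_(circle_arc I) x)%:C).
Proof.
have full (E : seq R) : (forall x, 0 < x -> x < 2 * pi -> x \notin E -> circle_arc I x) ->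
    piecewise_constant (fun x => (\1_(circle_arc I) x)%:C).
  move=> H; apply: (piecewise_constant_eq (E := E) _ (piecewise_constant_cst 1)).
  by move=> x x0 x1 xE; rewrite indicE mem_set//; exact: H.
have empty (E : seq R) : (forall x, 0 < x -> x < 2 * pi -> x \notin E -> ~ circle_arc I x) ->
    piecewise_constant (fun x => (\1_(circle_arc I) x)%:C).
  move=> H; apply: (piecewise_constant_eq (E := E) _ (piecewise_constant_cst 0)).
  by move=> x x0 x1 xE; rewrite indicE memNset//; exact: H.
case: I full empty => [[bl a|[]] [br b|[]]] full empty.
- have j1E (j : int) : 0 < j -> j <= 1 -> j = 1 by clear; lia.
  pose k0 := Num.floor (a / (2 * pi)); pose a' := a - k0%:~R * (2 * pi).
  have a'0 : 0 <= a' by rewrite subr_ge0 -ler_pdivlMr// floor_le.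
  have a'1 : a' < 2 * pi.
    rewrite ltrBlDl -[X in _ + X]mul1r -mulrDl -ltr_pdivrMr//.
    by rewrite -intrD1 floorD1_gt.
  pose b' := b - k0%:~R * (2 * pi).
  have bE : b' = a' + (b - a) by rewrite /b' /a'; ring.
  have mem1 x (j : int) : x + (k0 + j)%:~R * (2 * pi) \in Interval (BSide bl a) (BSide br b) ->
      a' <= x + j%:~R * (2 * pi) <= b'.
    rewrite in_itv/= => /andP[/lteifW h1 /lteifW h2].
    by move: h1 h2; rewrite rmorphD/= mulrDl /a' /b'; lra.
  have mem2 x (j : int) : a' < x + j%:~R * (2 * pi) < b' ->
      circle_arc (Interval (BSide bl a) (BSide br b)) x.
    move=> /andP[h1 h2]; exists (k0 + j); rewrite in_itv/=.
    by rewrite !lteifS// rmorphD/= mulrDl; move: h1 h2; rewrite /a' /b'; lra.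
  have mem3 x : circle_arc (Interval (BSide bl a) (BSide br b)) x ->
      exists j : int, a' <= x + j%:~R * (2 * pi) <= b'.
    by move=> [k]; rewrite -(subrKC k0 k) => /mem1; exists (k - k0).
  have jneg (j : int) : j < 0 -> j%:~R * (2 * pi) <= - (2 * pi) :> R.
    move=> j0; have : j%:~R <= -1 :> R by rewrite -[-1]/((-1)%:~R) ler_int; lia.
    by move: p2; nra.
  have jpos (j : int) : 1 < j -> 2 * (2 * pi) <= j%:~R * (2 * pi) :> R.
    move=> j0; have : 2 <= j%:~R :> R by rewrite -[2]/(2%:~R) ler_int; lia.
    by move: p2; nra.
  have [ba|ab] := leP b a.
    apply: (empty [:: a'; a' - 2 * pi]) => x x0 x1; rewrite !inE negb_or => /andP[/eqP xa /eqP xa2].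
    move=> /mem3[j /andP[h1 h2]].
    have b'a' : b' <= a' by rewrite /b' /a' lerD2r.
    have [j0|j0|j0] := ltgtP j 0.
    - by have := jneg j j0; lra.
    - have [j1|j1] := leP j 1.
        have jE := j1E j j0 j1.
        by apply: xa2; move: h1 h2; rewrite jE; lra.
      by have := jpos j j1; lra.
    - by apply: xa; move: h1 h2; rewrite j0; lra.
  have a'b' : a' < b' by rewrite /b' /a' ltrD2r.
  have [big|small] := leP (2 * pi) (b - a).
    apply: (full [:: a']) => x x0 x1; rewrite inE neq_lt => /orP[xa|xa].
      by apply: (mem2 x 1); rewrite bE; lra.
    by apply: (mem2 x 0); rewrite bE; lra.
  (* The first two terms are the indicator of the arc from [a'] to [b']; the part of it beyond
     [2 pi] reappears at the start of the period as [x < b' - 2 pi]. *)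
  have := piecewise_constantD (piecewise_constant_lt b') (piecewise_constantD
    (piecewise_constantZ (-1) (piecewise_constant_lt a')) (piecewise_constant_lt (b' - 2 * pi))).
  apply: (piecewise_constant_eq (E := [:: a'; b'; b' - 2 * pi])) => x x0 x1.
  rewrite !inE !negb_or => /and3P[xa xb xb2].
  have b'4 : b' < a' + 2 * pi by rewrite bE; lra.
  rewrite indicE.
  have [h1|h1] := ltP x (b' - 2 * pi).
    rewrite mem_set/=; last by apply: (mem2 x 1); lra.
    have -> : x < b' by lra.
    have -> : x < a' by lra.
    by rewrite /= mulN1r addNr addr0.
  have [h2|h2] := ltP x a'.
    have -> : x < b' by lra.
    rewrite memNset/= ?mulN1r ?addr0 ?subrr// => /mem3[j /andP[h3 h4]].
    have [j0|j0|j0] := ltgtP j 0.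
    - by have := jneg j j0; lra.
    - have [j1|j1] := leP j 1.
        have jE := j1E j j0 j1.
        by move: h3 h4 xb2 h1; rewrite jE => h3 h4 /eqP xb2 h1; apply: xb2; lra.
      by have := jpos j j1; lra.
    - by move: h3; rewrite j0; lra.
  have [h3|h3] := ltP x b'.
    rewrite mem_set/= ?mulr0 ?addr0//; apply: (mem2 x 0).
    by move: h3; rewrite mul0r addr0 => ->; rewrite lt_neqAle h2 eq_sym xa.
  rewrite memNset/= ?mulr0 ?addr0// => /mem3[j /andP[h4 h5]].
  have [j0|j0|j0] := ltgtP j 0.
  - by have := jneg j j0; lra.
  - have [j1|j1] := leP j 1.
      have jE := j1E j j0 j1.
      by move: h5; rewrite jE; move: h1 h2; lra.
    by have := jpos j j1; lra.
  - by move/eqP: xb; apply; move: h5; rewrite j0; lra.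
- by apply: (empty [::]) => x _ _ _ [k]; rewrite in_itv/= andbF.
- apply: (full [::]) => x _ _ _; have [k hk] := int_shift_gt x a.
  by exists k; rewrite in_itv/= andbT lteifS.
- apply: (full [::]) => x _ _ _; have [k hk] := int_shift_lt x b.
  by exists k; rewrite in_itv/= lteifS.
- by apply: (empty [::]) => x _ _ _ [k]; rewrite in_itv/=.
- by apply: (full [::]) => x _ _ _; exists 0; rewrite in_itv/=.
- by apply: (empty [::]) => x _ _ _ [k]; rewrite in_itv/=.
- by apply: (empty [::]) => x _ _ _ [k]; rewrite in_itv/=.
- by apply: (empty [::]) => x _ _ _ [k]; rewrite in_itv/=.
Qed.

Lemma circle_arc_periodic (I : interval R) x (k : int) :
  circle_arc I (x + k%:~R * (2 * pi)) <-> circle_arc I x.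
Proof.
split=> [[j hj]|[j hj]].
  by exists (k + j); rewrite rmorphD/= mulrDl addrA.
by exists (j - k); rewrite rmorphB/= -addrA -mulrDl addrCA subrr addr0.
Qed.

Lemma measurable_circle_arc (I : interval R) : measurable (circle_arc I).
Proof.
rewrite (_ : circle_arc I = \bigcup_(k : int) [set x | x + k%:~R * (2 * pi) \in I]).
  apply: countable_bigcupT_measurable => [|k]; first exact: countableP.
  rewrite -[X in measurable X]setTI.
  have mf : measurable_fun [set: R] (fun x => x + k%:~R * (2 * pi)).
    by apply: measurable_funD; [exact: measurable_id|exact: measurable_cst].
  by apply: (mf measurableT [set` I]); exact: measurable_itv.
by apply/seteqP; split => x /=; [move=> [k hk]; exists k|move=> [k _ hk]; exists k].
Qed.

Lemma step_function_periodic (g : R -> R[i]) x (k : int) : step_function g ->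
  g (x + k%:~R * (2 * pi)) = g x.
Proof.
move=> [m [a [I H]]]; rewrite !H; apply: eq_bigr => j _; congr (_ * _%:C).
rewrite !indicE; congr (_%:R); congr nat_of_bool.
by apply/idP/idP; rewrite !inE => /circle_arc_periodic.
Qed.

Lemma step_function_piecewise (g : R -> R[i]) : step_function g -> piecewise_constant g.
Proof.
move=> [m [a [I /funext ->]]]; apply: piecewise_constant_sum => j.
exact/piecewise_constantZ/piecewise_constant_arc.
Qed.

Lemma measurable_step_function (g : R -> R[i]) : step_function g ->
  measurable_fun setT (fun x => complex.Re (g x)) /\
  measurable_fun setT (fun x => complex.Im (g x)).
Proof.
move=> [m [a [I /funext ->]]].
have mI j : measurable_fun setT (\1_(circle_arc (I j)) : R -> R).
  by apply: measurable_indic; exact: measurable_circle_arc.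
split.
- rewrite (_ : (fun x => _) = fun x => \sum_(j < m) complex.Re (a j) * \1_(circle_arc (I j)) x).
    by apply: measurable_sum => j; apply: measurable_funM; [exact: measurable_cst|exact: mI].
  apply/funext => x; rewrite (raddf_sum (@complex.Re R : {additive R[i] -> R})).
  apply: eq_bigr => j _; case: (a j) => u v /=; ring.
- rewrite (_ : (fun x => _) = fun x => \sum_(j < m) complex.Im (a j) * \1_(circle_arc (I j)) x).
    by apply: measurable_sum => j; apply: measurable_funM; [exact: measurable_cst|exact: mI].
  apply/funext => x; rewrite (raddf_sum (@complex.Im R : {additive R[i] -> R})).
  apply: eq_bigr => j _; case: (a j) => u v /=; ring.
Qed.

(** Finitely many exceptional points per period are countably many on the line, hence a null set. *)
Lemma piecewise_constant_nonconstant (g : R -> R[i]) (c : R[i]) (E : seq R) :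
  step_function g -> nonconstant g ->
  ~ (forall x, 0 < x -> x < 2 * pi -> x \notin E -> g x = c).
Proof.
move=> sg ncg H; apply: ncg; exists c.
pose A := \bigcup_(k : int) [set y + k%:~R * (2 * pi) | y in [set` 0 :: E]].
have cA : countable A.
  apply: bigcup_countable => [|k _]; first exact: countableP.
  apply: (sub_countable (card_image_le _ _)).
  exact/finite_set_countable/finite_seq.
exists A; split.
- by apply: countable_measurable => // t; exact: measurable_set1.
- exact: countable_lebesgue_measure0.
move=> x /= gxc.
pose k := Num.floor (x / (2 * pi)); pose y := x - k%:~R * (2 * pi).
have xy : x = y + k%:~R * (2 * pi) by rewrite /y subrK.
have y0 : 0 <= y by rewrite subr_ge0 -ler_pdivlMr// floor_le.
have y1 : y < 2 * pi.
  rewrite ltrBlDl -{2}[2 * pi]mul1r -mulrDl -ltr_pdivrMr//.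
  by rewrite -intrD1 floorD1_gt.
exists k => //; exists y => //=; rewrite in_cons.
apply: contrapT => /negP; rewrite negb_or => /andP[yn0 yE]; apply: gxc.
by rewrite xy step_function_periodic// H// lt_neqAle eq_sym yn0.
Qed.

(** Half-lines ending at or before 0 vanish on the period, those ending at or after [2 pi] are
    constant on it, and equal endpoints have their coefficients added. *)
Lemma piecewise_constant_normal h : piecewise_constant h ->
  exists (c : R[i]) (ys : seq R) (beta : R -> R[i]) (E : seq R),
  [/\ uniq ys, (forall y, y \in ys -> 0 < y < 2 * pi) &
    forall x, 0 < x -> x < 2 * pi -> x \notin E ->
    h x = c + \sum_(y <- ys) beta y * (x < y)%R%:R].
Proof.
move=> [c [ps [E H]]].
suff [c' [ys [beta [u yin H']]]] : exists (c : R[i]) (ys : seq R) (beta : R -> R[i]),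
    [/\ uniq ys, (forall y, y \in ys -> 0 < y < 2 * pi) &
    forall x, 0 < x -> x < 2 * pi ->
    \sum_(p <- ps) p.2 * (x < p.1)%R%:R = c + \sum_(y <- ys) beta y * (x < y)%R%:R].
  exists (c + c'), ys, beta, E; split => // x x0 x1 xE.
  by rewrite H// H'// addrA.
elim: ps {H} => [|[a b] ps [c' [ys [beta [u yin IH]]]]].
  exists 0, [::], (fun=> 0); split => // x _ _.
  by rewrite !big_nil addr0.
have [a0|a0] := leP a 0.
  exists c', ys, beta; split => // x x0 x1.
  have -> : \sum_(p <- (a, b) :: ps) p.2 * (x < p.1)%R%:R = b * (x < a)%R%:R +
    \sum_(p <- ps) p.2 * (x < p.1)%R%:R by rewrite big_cons.
  by rewrite IH// ltNge (le_trans a0 (ltW x0)) mulr0 add0r.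
have [a1|a1] := leP (2 * pi) a.
  exists (b + c'), ys, beta; split => // x x0 x1.
  have -> : \sum_(p <- (a, b) :: ps) p.2 * (x < p.1)%R%:R = b * (x < a)%R%:R +
    \sum_(p <- ps) p.2 * (x < p.1)%R%:R by rewrite big_cons.
  by rewrite IH// (lt_le_trans x1 a1) mulr1 addrA.
exists c', (if a \in ys then ys else a :: ys),
  (fun y => (if y \in ys then beta y else 0) + (if y == a then b else 0)).
split.
- by case: ifPn => //= ->.
- by move=> y; case: ifPn => [_|_]; [exact: yin|rewrite inE => /orP[/eqP ->|/yin//]; rewrite a0].
move=> x x0 x1.
have -> : \sum_(p <- (a, b) :: ps) p.2 * (x < p.1)%R%:R = b * (x < a)%R%:R +
    \sum_(p <- ps) p.2 * (x < p.1)%R%:R by rewrite big_cons.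
rewrite IH// addrCA; congr (_ + _).
have e1 : \sum_(y <- ys) (if y \in ys then beta y else 0) * (x < y)%R%:R =
    \sum_(y <- ys) beta y * (x < y)%R%:R.
  by rewrite big_seq [RHS]big_seq; apply: eq_bigr => y ->.
have e2 y : ((if y \in ys then beta y else 0) + (if y == a then b else 0)) * (x < y)%R%:R =
   (if y \in ys then beta y else 0) * (x < y)%R%:R + (if y == a then b else 0) * (x < y)%R%:R.
  by rewrite mulrDl.
case: ifPn => ays.
  under [RHS]eq_bigr do rewrite e2.
  rewrite big_split/= e1 addrC; congr (_ + _).
  rewrite (bigD1_seq a)//= eqxx big1 ?addr0// => y /negbTE ->.
  by rewrite mul0r.
rewrite big_cons (negbTE ays) eqxx add0r; congr (_ + _).
rewrite -e1 big_seq [RHS]big_seq; apply: eq_bigr => y yys.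
case: (y =P a) => [ya|_]; last by rewrite addr0.
by rewrite -ya yys in ays.
Qed.

End StepFunctions.

(** * Integrals of exponentials and Fourier coefficients of step functions *)

Section ComplexIntegral.
Variable R : realType.
Notation mu := (@lebesgue_measure R).

Lemma Rintegral_FTC (f F : R -> R) (a b : R) : a < b -> continuous f ->
  (forall x : R, is_derive x 1 F (f x)) ->
  \int[mu]_(x in `[a, b]) f x = F b - F a.
Proof.
move=> ab cf dF.
have cF : continuous F.
  by move=> x; apply: differentiable_continuous; apply/derivable1_diffP; apply: ex_derive.
rewrite /Rintegral (@continuous_FTC2 _ f F)//.
- exact: continuous_subspaceT.
- split => [x _||]; first exact: ex_derive.
    by apply: cvg_at_right_filter; exact: cF.
  by apply: cvg_at_left_filter; exact: cF.
- by move=> x _; rewrite derive1E; exact: derive_val.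
Qed.

Lemma continuous_cosM (n : R) : continuous (fun x : R => cos (n * x)).
Proof.
move=> x; apply: (@continuous_comp _ _ _ (fun x => n * x) cos).
  by apply: mulrl_continuous.
exact: continuous_cos.
Qed.

Lemma continuous_sinM (n : R) : continuous (fun x : R => sin (n * x)).
Proof.
move=> x; apply: (@continuous_comp _ _ _ (fun x => n * x) sin).
  by apply: mulrl_continuous.
exact: continuous_sin.
Qed.

Lemma Rintegral_cos (n a : R) : n != 0 -> 0 < a ->
  \int[mu]_(x in `[0, a]) cos (n * x) = sin (n * a) / n.
Proof.
move=> n0 a0.
have dF (x : R) : is_derive x 1 (fun x : R => sin (n * x) / n : R) (cos (n * x)).
  by apply: is_derive_eq; rewrite /GRing.scale/= ?mulr1 ?mul1r; field.
rewrite (Rintegral_FTC a0 (@continuous_cosM n) dF).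
by rewrite mulr0 sin0 mul0r subr0.
Qed.

Lemma Rintegral_sin (n a : R) : n != 0 -> 0 < a ->
  \int[mu]_(x in `[0, a]) sin (n * x) = (1 - cos (n * a)) / n.
Proof.
move=> n0 a0.
have dF (x : R) : is_derive x 1 (fun x : R => - cos (n * x) / n : R) (sin (n * x)).
  by apply: is_derive_eq; rewrite /GRing.scale/= ?mulr1 ?mul1r; field.
rewrite (Rintegral_FTC a0 (@continuous_sinM n) dF).
by rewrite mulr0 cos0; field.
Qed.

Definition cintegrable (a b : R) (h : R -> R[i]) :=
  mu.-integrable `[a, b] (EFin \o (fun x => complex.Re (h x))) /\
  mu.-integrable `[a, b] (EFin \o (fun x => complex.Im (h x))).

Lemma cintegrableD a b h1 h2 : cintegrable a b h1 -> cintegrable a b h2 ->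
  cintegrable a b (fun x => h1 x + h2 x).
Proof.
have mD : measurable (`[a, b]%classic : set (measurableTypeR R)) by exact: measurable_itv.
move=> [r1 i1] [r2 i2]; split.
- have := integrableD mD r1 r2; apply: eq_integrable => // x _ /=.
  by rewrite raddfD.
- have := integrableD mD i1 i2; apply: eq_integrable => // x _ /=.
  by rewrite raddfD.
Qed.

Lemma cintegralD a b h1 h2 : cintegrable a b h1 -> cintegrable a b h2 ->
  cintegral `[a, b] (fun x => h1 x + h2 x) = cintegral `[a, b] h1 + cintegral `[a, b] h2.
Proof.
have mD : measurable (`[a, b]%classic : set (measurableTypeR R)) by exact: measurable_itv.
move=> [r1 i1] [r2 i2]; rewrite /cintegral.
by apply/eqP; rewrite eq_complex/=; apply/andP; split; apply/eqP;
  rewrite -RintegralD//; apply: eq_Rintegral => x _; rewrite raddfD.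
Qed.

Lemma cintegrableZ a b (z : R[i]) h : cintegrable a b h ->
  cintegrable a b (fun x => z * h x).
Proof.
have mD : measurable (`[a, b]%classic : set (measurableTypeR R)) by exact: measurable_itv.
move=> [r1 i1]; case: z => u v; split.
- have := integrableB mD (integrableZl mD u r1) (integrableZl mD v i1).
  by apply: eq_integrable => // x _ /=; case: (h x).
- have := integrableD mD (integrableZl mD u i1) (integrableZl mD v r1).
  by apply: eq_integrable => // x _ /=; case: (h x).
Qed.

Lemma cintegralZ a b (z : R[i]) h : cintegrable a b h ->
  cintegral `[a, b] (fun x => z * h x) = z * cintegral `[a, b] h.
Proof.
have mD : measurable (`[a, b]%classic : set (measurableTypeR R)) by exact: measurable_itv.
move=> [r1 i1]; case: z => u v; rewrite /cintegral.
have zr c := integrableZl mD c r1; have zi c := integrableZl mD c i1.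
apply/eqP; rewrite eq_complex/=; apply/andP; split; apply/eqP.
- rewrite -(RintegralZl u mD r1) -(RintegralZl v mD i1) -(RintegralB mD (zr u) (zi v)); apply: eq_Rintegral => x _.
  by case: (h x).
- rewrite -(RintegralZl u mD i1) -(RintegralZl v mD r1) -(RintegralD mD (zi u) (zr v)); apply: eq_Rintegral => x _.
  by case: (h x).
Qed.

Lemma cintegrable_sum a b (I : Type) (s : seq I) (z : I -> R[i]) (h : I -> R -> R[i]) :
  (forall i, cintegrable a b (h i)) ->
  cintegrable a b (fun x => \sum_(i <- s) z i * h i x) /\
  cintegral `[a, b] (fun x => \sum_(i <- s) z i * h i x) = \sum_(i <- s) z i * cintegral `[a, b] (h i).
Proof.
have mD : measurable (`[a, b]%classic : set (measurableTypeR R)) by exact: measurable_itv.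
move=> ih; elim: s => [|i s [IH1 IH2]].
  split.
    by split; apply: (@eq_integrable _ _ _ mu _ mD (cst 0%E)); rewrite ?integrable0// => x _;
      rewrite /= big_nil.
  rewrite big_nil /cintegral; apply/eqP; rewrite eq_complex/=.
  by apply/andP; split; apply/eqP; under eq_Rintegral do rewrite big_nil;
    rewrite /Rintegral/= integral0.
have e : (fun x => \sum_(j <- i :: s) z j * h j x) =
    (fun x => z i * h i x + \sum_(j <- s) z j * h j x).
  by apply/funext => x; rewrite big_cons.
have zi := cintegrableZ (z i) (ih i).
rewrite e; split; first exact: cintegrableD.
by rewrite cintegralD// IH2 cintegralZ// big_cons.
Qed.

Lemma continuous_cintegrable (a b : R) (h : R -> R[i]) :
  continuous (fun x => complex.Re (h x)) -> continuous (fun x => complex.Im (h x)) ->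
  cintegrable a b h.
Proof.
by move=> cr ci; split; apply: continuous_compact_integrable;
  [exact: segment_compact|exact: continuous_subspaceT|exact: segment_compact|exact: continuous_subspaceT].
Qed.

Lemma expi_cintegrable (a b v : R) : cintegrable a b (fun x => expi (v * x)).
Proof.
by apply: continuous_cintegrable; [exact: continuous_cosM|exact: continuous_sinM].
Qed.

Lemma cintegral_expi (v a : R) : v != 0 -> 0 < a ->
  cintegral `[0, a] (fun x => expi (v * x)) = (expi (v * a) - 1) / ('i * v%:C).
Proof.
move=> v0 a0; rewrite /cintegral Rintegral_cos// Rintegral_sin//.
have vC : v%:C != 0 by rewrite (inj_eq (@complexI R)) .
apply: (mulIf (_ : 'i * v%:C != 0)); rewrite ?mulf_neq0 ?neq0Ci// divfK ?mulf_neq0 ?neq0Ci//.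
by rewrite /expi; apply/eqP; rewrite eq_complex/=; apply/andP; split; apply/eqP; field.
Qed.

Lemma cintegral_ae_eq (a b : R) (h1 h2 : R -> R[i]) (E : seq R) :
  measurable_fun `[a, b] (fun x => complex.Re (h1 x)) ->
  measurable_fun `[a, b] (fun x => complex.Im (h1 x)) ->
  measurable_fun `[a, b] (fun x => complex.Re (h2 x)) ->
  measurable_fun `[a, b] (fun x => complex.Im (h2 x)) ->
  (forall x, a < x -> x < b -> x \notin E -> h1 x = h2 x) ->
  cintegral `[a, b] h1 = cintegral `[a, b] h2.
Proof.
move=> mr1 mi1 mr2 mi2 H.
have ae (f : R[i] -> R) : ae_eq mu `[a, b]%classic (EFin \o (fun x => f (h1 x))) (EFin \o (fun x => f (h2 x))).
  exists [set` [:: a, b & E]]; split.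
  - apply: countable_measurable => [t|]; first exact: measurable_set1.
    exact/finite_set_countable/finite_seq.
  - exact/countable_lebesgue_measure0/finite_set_countable/finite_seq.
  - move=> x /= nH; apply: contrapT => /negP.
    rewrite !in_cons !negb_or => /and3P[xa xb xE]; apply: nH.
    rewrite in_itv/= => /andP[ax xb'].
    by rewrite H// lt_neqAle ?ax ?xb' ?andbT// eq_sym.
rewrite /cintegral /Rintegral; congr (fine _ +i* fine _); apply: ae_eq_integral => //.
- exact/measurable_EFinP.
- exact/measurable_EFinP.
- exact: ae.
- exact/measurable_EFinP.
- exact/measurable_EFinP.
- exact: ae.
Qed.

Lemma Rintegral_lt (f : R -> R) (c y : R) : continuous f -> 0 < y -> y < c ->
  mu.-integrable `[0, c] (EFin \o (fun x => (x < y)%R%:R * f x)) /\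
  \int[mu]_(x in `[0, c]) ((x < y)%R%:R * f x) = \int[mu]_(x in `[0, y]) f x.
Proof.
move=> cf y0 yc.
have mD : measurable (`[0, c]%classic : set (measurableTypeR R)) by exact: measurable_itv.
have mI : measurable (`]-oo, y[%classic : set (measurableTypeR R)) by exact: measurable_itv.
have mY : measurable (`[0, y[%classic : set (measurableTypeR R)) by exact: measurable_itv.
have E : `[0, c]%classic `&` `]-oo, y[%classic = `[0, y[%classic :> set R.
  apply/seteqP; split => x /=; rewrite !in_itv/=.
    by move=> [/andP[-> _] ->].
  by move=> /andP[-> xy]; rewrite xy; split => //; rewrite (le_trans (ltW xy) (ltW yc)).
have fE x : (f \_ `]-oo, y[%classic) x = (x < y)%R%:R * f x.
  rewrite /patch mem_setE in_itv/=.
  by case: ifP => _; rewrite ?mul1r ?mul0r.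
have iy : mu.-integrable `[0, y[ (EFin \o f).
  have iy' : mu.-integrable `[0, y] (EFin \o f).
    apply: continuous_compact_integrable; [exact: segment_compact|exact: continuous_subspaceT].
  apply: (integrableS _ mY _ iy'); first exact: measurable_itv.
  by apply: subset_itvl; rewrite bnd_simp.
split.
  apply: (@eq_integrable _ _ _ mu _ mD ((EFin \o f) \_ `]-oo, y[%classic)).
    move=> x _ /=; rewrite -fE /patch.
    by case: ifP.
  by apply/(integrable_restrict mu mI mD); rewrite E.
have <- := Rintegral_itv_bndo_bndc iy.
rewrite -E Rintegral_mkcondr.
by apply: eq_Rintegral => x _; rewrite fE.
Qed.

Lemma cintegral_lt_expi (v c y : R) : v != 0 -> 0 < y -> y < c ->
  cintegrable 0 c (fun x => (x < y)%R%:R * expi (v * x)) /\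
  cintegral `[0, c] (fun x => (x < y)%R%:R * expi (v * x)) =
  (expi (v * y) - 1) / ('i * v%:C).
Proof.
move=> v0 y0 yc.
have [ic ec] := Rintegral_lt (@continuous_cosM v) y0 yc.
have [is' es] := Rintegral_lt (@continuous_sinM v) y0 yc.
have E : (fun x : R => (x < y)%R%:R * expi (v * x)) =
  (fun x => ((x < y)%R%:R * cos (v * x)) +i* ((x < y)%R%:R * sin (v * x))).
  apply/funext => x.
  by case: (x < y); apply/eqP; rewrite eq_complex/=; apply/andP; split; apply/eqP; ring.
by rewrite -cintegral_expi// E /cintegral/= ec es.
Qed.

Lemma measurable_mul_expi (g : R -> R[i]) (v : R) (D : set R) :
  measurable_fun setT (fun x => complex.Re (g x)) ->
  measurable_fun setT (fun x => complex.Im (g x)) ->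
  measurable_fun D (fun x => complex.Re (g x * expi (v * x))) /\
  measurable_fun D (fun x => complex.Im (g x * expi (v * x))).
Proof.
move=> mr mi.
have mc : measurable_fun setT (fun x : R => cos (v * x)).
  exact: continuous_measurable_fun (@continuous_cosM v).
have ms : measurable_fun setT (fun x : R => sin (v * x)).
  exact: continuous_measurable_fun (@continuous_sinM v).
split; apply: measurable_funTS.
- rewrite (_ : (fun x => _) = (fun x => complex.Re (g x) * cos (v * x) - complex.Im (g x) * sin (v * x))).
    by apply: measurable_funB; apply: measurable_funM.
  by apply/funext => x; case: (g x).
- rewrite (_ : (fun x => _) = (fun x => complex.Re (g x) * sin (v * x) + complex.Im (g x) * cos (v * x))).
    by apply: measurable_funD; apply: measurable_funM.
  by apply/funext => x; case: (g x).
Qed.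

(* The points of discontinuity are merged modulo 2 pi, so a nonconstant step
   function has some coefficient beta y != 0. *)
Theorem step_function_fourier (g : R -> R[i]) : step_function g -> nonconstant g ->
  exists (ys : seq R) (beta : R -> R[i]) (y0 : R),
  [/\ uniq ys, (forall y, y \in ys -> 0 <= y < 2 * pi), y0 \in ys, beta y0 != 0 &
    forall n : int, n != 0 -> fourier_coef g n =
      (n%:~R)^-1 * \sum_(y <- ys) beta y * expi (- (n%:~R * y))].
Proof.
move=> sg ncg.
have [c [ys [beta [E [u yin H]]]]] := piecewise_constant_normal (step_function_piecewise sg).
have [y0 y0s b0] : exists2 y, y \in ys & beta y != 0.
  apply: contrapT => hn; apply: (piecewise_constant_nonconstant (c := c) (E := E) sg ncg).
  move=> x x0 x1 xE; rewrite H// big_seq big1 ?addr0// => y yys.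
  have -> : beta y = 0.
    by apply: contrapT => /eqP by0; apply: hn; exists y.
  by rewrite mul0r.
have z0 : 0 \notin ys by apply/negP => /yin; rewrite ltxx.
(* A jump at [y] contributes [beta y / (2 pi)] times [(e^{-i n y} - 1) / (- i n)], whence
   [D = - 2 pi i]. The terms [- 1] are collected as a jump at 0, where the period closes up. *)
pose D : R[i] := - (2 * pi)%:C * 'i.
have D0 : D != 0.
  rewrite mulf_neq0 ?neq0Ci// oppr_eq0 (inj_eq (@complexI R)).
  by rewrite mulf_neq0 ?pnatr_eq0// lt0r_neq0// pi_gt0.
pose bb y := (if y == 0 then - \sum_(y <- ys) beta y else beta y) / D.
exists (0 :: ys), bb, y0; split.
- by rewrite /= z0.
- move=> y; rewrite inE => /orP[/eqP ->|/yin/andP[y1 ->]].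
    by rewrite lexx mulr_gt0 ?pi_gt0.
  by rewrite ltW.
- by rewrite inE y0s orbT.
- rewrite /bb mulf_neq0 ?invr_neq0//; case: (y0 =P 0) => [y00|//].
  by rewrite y00 (negbTE z0) in y0s.
move=> n n0; have nR : n%:~R != 0 :> R by rewrite intr_eq0.
have nR' : - n%:~R != 0 :> R by rewrite oppr_eq0.
have pp : 0 < 2 * pi :> R by rewrite mulr_gt0 ?pi_gt0.
rewrite /fourier_coef.
pose G x : R[i] := (c + \sum_(y <- ys) beta y * (x < y)%R%:R) * expi (- n%:~R * x).
(* [None] indexes the constant term. The guard [0 < y < 2 pi] makes the summand integrable for every
   real [y], as [cintegrable_sum] requires. *)
have GE : G = fun x => \sum_(j <- None :: [seq Some y | y <- ys])
   (if j is Some y then beta y else c) *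
   (if j is Some y then (0 < y < 2 * pi)%R%:R * ((x < y)%R%:R * expi (- n%:~R * x)) else expi (- n%:~R * x)).
  apply/funext => x; rewrite big_cons big_map /G mulrDl; congr (_ + _).
  rewrite mulr_suml big_seq [RHS]big_seq; apply: eq_bigr => y /yin ->.
  by rewrite mul1r mulrA.
have ih (j : option R) : cintegrable 0 (2 * pi) (fun x =>
   (if j is Some y then (0 < y < 2 * pi)%R%:R * ((x < y)%R%:R * expi (- n%:~R * x)) else expi (- n%:~R * x))).
  case: j => [y|]; last exact: expi_cintegrable.
  case: (boolP (0 < y < 2 * pi)) => [/andP[y1 y2]|_].
    by apply: cintegrableZ; apply: (cintegral_lt_expi _ _ _).1.
  have := cintegrableZ 0 (expi_cintegrable 0 (2 * pi) 0).
  congr (cintegrable 0 (2 * pi)).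
  by apply/funext => x; rewrite !mul0r.
have [iG eG] := cintegrable_sum (None :: [seq Some y | y <- ys])
  (fun j : option R => if j is Some y then beta y else c) ih.
rewrite -GE in iG eG.
have -> : cintegral `[0, 2 * pi] (fun x => g x * expi (- (n%:~R * x))) = cintegral `[0, 2 * pi] G.
  have [mr mi] := measurable_step_function sg.
  have [mr' mi'] := measurable_mul_expi (- n%:~R) `[0, 2 * pi]%classic mr mi.
  apply: (@cintegral_ae_eq _ _ _ _ E).
  - by move: mr'; congr measurable_fun; apply/funext => x; rewrite mulNr.
  - by move: mi'; congr measurable_fun; apply/funext => x; rewrite mulNr.
  - by case: iG => /measurable_int/measurable_EFinP.
  - by case: iG => _ /measurable_int/measurable_EFinP.
  by move=> x x0 x1 xE; rewrite /G H// mulNr.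
rewrite eG big_cons big_map.
have nC : (n%:~R : R[i]) != 0 by rewrite intr_eq0.
have nE : (n%:~R : R[i]) = (n%:~R : R)%:C by rewrite rmorph_int.
have e2pi : expi (- n%:~R * (2 * pi)) = 1 :> R[i].
  by rewrite mulNr mulrC -mulrN -mulrNz expi_2pi_int.
rewrite cintegral_expi// e2pi subrr mul0r mulr0 add0r.
have e1 : \sum_(y <- ys) beta y * cintegral `[0, 2 * pi]
      (fun x => (0 < y < 2 * pi)%R%:R * ((x < y)%R%:R * expi (- n%:~R * x))) =
  \sum_(y <- ys) beta y * ((expi (- (n%:~R * y)) - 1) / ('i * (- n%:~R)%:C)).
  rewrite big_seq [RHS]big_seq; apply: eq_bigr => y /yin yy; congr (_ * _).
  rewrite cintegralZ; last by have /andP[y1 y2] := yy; apply: (cintegral_lt_expi _ _ _).1.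
  have /andP[y1 y2] := yy; rewrite yy mul1r -mulNr.
  exact: (cintegral_lt_expi _ _ _).2.
rewrite e1 big_cons /bb eqxx mulr0 oppr0 expi0 mulr1.
have -> : \sum_(j <- ys) (if j == 0 then - \sum_(y <- ys) beta y else beta j) / D * expi (- (n%:~R * j))
   = \sum_(j <- ys) beta j / D * expi (- (n%:~R * j)).
  rewrite big_seq [RHS]big_seq; apply: eq_bigr => y yys.
  by case: eqP => // y00; rewrite y00 (negbTE z0) in yys.
rewrite mulNr mulr_suml -sumrN -big_split/= mulr_sumr mulr_sumr.
apply: eq_bigr => y _; rewrite nE rmorphN/= /D.
set eN := expi _; set bt := beta y.
have pC : (2 * pi : R)%:C != 0 by rewrite (inj_eq (@complexI R)) lt0r_neq0.
have -> : ((2 * pi)^-1)%:C = ((2 * pi)%:C)^-1 :> R[i] by exact: fmorphV.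
move: pC; move: ((2 * pi : R)%:C) => tp pC; rewrite -nE; field.
by rewrite nC pC neq0Ci.
Qed.

End ComplexIntegral.

(** * Almost every real number is Diophantine *)

Section DiophantineAE.
Variable R : realType.
Notation mu := (@lebesgue_measure R).

(** A discrete form of the comparison with the integral of [x^-(1 + s)]: one has [(n / (n + 1))^s <=
    e^(- s / (n + 1)) <= 1 / (1 + s / (n + 1))], and the 3 comes from [n + 1 + s <= 3 n]. *)
Lemma powR_telescope (s : R) (n : nat) : 0 < s <= 1 -> (0 < n)%N ->
  n%:R `^ (- (1 + s)) <= 3 / s * (n%:R `^ (- s) - n.+1%:R `^ (- s)).
Proof.
move=> /andP[s0 s1] n0; have nR : 1 <= n%:R :> R by rewrite ler1n.
have nR0 : 0 < n%:R :> R by rewrite ltr0n.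
have mR0 : 0 < n.+1%:R :> R by rewrite ltr0n.
have mE : n.+1%:R = n%:R + 1 :> R by rewrite natr1.
pose r : R := (n%:R / n.+1%:R) `^ s.
have rle : r <= (1 + s / n.+1%:R)^-1.
  have ln_le : ln (n%:R / n.+1%:R) <= - n.+1%:R^-1 :> R.
    rewrite (_ : n%:R / n.+1%:R = 1 + - n.+1%:R^-1).
      by rewrite le_ln1Dx// ltrN2 invf_lt1// mE; lra.
    by rewrite mE; field; rewrite -mE lt0r_neq0.
  rewrite /r /powR gt_eqF ?divr_gt0//.
  rewrite (@le_trans _ _ (expR (- (s / n.+1%:R))))//.
    by rewrite ler_expR -mulrN ler_wpM2l// ltW.
  rewrite expRN lef_pV2 ?posrE ?expR_gt0 ?expR_ge1Dx//.
  by rewrite addr_gt0// divr_gt0.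
have E : n.+1%:R `^ (- s) = n%:R `^ (- s) * r.
  rewrite /r powRM ?invr_ge0//.
  rewrite -[X in _ * (_ * X `^ _)](powR_inv1 (ltW mR0)) -powRrM mulN1r !powRN.
  by rewrite mulKf// gt_eqF// powR_gt0.
rewrite E -[X in _ * (X - _)]mulr1 -mulrBr.
have -> : n%:R `^ (- (1 + s)) = n%:R `^ (- s) * n%:R^-1.
  rewrite opprD addrC powRD; last by rewrite (gt_eqF nR0) implybT.
  by rewrite powR_inv1// ltW.
rewrite mulrCA ler_wpM2l ?powR_ge0//.
have h1 : 1 - r >= s / (3 * n%:R).
  have : (1 + s / n.+1%:R)^-1 <= 1 - s / (3 * n%:R).
    rewrite -[leLHS]mul1r ler_pdivrMr; last by rewrite addr_gt0// divr_gt0.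
    have -> : (1 - s / (3 * n%:R)) * (1 + s / n.+1%:R) =
      1 + s * (3 * n%:R - (n%:R + 1) - s) / (3 * n%:R * n.+1%:R).
      by rewrite mE; field; rewrite -mE !lt0r_neq0.
    rewrite lerDl; apply: divr_ge0; last by rewrite !mulr_ge0.
    by apply: mulr_ge0; [exact: ltW|move: s1 nR; clear; lra].
  by lra.
rewrite (@le_trans _ _ (3 / s * (s / (3 * n%:R))))//.
  by rewrite le_eqVlt; apply/orP; left; apply/eqP; field; rewrite !lt0r_neq0.
by rewrite ler_wpM2l// divr_ge0// ltW.
Qed.

Lemma sum_powR_tail (s : R) (N M : nat) : 0 < s <= 1 -> (0 < N)%N ->
  \sum_(N <= n < M) n%:R `^ (- (1 + s)) <= 3 / s * N%:R `^ (- s).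
Proof.
move=> s01 N0; have /andP[s0 s1] := s01.
have C0 : 0 <= 3 / s by rewrite divr_ge0// ltW.
have [NM|MN] := leqP N M; last first.
  by rewrite big_geq ?(ltnW MN)// mulr_ge0 ?powR_ge0.
rewrite (@le_trans _ _ (\sum_(N <= n < M) 3 / s * (n%:R `^ (- s) - n.+1%:R `^ (- s))))//.
  rewrite big_nat [leRHS]big_nat ler_sum// => n /andP[Nn _].
  by rewrite powR_telescope// (leq_trans N0).
rewrite -mulr_sumr ler_wpM2l//.
under eq_bigr do rewrite -opprB.
by rewrite sumrN telescope_sumr// opprB gerBl powR_ge0.
Qed.

Lemma measure_bigsetU_le (I : Type) (s : seq I) (F : I -> set R) (c : R) :
  (forall i, measurable (F i)) -> (forall i, (mu (F i) <= c%:E)%E) ->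
  (mu (\big[setU/set0]_(i <- s) F i) <= ((size s)%:R * c)%:E)%E.
Proof.
move=> mF hF; elim: s => [|i s IH]; first by rewrite big_nil measure0 mul0r.
rewrite big_cons (le_trans (measureU2 _ _ _))//.
- exact: mF.
- by apply: bigsetU_measurable => j _; exact: mF.
by rewrite /= -natr1 mulrDl mul1r EFinD addeC leeD.
Qed.

Lemma negligible_le_inv (A : set R) (C : R) :
  (forall k : nat, exists V : set R, [/\ measurable V, A `<=` V & (mu V <= (C / k.+1%:R)%:E)%E]) ->
  mu.-negligible A.
Proof.
move=> /choice[V HV].
have mV k : measurable (V k) by have [] := HV k.
have AV k : A `<=` V k by have [] := HV k.
have lV k : (mu (V k) <= (C / k.+1%:R)%:E)%E by have [] := HV k.
have mI : measurable (\bigcap_k V k) by exact: bigcapT_measurable.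
exists (\bigcap_k V k); split => //; last by move=> x Ax k _; exact: AV.
apply/eqP; rewrite eq_le measure_ge0 andbT; apply/lee_addgt0Pr => eps e0.
rewrite add0e.
pose k := Num.truncn (C / eps).
rewrite (@le_trans _ _ (mu (V k)))//.
  by apply: le_measure; rewrite ?inE; [exact: mI|exact: mV|move=> x; apply].
rewrite (le_trans (lV k))// lee_fin ler_pdivrMr ?ltr0n// mulrC -ler_pdivrMr//.
by rewrite ltW// truncnS_gt.
Qed.

(** For a given [c0] the exceptional [c] lie in balls around [(j / q - b) / a], with [O(q)] values
    of [j] and radius [c0 q^-(2 + e) / |a|]; their total measure is [O(c0)]. An exceptional [c]
    fails for every [c0], in particular for all [c0 = 1 / (k + 1)]. *)
Lemma negligible_diophantine_bounded (a b e : R) (n : nat) : a != 0 -> 0 < e <= 1 ->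
  mu.-negligible [set c : R | `|c| <= n%:R /\ ~ exists c0 : R, 0 < c0 /\
    forall (q : nat) (j : int), (0 < q)%N ->
    c0 * q%:R `^ (- (1 + e)) <= `|q%:R * (a * c + b) - j%:~R|].
Proof.
move=> a0 e01; have /andP[e0 e1] := e01.
have a0' : 0 < `|a| by rewrite normr_gt0.
(* An approximation with error below 1 forces [|j| <= q (|a| n + |b|) + 1 <= q D]. *)
pose D := (Num.truncn (`|a| * n%:R + `|b| + 1)).+1.
have DE : `|a| * n%:R + `|b| + 1 < D%:R by exact: truncnS_gt.
apply: (@negligible_le_inv _ (6 * D%:R / `|a| * (3 / e))) => k.
pose c0 : R := k.+1%:R^-1.
have c00 : 0 < c0 by rewrite invr_gt0 ltr0n.
have c01 : c0 <= 1 by rewrite invf_le1 ?ltr0n// ler1n.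
pose rho (q : nat) : R := c0 * q%:R `^ (- (1 + e)) / (q%:R * `|a|).
pose js (q : nat) : seq int := [seq (i%:Z - (q * D)%:Z) | i <- iota 0 (2 * (q * D)).+1].
pose V (i : nat) : set R := \big[setU/set0]_(j <- js i.+1)
   ball ((j%:~R / i.+1%:R - b) / a : R) (rho i.+1).
have mV i : measurable (V i).
  by apply: bigsetU_measurable => j _; exact: measurable_ball.
have rho0 i : 0 < rho i.+1.
  by rewrite divr_gt0 ?mulr_gt0 ?powR_gt0 ?ltr0n.
exists (\bigcup_i V i); split.
- exact: bigcupT_measurable.
- move=> c /= [cn nc].
  have {}nc : ~ forall (q : nat) (j : int), (0 < q)%N ->
      c0 * q%:R `^ (- (1 + e)) <= `|q%:R * (a * c + b) - j%:~R|.
    by move=> h; apply: nc; exists c0.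
  move/existsNP : nc => [q /existsNP[j /not_implyP[q0 /negP]]]; rewrite -ltNge => hqj.
  case: q q0 hqj => // q _ hqj; exists q => //.
  have qR : 0 < q.+1%:R :> R by rewrite ltr0n.
  have q1 : 1 <= q.+1%:R :> R by rewrite ler1n.
  have p1 : q.+1%:R `^ (- (1 + e)) <= 1 :> R.
    by rewrite -[leRHS](powRr0 q.+1%:R) ler_powR//; lra.
  have h1 : `|q.+1%:R * (a * c + b) - j%:~R| < 1.
    by rewrite (lt_le_trans hqj)// mulr_ile1 ?powR_ge0// ltW.
  have hj : `|j%:~R| <= q.+1%:R * D%:R :> R.
    have h2 : `|q.+1%:R * (a * c + b)| <= q.+1%:R * (`|a| * n%:R + `|b|).
      rewrite normrM ger0_norm ?ler0n// ler_wpM2l// (le_trans (ler_normD _ _))//.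
      by rewrite normrM lerD2r ler_wpM2l.
    have h3 : `|j%:~R| <= `|q.+1%:R * (a * c + b)| + `|q.+1%:R * (a * c + b) - j%:~R| :> R.
      by rewrite -[X in `|X| <= _](subKr (q.+1%:R * (a * c + b))) (le_trans (ler_normB _ _)).
    have h4 : q.+1%:R * (`|a| * n%:R + `|b| + 1) <= q.+1%:R * D%:R by rewrite ler_wpM2l// ltW.
    by move: h1 h2 h3 h4 q1; clear; lra.
  rewrite /V -bigcup_seq; exists j => /=.
    rewrite /js; apply/mapP; exists (absz (j + (q.+1 * D)%:Z)%R).
      rewrite mem_iota add0n.
      move: hj; rewrite -natrM -intr_norm -[X in _ <= X]/((q.+1 * D)%:Z%:~R) ler_int.
      by move: (q.+1 * D)%N => u; clear; lia.
    move: hj; rewrite -natrM -intr_norm -[X in _ <= X]/((q.+1 * D)%:Z%:~R) ler_int.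
    by move: (q.+1 * D)%N => u; clear; lia.
  rewrite /ball /= /rho ltr_pdivlMr ?mulr_gt0//.
  rewrite (_ : `|_| * _ = `|q.+1%:R * (a * c + b) - j%:~R|)//.
  rewrite -[X in _ * (X * _)](ger0_norm (ltW qR)) -!normrM -normrN.
  by congr `|_|; field; rewrite ?a0 ?lt0r_neq0.
have hV i : (mu (V i) <= ((6 * D%:R / `|a| * c0) * i.+1%:R `^ (- (1 + e)))%:E)%E.
  rewrite (le_trans (measure_bigsetU_le (c := rho i.+1 *+ 2) _ _ _))//.
  - by move=> j; exact: measurable_ball.
  - by move=> j; rewrite lebesgue_measure_ball// ltW.
  rewrite lee_fin size_map size_iota.
  have qR : 0 < i.+1%:R :> R by rewrite ltr0n.
  have hs : (2 * (i.+1 * D)).+1%:R <= 3 * (i.+1%:R * D%:R) :> R.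
    rewrite -!natrM ler_nat; have : (0 < i.+1 * D)%N by rewrite muln_gt0.
    by move: (i.+1 * D)%N => u; clear; lia.
  rewrite (le_trans (ler_wpM2r _ hs)) ?mulrn_wge0 ?(ltW (rho0 i))//.
  rewrite /rho le_eqVlt; apply/orP; left; apply/eqP; rewrite -mulr_natr; field.
  by rewrite !lt0r_neq0.
have := measure_sigma_subadditive mu mV (bigcupT_measurable V mV) (@subset_refl _ _).
move=> /le_trans; apply.
rewrite (le_trans (lee_nneseries _ (fun i _ => hV i)))//.
apply: lime_le.
  apply: is_cvg_nneseries => i _ _; rewrite lee_fin mulr_ge0 ?powR_ge0//.
  by rewrite !mulr_ge0 ?invr_ge0// ltW.
apply: nearW => m; rewrite sumEFin lee_fin -mulr_sumr.
have := sum_powR_tail m.+1 e01 (ltn0Sn 0).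
rewrite powR1 mulr1 big_add1/= => h.
rewrite (le_trans (ler_wpM2l _ h)); last 2 first.
- by rewrite !mulr_ge0 ?invr_ge0// ltW.
- by rewrite /c0 le_eqVlt; apply/orP; left; apply/eqP; ring.
by [].
Qed.

Lemma ae_diophantine (a b : R) : a != 0 ->
  {ae mu, forall c : R, diophantine (a * c + b)}.
Proof.
move=> a0.
have H k : {ae mu, forall c : R, exists c0 : R, 0 < c0 /\
    forall (q : nat) (j : int), (0 < q)%N ->
    c0 * q%:R `^ (- (1 + k.+1%:R^-1)) <= `|q%:R * (a * c + b) - j%:~R|}.
  have e01 : 0 < (k.+1%:R^-1 : R) <= 1.
    by rewrite invr_gt0 ltr0n/= invf_le1 ?ltr0n// ler1n.
  apply: (negligibleS _ (negligible_bigcup (fun n => negligible_diophantine_bounded b n a0 e01))).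
  move=> c /= nc; exists (Num.truncn `|c|).+1 => //=; split => //.
  by rewrite ltW// truncnS_gt.
apply: filterS (ae_foralln H) => c hc eps eps0.
pose k := Num.truncn eps^-1.
have ke : k.+1%:R^-1 <= eps.
  rewrite -[leRHS]invrK lef_pV2 ?posrE ?invr_gt0 ?ltr0n//.
  by rewrite ltW// truncnS_gt.
have [c0 [c00 h]] := hc k; exists c0; split => // q j q0.
rewrite (le_trans _ (h q j q0))// ler_pM2l// ler_powR ?ler1n//.
by rewrite lerN2 lerD2l.
Qed.

End DiophantineAE.

(** * Abel summation for tails and for increments *)

Section AbelBounds.
Variable R : realType.
Implicit Types (u : nat -> R[i]) (C s h : R) (N M : nat).

Lemma normc_natV n : normc ((n%:R : R[i])^-1) = n%:R^-1.
Proof.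
by rewrite -[n%:R](rmorph_nat (real_complex R)) -fmorphV normc_real ger0_norm ?invr_ge0.
Qed.

Lemma powR_1B (N : nat) s : (0 < N)%N -> N%:R `^ (1 - s) = N%:R * N%:R `^ (- s) :> R.
Proof. by move=> N0; rewrite powR_addr ?ltr0n// powRr1. Qed.

Lemma abel_tail u C s N M : 0 < s <= 1 -> 0 <= C ->
  (forall L, (0 < L)%N -> normc (\sum_(n < L) u n) <= C * L%:R `^ (1 - s)) ->
  (0 < N <= M)%N ->
  normc (\sum_(N <= n < M) n%:R^-1 * u n) <= (2 + 3 / s) * C * N%:R `^ (- s).
Proof.
move=> s01 C0 hu /andP[N0 NM]; have M0 : (0 < M)%N by apply: leq_trans NM.
have /andP[s0 s1] := s01.
apply: (le_trans (normc_abel _ _ NM)); rewrite !normc_natV.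
have hend L : (0 < L)%N -> L%:R^-1 * normc (\sum_(i < L) u i) <= C * L%:R `^ (- s).
  move=> L0; rewrite ler_pdivrMl ?ltr0n// mulrCA -powR_1B//; exact: hu.
have hM : M%:R^-1 * normc (\sum_(i < M) u i) <= C * N%:R `^ (- s).
  rewrite (le_trans (hend _ M0))// ler_wpM2l// !powRN lef_pV2 ?posrE ?powR_gt0 ?ltr0n//.
  by rewrite ge0_ler_powR ?nnegrE ?ler_nat// ltW.
have hS : \sum_(N <= i < M) normc ((i.+1%:R : R[i])^-1 - i%:R^-1) * normc (\sum_(j < i.+1) u j)
    <= C * (3 / s * N%:R `^ (- s)).
  apply: (le_trans _ (ler_wpM2l C0 (sum_powR_tail M s01 N0))).
  rewrite mulr_sumr big_nat [leRHS]big_nat ler_sum// => i /andP[Ni _].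
  have i0 : (0 < i)%N by apply: leq_trans Ni.
  have iR : 0 < i%:R :> R by rewrite ltr0n.
  rewrite (_ : _ - _ = - (i%:R^-1 * i.+1%:R^-1)); last first.
    by field; rewrite ?nat1r ?natr1 !pnatr_eq0 -?lt0n ?i0.
  rewrite normcN normcM !normc_natV.
  apply: (le_trans (ler_wpM2l _ (hu _ (ltn0Sn i)))); first by rewrite mulr_ge0 ?invr_ge0.
  rewrite powR_1B// mulrCA ler_wpM2l//.
  rewrite -mulrA (mulKf (_ : i.+1%:R != 0)) ?pnatr_eq0//.
  rewrite opprD powR_addr// (powR_inv1 (ltW iR)) ler_wpM2l ?invr_ge0//.
  rewrite !powRN lef_pV2 ?posrE ?powR_gt0//.
  by rewrite ge0_ler_powR ?nnegrE ?ler_nat// ltW.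
have hN := hend _ N0.
rewrite (_ : _ * _ * _ = C * N%:R `^ (- s) + C * N%:R `^ (- s) + C * (3 / s * N%:R `^ (- s))).
  by rewrite !lerD.
by ring.
Qed.

(** The phases [th] behave like a polynomial of degree [d + 2], so the weight
    [n^-1 (e^{i th_n h} - 1)] is [O(|h| n^(d + 1))] and changes by [O(|h| n^d)] from one index to
    the next. Abel summation keeps the saving [N^-s], which absolute values would lose. *)
Lemma abel_low u C (Ct : R) s h (th : nat -> R) (d N : nat) : 0 <= s <= 1 -> 0 <= C -> 0 <= Ct ->
  (forall L, (0 < L)%N -> normc (\sum_(n < L) u n) <= C * L%:R `^ (1 - s)) ->
  (forall n, (0 < n)%N -> `|th n| <= Ct * n%:R ^+ d.+2) ->
  (forall n, (0 < n)%N -> `|th n.+1 - th n| <= Ct * n%:R ^+ d.+1) ->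
  (0 < N)%N ->
  normc (\sum_(1 <= n < N) n%:R^-1 * ((expi (th n * h) - 1) * u n)) <=
    4 * C * Ct * `|h| * (N%:R ^+ d.+2 * N%:R `^ (- s)).
Proof.
move=> /andP[s0 s1] C0 Ct0 hu hth hdth N0.
pose w n : R[i] := n%:R^-1 * (expi (th n * h) - 1).
have NR : 0 < N%:R :> R by rewrite ltr0n.
have N1 : 1 <= N%:R :> R by rewrite ler1n.
under eq_bigr do rewrite mulrA -/(w _).
apply: (le_trans (normc_abel u w N0)).
have wle n : (0 < n)%N -> normc (w n) <= Ct * `|h| * n%:R ^+ d.+1.
  move=> n0; rewrite normcM normc_natV ler_pdivrMl ?ltr0n//.
  rewrite (le_trans (normc_expiB1_le _))// normrM.
  rewrite (_ : _ * (_ * _) = Ct * n%:R ^+ d.+2 * `|h|); last by rewrite !exprS; ring.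
  by rewrite ler_wpM2r// hth.
have dwle n : (0 < n)%N -> normc (w n.+1 - w n) <= 2 * Ct * `|h| * n%:R ^+ d.
  move=> n0; have nR : 0 < n%:R :> R by rewrite ltr0n.
  have -> : w n.+1 - w n = n.+1%:R^-1 * (expi (th n.+1 * h) - expi (th n * h))
      - n.+1%:R^-1 * w n.
    by rewrite /w; field; rewrite ?nat1r ?natr1 !pnatr_eq0 -?lt0n ?n0.
  rewrite (le_trans (normcB_le _ _))// normcM [normc (_ * w n)]normcM !normc_natV -mulrDr.
  rewrite ler_pdivrMl ?ltr0n//.
  have h1 : normc (expi (th n.+1 * h) - expi (th n * h)) <= Ct * `|h| * n%:R ^+ d.+1.
    rewrite (le_trans (normc_expiB_le _ _))// -mulrBl normrM mulrAC.
    by rewrite ler_wpM2r// hdth.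
  rewrite (le_trans (lerD h1 (wle _ n0)))//.
  rewrite (_ : _ + _ = 2 * Ct * `|h| * n%:R ^+ d * n%:R); last by rewrite exprS; ring.
  rewrite [leRHS]mulrC ler_wpM2l ?ler_nat// !mulr_ge0// exprn_ge0//.
have hb : C * N%:R `^ (1 - s) * (Ct * `|h| * N%:R ^+ d.+1)
    = C * Ct * `|h| * (N%:R ^+ d.+2 * N%:R `^ (- s)).
  by rewrite powR_1B// !exprS; ring.
have Np : 1 <= N%:R `^ (1 - s) :> R by rewrite -[leLHS](powRr0 N%:R) ler_powR//; lra.
have hM : normc (w N) * normc (\sum_(i < N) u i) <= C * Ct * `|h| * (N%:R ^+ d.+2 * N%:R `^ (- s)).
  by rewrite -hb mulrC ler_pM ?normc_ge0 ?hu ?wle.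
have h1 : normc (w 1%N) * normc (\sum_(i < 1) u i) <= C * Ct * `|h| * (N%:R ^+ d.+2 * N%:R `^ (- s)).
  rewrite -hb mulrC ler_pM ?normc_ge0//.
    by rewrite (le_trans (hu 1%N _))// powR1 ler_wpM2l.
  rewrite (le_trans (wle 1%N _))// ler_wpM2l ?mulr_ge0// expr1n.
  exact: exprn_ege1.
have hS : \sum_(1 <= i < N) normc (w i.+1 - w i) * normc (\sum_(j < i.+1) u j)
    <= 2 * (C * Ct * `|h| * (N%:R ^+ d.+2 * N%:R `^ (- s))).
  rewrite (@le_trans _ _ (\sum_(1 <= i < N) (2 * Ct * `|h| * N%:R ^+ d) * (C * N%:R `^ (1 - s))))//.
    rewrite big_nat [leRHS]big_nat ler_sum// => i /andP[i0 iN].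
    rewrite ler_pM ?normc_ge0//.
      rewrite (le_trans (dwle _ i0))// ler_wpM2l ?mulr_ge0//.
      by rewrite lerXn2r ?nnegrE// ler_nat ltnW.
    rewrite (le_trans (hu _ _))// ler_wpM2l// ge0_ler_powR ?nnegrE ?ler_nat//; lra.
  rewrite sumr_const_nat -[_ *+ _]mulr_natr.
  rewrite (@le_trans _ _ (2 * Ct * `|h| * N%:R ^+ d * (C * N%:R `^ (1 - s)) * N%:R))//.
    rewrite ler_wpM2l ?ler_nat ?leq_subr// !mulr_ge0 ?exprn_ge0 ?powR_ge0//.
  by rewrite powR_1B// !exprS le_eqVlt; apply/orP; left; apply/eqP; ring.
by move: hM h1 hS; clear; lra.
Qed.

End AbelBounds.

(** * Symmetric ranges of integers *)

Section Box.

Definition box (N : nat) : seq int :=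
  [seq n%:Z | n <- iota 0 N.+1] ++ [seq - n%:Z | n <- iota 1 N].

Lemma mem_box N n : (n \in box N) = (absz n <= N)%N.
Proof.
rewrite mem_cat; apply/idP/idP => [/orP[]/mapP[m]|nN].
- by rewrite mem_iota add0n ltnS => /andP[_ mN] ->.
- by rewrite mem_iota add1n ltnS => /andP[_ mN] ->; rewrite abszN.
have [n0|n0] := lerP 0 n; apply/orP; [left|right]; apply/mapP; exists (absz n).
- by rewrite mem_iota add0n ltnS.
- by move: n0; clear; lia.
- by rewrite mem_iota add1n ltnS nN andbT absz_gt0 lt_eqF.
- by move: n0; clear; lia.
Qed.

Lemma box_uniq N : uniq (box N).
Proof.
rewrite cat_uniq !map_inj_uniq ?iota_uniq//= ?andbT; last 2 first.
- by move=> i j /eqP; rewrite eqr_opp => /eqP[].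
- by move=> i j [].
apply/hasPn => n /mapP[m]; rewrite mem_iota => /andP[m0 _] ->.
by apply: (contraTN _ m0) => /(mapP (s := iota 0 N.+1))[j _]; clear; lia.
Qed.

Lemma big_box (V : zmodType) (u : int -> V) N :
  \sum_(n <- box N) u n = u 0 + \sum_(1 <= n < N.+1) (u n%:Z + u (- n%:Z)).
Proof.
rewrite big_cat !big_map big_split /= addrA; congr (_ + _).
  by rewrite /index_iota subn1 /= big_cons.
by rewrite /index_iota subn1.
Qed.

Lemma big_boxB (V : zmodType) (u : int -> V) N M : (N <= M)%N ->
  \sum_(n <- box M) u n - \sum_(n <- box N) u n =
  \sum_(N.+1 <= n < M.+1) u n%:Z + \sum_(N.+1 <= n < M.+1) u (- n%:Z).
Proof.
move=> NM; rewrite !big_box opprD addrACA subrr add0r -big_split/=.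
by rewrite (big_cat_nat (n := N.+1) (p := M.+1))//= addrAC subrr add0r.
Qed.

End Box.

(** * Convergence and Hoelder continuity of a series with controlled sums *)

Section Series.
Variable R : realType.

Lemma powR_cvg0 (s : R) : 0 < s -> (fun n : nat => n.+1%:R `^ (- s) : R) @ \oo --> (0 : R).
Proof.
move=> s0; apply/cvgrPdist_le => e e0.
exists (Num.truncn (e `^ (- s^-1))) => // n /= hn.
rewrite sub0r normrN ger0_norm ?powR_ge0//.
have en : e `^ (- s^-1) <= n.+1%:R.
  by rewrite ltW// (lt_le_trans (truncnS_gt _))// ler_nat.
rewrite powRN -[leRHS]invrK lef_pV2 ?posrE ?invr_gt0 ?powR_gt0//.
rewrite (@le_trans _ _ ((e `^ (- s^-1)) `^ s))//.
  by rewrite -powRrM mulNr mulVf ?gt_eqF// powR_inv1// ltW.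
by rewrite ge0_ler_powR ?nnegrE ?powR_ge0// ltW.
Qed.

(** Real and imaginary parts converge separately, which costs the factor 2. *)
Lemma uniform_limit (T : Type) (F : nat -> T -> R[i]) (B : nat -> R) :
  B @ \oo --> (0 : R) ->
  (forall N M x, (N <= M)%N -> normc (F M x - F N x) <= B N) ->
  exists f : T -> R[i], forall N x, normc (f x - F N x) <= 2 * B N.
Proof.
move=> B0 FB.
have cauchy_real (v : nat -> R) : (forall N M, (N <= M)%N -> `|v M - v N| <= B N) ->
    cvgn v.
  move=> vB; apply: cauchy_cvg; apply: cauchy_exP => e e0.
  move/cvgrPdist_lt : B0 => /(_ e e0)[N _ /(_ N (leqnn N))]; rewrite sub0r normrN => BN.
  exists (v N); exists N => // M /= NM.
  by rewrite /ball/= distrC (le_lt_trans (vB _ _ NM))// (le_lt_trans _ BN)// ler_norm.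
have lim_le (v : nat -> R) : (forall N M, (N <= M)%N -> `|v M - v N| <= B N) ->
    forall N, `|limn v - v N| <= B N.
  move=> vB N; apply: (cvgr_to_le (cvg_norm (cvgB (cauchy_real v vB) (cvg_cst (v N))))).
  by exists N => // M /= NM; exact: vB.
exists (fun x => limn (fun n => complex.Re (F n x)) +i* limn (fun n => complex.Im (F n x))) => N x.
have FRe n M : (n <= M)%N -> `|complex.Re (F M x) - complex.Re (F n x)| <= B n.
  by move=> nM; rewrite -raddfB (le_trans (normc_Re_le _))// FB.
have FIm n M : (n <= M)%N -> `|complex.Im (F M x) - complex.Im (F n x)| <= B n.
  by move=> nM; rewrite -raddfB (le_trans (normc_Im_le _))// FB.
rewrite (le_trans (normc_le_ReIm _))// mulr2n mulrDl mul1r !raddfB/=.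
by rewrite lerD// lim_le.
Qed.

Variables (t : int -> R -> R[i]) (theta : int -> R) (d : nat) (s0 Ct C1 : R).
Hypothesis tD : forall n x h, t n (x + h) = t n x * expi (theta n * h).
Hypothesis s01 : 0 < s0 <= 1.
Hypothesis t_sum : forall s : R, 0 < s -> s < s0 -> exists C : R, 0 <= C /\
  forall (e : bool) x (L : nat), (0 < L)%N ->
  normc (\sum_(n < L) n%:R * t ((-1) ^+ e * n%:Z) x) <= C * L%:R `^ (1 - s).
Hypothesis Ct0 : 0 <= Ct.
Hypothesis theta_le : forall (e : bool) (n : nat), (0 < n)%N ->
  `|theta ((-1) ^+ e * n%:Z)| <= Ct * n%:R ^+ d.+2.
Hypothesis thetaB_le : forall (e : bool) (n : nat), (0 < n)%N ->
  `|theta ((-1) ^+ e * n.+1%:Z) - theta ((-1) ^+ e * n%:Z)| <= Ct * n%:R ^+ d.+1.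
Hypothesis t0_le : forall x, normc (t 0 x) <= C1.

Let F N x := \sum_(n <- box N) t n x.

Let tE (e : bool) (n : nat) x : (0 < n)%N ->
  t ((-1) ^+ e * n%:Z) x = n%:R^-1 * (n%:R * t ((-1) ^+ e * n%:Z) x).
Proof. by move=> n0; rewrite mulKf// pnatr_eq0 -lt0n. Qed.

Lemma partial_sum_tail s : 0 < s -> s < s0 -> exists C : R, 0 <= C /\
  forall N M x, (N <= M)%N -> normc (F M x - F N x) <= C * N.+1%:R `^ (- s).
Proof.
move=> sp ss; have [C [C0 hC]] := t_sum sp ss; have /andP[_ s01'] := s01.
have s1 : 0 < s <= 1 by rewrite sp (le_trans (ltW ss)).
exists (2 * ((2 + 3 / s) * C)); split.
  by rewrite !mulr_ge0// addr_ge0// divr_ge0// ltW.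
move=> N M x NM; rewrite /F (big_boxB _ NM).
have half (e : bool) : normc (\sum_(N.+1 <= n < M.+1) t ((-1) ^+ e * n%:Z) x)
    <= (2 + 3 / s) * C * N.+1%:R `^ (- s).
  rewrite (_ : \sum_(_ <= _ < _) _ = \sum_(N.+1 <= n < M.+1) n%:R^-1 * (n%:R * t ((-1) ^+ e * n%:Z) x)).
    by apply: abel_tail => // L L0; exact: hC.
  by rewrite !big_nat; apply: eq_bigr => n /andP[n0 _]; rewrite -tE// (leq_trans _ n0).
rewrite (le_trans (normcD_le _ _))// [leRHS](_ : _ = (2 + 3 / s) * C * N.+1%:R `^ (- s) + (2 + 3 / s) * C * N.+1%:R `^ (- s)); last by ring.
rewrite lerD//.
  by have := half false; under eq_bigr do rewrite expr0 mul1r.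
by have := half true; under eq_bigr do rewrite expr1 mulN1r.
Qed.

Lemma partial_sum_diff s : 0 < s -> s < s0 -> exists C : R, 0 <= C /\
  forall N x h, normc (F N (x + h) - F N x) <=
    C * `|h| * (N.+1%:R ^+ d.+2 * N.+1%:R `^ (- s)) + C * `|h|.
Proof.
move=> sp ss; have [C [C0 hC]] := t_sum sp ss; have /andP[_ s01'] := s01.
have s1 : 0 <= s <= 1 by rewrite (ltW sp) (le_trans (ltW ss)).
have C10 : 0 <= C1 by rewrite (le_trans (normc_ge0 _) (t0_le 0)).
exists (2 * (4 * C * Ct) + C1 * `|theta 0|); split.
  by rewrite addr_ge0 ?mulr_ge0.
move=> N x h; rewrite /F -sumrB big_box.
have h0 : normc (t 0 (x + h) - t 0 x) <= C1 * `|theta 0| * `|h|.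
  rewrite tD -[X in _ - X]mulr1 -mulrBr normcM -mulrA ler_pM ?normc_ge0//.
  by rewrite (le_trans (normc_expiB1_le _))// normrM.
have half (e : bool) : normc (\sum_(1 <= n < N.+1) (t ((-1) ^+ e * n%:Z) (x + h) - t ((-1) ^+ e * n%:Z) x))
    <= 4 * C * Ct * `|h| * (N.+1%:R ^+ d.+2 * N.+1%:R `^ (- s)).
  rewrite (_ : \sum_(_ <= _ < _) _ = \sum_(1 <= n < N.+1) n%:R^-1 *
     ((expi (theta ((-1) ^+ e * n%:Z) * h) - 1) * (n%:R * t ((-1) ^+ e * n%:Z) x))).
    apply: (abel_low (th := fun n : nat => theta ((-1) ^+ e * n%:Z)) h s1 C0 Ct0) => //.
    - by move=> L L0; exact: hC.
    - by move=> n n0; exact: theta_le.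
    - by move=> n n0; exact: thetaB_le.
  rewrite !big_nat; apply: eq_bigr => n /andP[n0 _].
  rewrite tD [RHS]mulrCA mulKf ?pnatr_eq0 -?lt0n//; ring.
have hf := half false; have ht := half true.
move: hf ht; under eq_bigr do rewrite expr0 mul1r.
under [X in _ -> normc X <= _ -> _]eq_bigr do rewrite expr1 mulN1r.
move=> hf ht; rewrite big_split/=.
have := normcD_le (\sum_(1 <= n < N.+1) (t n%:Z (x + h) - t n%:Z x))
  (\sum_(1 <= n < N.+1) (t (- n%:Z) (x + h) - t (- n%:Z) x)).
set A := \sum_(_ <= _ < _) _; set B := \sum_(_ <= _ < _) _.
have := normcD_le (t 0 (x + h) - t 0 x) (A + B).
set W := N.+1%:R ^+ _ * _ in hf ht *.
have W0 : 0 <= W by rewrite mulr_ge0 ?exprn_ge0 ?powR_ge0.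
have := mulr_ge0 (mulr_ge0 (mulr_ge0 C10 (normr_ge0 (theta 0))) (normr_ge0 h)) W0.
have : 0 <= 2 * (4 * C * Ct) * `|h| by rewrite !mulr_ge0.
by move: hf ht h0; lra.
Qed.

(** The series is cut near [N = |h|^(-1 / (d + 2))]: the tails contribute [N^-s] and the increment
    of the partial sum [|h| N^(d + 2 - s)], and both are then of order [|h|^(s / (d + 2))]. *)
Theorem series_hoelder : exists f : R -> R[i],
  (forall s : R, 0 < s -> s < s0 -> exists C : R, 0 <= C /\
     forall N x, normc (f x - F N x) <= C * N.+1%:R `^ (- s)) /\
  (forall s : R, 0 < s -> s < s0 -> hoelder_continuous (s / d.+2%:R) f).
Proof.
have /andP[s00 s0le1] := s01.
(* The limit is defined once, with the exponent [s0 / 2]. For any other [s] the tail bound passes to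
   the same limit through partial sums far beyond [N]. *)
have sh : 0 < s0 / 2 by rewrite divr_gt0.
have sh1 : s0 / 2 < s0 by move: s00; lra.
have [C' [C'0 hC']] := partial_sum_tail sh sh1.
have B0 : (fun n : nat => C' * n.+1%:R `^ (- (s0 / 2)) : R) @ \oo --> (0 : R).
  by rewrite -[X in _ --> X](mulr0 C'); apply: cvgMr; exact: powR_cvg0.
have [f hf] := uniform_limit B0 hC'.
have tail s : 0 < s -> s < s0 -> exists C : R, 0 <= C /\
     forall N x, normc (f x - F N x) <= C * N.+1%:R `^ (- s).
  move=> sp ss; have [C [C0 hC]] := partial_sum_tail sp ss.
  exists C; split=> // N x; apply/ler_addgt0Pr => e e0.
  move/cvgrPdist_lt : B0 => /(_ (e / 2)) []; first by rewrite divr_gt0.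
  move=> M _ /(_ (maxn N M) (leq_maxr _ _)); rewrite /= sub0r normrN => BM.
  rewrite (le_trans (normcB_trans _ _ (F (maxn N M) x)))// addrC lerD//.
    exact/hC/leq_maxl.
  rewrite (le_trans (hf _ _))// mulrC -ler_pdivlMr// (le_trans (ler_norm _))//.
  exact: ltW.
exists f; split => // s sp ss.
have [Ca [Ca0 hCa]] := tail s sp ss.
have [Cb [Cb0 hCb]] := partial_sum_diff sp ss.
have C10 : 0 <= C1 by rewrite (le_trans (normc_ge0 _) (t0_le 0)).
pose D : R := d.+2%:R.
have D0 : 0 < D by rewrite ltr0n.
have D1 : 1 <= D by rewrite ler1n.
have s1 : s <= 1 by rewrite (le_trans (ltW ss)).
pose K := 2 * Ca + 2 * C1 + Cb * 2 ^+ d.+2 + Cb.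
have P0 : 0 <= Cb * 2 ^+ d.+2 by rewrite mulr_ge0 ?exprn_ge0.
have K0 : 0 <= K.
  by apply: addr_ge0 => //; apply: addr_ge0 => //; apply: addr_ge0; exact: mulr_ge0.
exists K => y x; rewrite -[y](subrK x) addrK; move: (y - x) => h; rewrite [h + x]addrC.
have [->|h0] := eqVneq h 0.
  by rewrite addr0 subrr normc0 mulr_ge0 ?powR_ge0.
have hn : 0 < `|h| by rewrite normr_gt0.
have sD0 : 0 <= s / D by rewrite divr_ge0// ltW.
have hs0 : 0 <= `|h| `^ (s / D) := powR_ge0 _ _.
have [h1|h1] := lerP `|h| 1; last first.
  have hs : 1 <= `|h| `^ (s / D) by rewrite -[leLHS](powRr0 `|h|) ler_powR// ltW.
  have f0 z : normc (f z) <= Ca + C1.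
    have := hCa 0%N z; rewrite powR1 mulr1 /F /box /= big_seq1 => hz.
    rewrite -[f z](subrK (t 0 z)) (le_trans (normcD_le _ _))// lerD//.
  rewrite (le_trans (normcB_le _ _))// (le_trans (lerD (f0 _) (f0 _)))//.
  rewrite (@le_trans _ _ (K * 1))//; last by rewrite ler_wpM2l.
  by rewrite /K; move: Cb0 P0; lra.
pose a := `|h| `^ (- D^-1).
have a1 : 1 <= a.
  rewrite /a powRN -[leLHS]invr1 lef_pV2 ?posrE ?powR_gt0//.
  rewrite [leRHS](_ : _ = 1 `^ D^-1); last by rewrite powR1.
  by rewrite ge0_ler_powR ?nnegrE// ?invr_ge0 ltW.
have a0 : 0 < a by rewrite (lt_le_trans ltr01).
pose N := Num.truncn a.
have Na : a <= N.+1%:R by rewrite ltW// truncnS_gt.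
have aN : N.+1%:R <= 2 * a.
  have : N%:R <= a by rewrite truncn_le// ltW.
  by rewrite -natr1; move: a1; lra.
have aD : a ^+ d.+2 = `|h|^-1.
  rewrite -powR_mulrn ?(ltW a0)// /a -powRrM mulNr mulVf ?lt0r_neq0//.
  by rewrite powR_inv1// ltW.
have as_ : a `^ (- s) = `|h| `^ (s / D).
  by rewrite /a -powRrM mulrNN mulrC.
have Ns : N.+1%:R `^ (- s) <= `|h| `^ (s / D).
  rewrite -as_ !powRN lef_pV2 ?posrE ?powR_gt0//.
  by rewrite ge0_ler_powR ?nnegrE ?(ltW sp) ?(ltW a0).
have hle : `|h| <= `|h| `^ (s / D).
  apply: ger1_powR; first by rewrite hn h1.
  by rewrite ler_pdivrMr// mul1r (le_trans s1).
rewrite (le_trans (normcB_trans _ _ (F N (x + h))))//.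
have e1 := hCa N (x + h).
have e2 := hCa N x.
have e3 := hCb N x h.
have e4 := normcB_trans (F N (x + h)) (f x) (F N x).
have e5 : Ca * N.+1%:R `^ (- s) <= Ca * `|h| `^ (s / D) by rewrite ler_wpM2l.
have e6 : `|h| * (N.+1%:R ^+ d.+2 * N.+1%:R `^ (- s)) <= 2 ^+ d.+2 * `|h| `^ (s / D).
  have Np0 : 0 <= N.+1%:R ^+ d.+2 :> R by exact: exprn_ge0.
  rewrite mulrA; apply: (ler_pM (mulr_ge0 (ltW hn) Np0) (powR_ge0 _ _) _ Ns).
  rewrite mulrC -ler_pdivlMr// -aD -exprMn; apply: lerXn2r aN; rewrite nnegrE//.
  by apply: mulr_ge0 => //; exact: ltW.
have e7 : Cb * (`|h| * (N.+1%:R ^+ d.+2 * N.+1%:R `^ (- s))) <= Cb * (2 ^+ d.+2 * `|h| `^ (s / D)) by rewrite ler_wpM2l.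
have e8 : Cb * `|h| <= Cb * `|h| `^ (s / D) by rewrite ler_wpM2l.
have e9 : 0 <= C1 * `|h| `^ (s / D) by rewrite mulr_ge0.
rewrite [normc (F N x - f x)]normcB in e4.
rewrite /K -/D; move: e1 e2 e3 e4 e5 e7 e8 e9.
set H := `|h| `^ (s / D); set Z := 2 ^+ d.+2; set W := _ * N.+1%:R `^ _.
set u1 := normc _; set u2 := normc _; set u3 := normc _; set u4 := normc _.
move: H Z W (N.+1%:R `^ (- s)) u1 u2 u3 u4 => H Z W V u1 u2 u3 u4; lra.
Qed.

End Series.

(** * The propagator along the line [t = c - r x] *)

Section PropagatorSeries.
Variables (R : realType) (dd : nat) (omega : {poly int}) (g : R -> R[i]) (r : rat).
Notation mu := (@lebesgue_measure R).
Hypothesis size_omega : size omega = dd.+3.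
Hypothesis r0 : r != 0.

Definition phase (n : int) : R := n%:~R - ratr r * (omega.[n])%:~R.

Definition term (c : R) (n : int) (x : R) : R[i] :=
  propagator_term (fun m : int => (omega.[m])%:~R) g (c - ratr r * x) x n.

Lemma termE c n x : term c n x =
  fourier_coef g n * expi (c * (omega.[n])%:~R) * expi (phase n * x).
Proof.
rewrite /term /propagator_term -mulrA -expiD; congr (_ * expi _).
by rewrite /phase; ring.
Qed.

Lemma termD c n x h : term c n (x + h) = term c n x * expi (phase n * h).
Proof. by rewrite !termE mulrDr expiD mulrA. Qed.

Lemma ratr_quot : ratr r = (numq r)%:~R / (denq r)%:~R :> R.
Proof. by []. Qed.

(** The negative half of the series is the positive half for [omega(-n)], so both become sums of
    polynomial phases over [n < L]. *)
Let omega_sgn (e : bool) : {poly int} := if e then omega \Po (- 'X) else omega.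

Let omega_sgnE e n : (omega_sgn e).[n] = omega.[(-1) ^+ e * n].
Proof. by case: e; rewrite /omega_sgn ?horner_comp ?hornerN ?hornerX ?mulN1r ?mul1r. Qed.

Let size_omega_sgn e : size (omega_sgn e) = dd.+3.
Proof. by case: e => //; rewrite /omega_sgn size_comp_poly2// size_polyN size_polyX. Qed.

Let phase_poly (e : bool) : {poly R} := (-1) ^+ e *: 'X - ratr r *: map_poly intr (omega_sgn e).

Let phase_polyE e (n : nat) : (phase_poly e).[n%:R] = phase ((-1) ^+ e * n%:Z).
Proof.
rewrite /phase_poly /phase hornerD hornerN !hornerZ hornerX horner_map_nat omega_sgnE.
by rewrite intrM rmorph_sign.
Qed.

Let size_phase_poly e : (size (phase_poly e) <= dd.+3)%N.
Proof.
rewrite (leq_trans (size_polyD _ _))// geq_max; apply/andP; split.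
  by rewrite (leq_trans (size_scale_leq _ _))// size_polyX.
by rewrite size_polyN (leq_trans (size_scale_leq _ _))// (leq_trans (size_poly _ _))// size_omega_sgn.
Qed.

Lemma phase_bounds : exists Ct : R, [/\ 0 <= Ct,
  (forall (e : bool) (n : nat), (0 < n)%N -> `|phase ((-1) ^+ e * n%:Z)| <= Ct * n%:R ^+ dd.+2) &
  (forall (e : bool) (n : nat), (0 < n)%N ->
    `|phase ((-1) ^+ e * n.+1%:Z) - phase ((-1) ^+ e * n%:Z)| <= Ct * n%:R ^+ dd.+1)].
Proof.
have H (e : bool) : exists Ct : R, [/\ 0 <= Ct,
  (forall (n : nat), (0 < n)%N -> `|phase ((-1) ^+ e * n%:Z)| <= Ct * n%:R ^+ dd.+2) &
  (forall (n : nat), (0 < n)%N ->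
    `|phase ((-1) ^+ e * n.+1%:Z) - phase ((-1) ^+ e * n%:Z)| <= Ct * n%:R ^+ dd.+1)].
  have [Ca [Ca0 ha]] := poly_abs_le (size_phase_poly e).
  have [Cb [Cb0 hb]] := poly_diff_le (size_phase_poly e).
  have C20 : 0 <= Cb * 2 ^+ dd.+1 by rewrite mulr_ge0 ?exprn_ge0.
  exists (Ca + Cb * 2 ^+ dd.+1); split; first by rewrite addr_ge0.
  - move=> n n0; rewrite -phase_polyE (le_trans (ha _ n%:R _ _)) ?ler1n ?ger0_norm//.
    by rewrite ler_wpM2r ?exprn_ge0// lerDl.
  - move=> n n0; rewrite -!phase_polyE (le_trans (hb _ n.+1 _))//.
    rewrite (@le_trans _ _ (Cb * 2 ^+ dd.+1 * n%:R ^+ dd.+1))//; last first.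
      by rewrite ler_wpM2r ?exprn_ge0// lerDr.
    rewrite -mulrA ler_wpM2l// -exprMn lerXn2r ?nnegrE ?mulr_ge0//.
    by rewrite -natrM ler_nat mul2n -addnn -addn1 leq_add2l.
have [C1 [C10 h1 h1']] := H true; have [C2 [C20 h2 h2']] := H false.
exists (C1 + C2); split; first by rewrite addr_ge0.
- move=> [] n n0; [apply: (le_trans (h1 n n0))|apply: (le_trans (h2 n n0))];
    by rewrite ler_wpM2r ?exprn_ge0// ?lerDl ?lerDr.
- move=> [] n n0; [apply: (le_trans (h1' n n0))|apply: (le_trans (h2' n n0))];
    by rewrite ler_wpM2r ?exprn_ge0// ?lerDl ?lerDr.
Qed.

(** The factor [n] removes the decay of the Fourier coefficient, and each jump [y] leaves an
    exponential sum in [alpha] and [z]. By [rel] the number that must be Diophantine is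
    [(l c - k y) / (2 pi)] up to sign, where [r = k / l]; it is free of [x], and so is the resulting
    constant. *)
Lemma term_sum_le (ys : seq R) (beta : R -> R[i]) (c : R) :
  (forall n : int, n != 0 ->
     fourier_coef g n = (n%:~R)^-1 * \sum_(y <- ys) beta y * expi (- (n%:~R * y))) ->
  (forall (e : bool) y, y \in ys ->
     diophantine ((-1) ^+ e * ((denq r)%:~R * c - (numq r)%:~R * y) / (2 * pi))) ->
  forall s : R, 0 < s -> s < 1 / (2 ^+ dd.+2 + 1) -> exists C : R, 0 <= C /\
  forall (e : bool) x (L : nat), (0 < L)%N ->
  normc (\sum_(n < L) n%:R * term c ((-1) ^+ e * n%:Z) x) <= C * L%:R `^ (1 - s).
Proof.
move=> hg hd s s0 s1.
pose z (e : bool) y x : R := (-1) ^+ e * (x - y) / (2 * pi).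
pose alpha x : R := (c - ratr r * x) / (2 * pi).
have pi20 : 2 * pi != 0 :> R by rewrite mulf_neq0// gt_eqF// pi_gt0.
have rel (e : bool) y x : (numq r)%:~R * z e y x =
    (-1) ^+ e * ((denq r)%:~R * c - (numq r)%:~R * y) / (2 * pi) -
    ((-1) ^+ e * denq r)%:~R * alpha x.
  rewrite /z /alpha ratr_quot intrM rmorph_sign.
  have dr : (denq r)%:~R != 0 :> R by rewrite intr_eq0 denq_neq0.
  have p0 : pi != 0 :> R by rewrite gt_eqF// pi_gt0.
  move: (_ ^+ e : R) ((denq r)%:~R : R) ((numq r)%:~R : R) (pi : R) dr p0 => u D K p dr p0.
  by field; rewrite dr p0.
have H (e : bool) y : exists C : R, y \in ys -> 0 <= C /\ forall x L, (0 < L)%N ->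
    normc (\sum_(n < L) expi (2 * pi * (alpha x * ((omega_sgn e).[n%:Z])%:~R + n%:R * z e y x)))
      <= C * L%:R `^ (1 - s).
  have [yin|] := boolP (y \in ys); last by exists 0.
  have kk0 : numq r != 0 by rewrite numq_eq0.
  have [C [C0 hC]] := expsum_bound ((-1) ^+ e * denq r) (size_omega_sgn e) (ltn0Sn dd) kk0
    (hd e y yin) (ltW s0) s1.
  exists C => _; split => // x L L0.
  exact: (hC _ _ (rel e y x)).
pose C e := projT1 (choice (H e)); pose hC e := projT2 (choice (H e)).
have C0 e y : y \in ys -> 0 <= C e y by move=> yin; have [] := hC e y yin.
pose B := \sum_(y <- ys) normc (beta y).
have B0 : 0 <= B by rewrite sumr_ge0// => y _; exact: normc_ge0.
pose K e := \sum_(y <- ys) normc (beta y) * C e y.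
have K0 e : 0 <= K e.
  rewrite /K big_seq sumr_ge0// => y yin.
  by rewrite mulr_ge0 ?normc_ge0// C0.
exists (K true + K false + B); split; first by rewrite !addr_ge0.
move=> e x L L0.
pose U n := \sum_(y <- ys) beta y *
  expi (2 * pi * (alpha x * ((omega_sgn e).[n%:Z])%:~R + n%:R * z e y x)).
have termU n : (0 < n)%N -> n%:R * term c ((-1) ^+ e * n%:Z) x = (-1) ^+ e * U n.
  move=> n0.
  have nz : (-1) ^+ e * n%:Z != 0 :> int.
    by rewrite mulf_neq0 ?signr_eq0// -lt0n.
  have nC : n%:R != 0 :> R[i] by rewrite pnatr_eq0 -lt0n.
  have E : ((-1) ^+ e * n%:Z)%:~R = (-1) ^+ e * n%:R :> R[i] by rewrite intrM rmorph_sign.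
  have ER : ((-1) ^+ e * n%:Z)%:~R = (-1) ^+ e * n%:R :> R by rewrite intrM rmorph_sign.
  rewrite /term /propagator_term hg// E ER invfM invr_sign.
  rewrite -2!mulrA mulrCA; congr (_ * _); rewrite mulVKf// mulr_suml.
  apply: eq_bigr => y _; rewrite -mulrA -expiD omega_sgnE; congr (_ * expi _).
  have p0 : pi != 0 :> R by rewrite gt_eqF// pi_gt0.
  rewrite /alpha /z; move: (_ ^+ e : R) (_%:~R : R) (pi : R) p0 => u v p p0.
  by field; rewrite p0.
have L1 : 1 <= L%:R `^ (1 - s).
  rewrite -[leLHS](powRr0 L%:R) ler_powR ?ler1n// subr_ge0 (le_trans (ltW s1))//.
  by rewrite ler_pdivrMr ?mul1r ?lerDr ?exprn_ge0// ltr_wpDr// exprn_gt0.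
have U0 : normc (U 0%N) <= B.
  rewrite (le_trans (normc_sum _ _ _))// ler_sum// => y _.
  by rewrite normcM normc_expi mulr1.
have SU : normc (\sum_(n < L) U n) <= K e * L%:R `^ (1 - s).
  rewrite exchange_big/= (le_trans (normc_sum _ _ _))// /K mulr_suml.
  rewrite big_seq [leRHS]big_seq ler_sum// => y yin.
  rewrite -mulr_sumr normcM -mulrA ler_wpM2l ?normc_ge0//.
  by have [_] := hC e y yin; apply.
(* The factor [n] kills the term at 0, where the formula for the Fourier coefficient does not apply,
   whereas the exponential sum includes [U 0]. *)
have -> : \sum_(n < L) n%:R * term c ((-1) ^+ e * n%:Z) x =
    (-1) ^+ e * (\sum_(n < L) U n - U 0%N).
  case: L L0 L1 SU => // L _ _ _.
  rewrite !big_ord_recl mul0r add0r addrAC subrr add0r mulr_sumr.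
  by apply: eq_bigr => n _; exact: termU.
rewrite normcM normcX normcN normc1 expr1n mul1r (le_trans (normcB_le _ _))//.
rewrite (le_trans (lerD SU U0))// mulrDl lerD ?ler_peMr//.
by rewrite ler_wpM2r ?powR_ge0//; case: e {SU termU U0 U}; rewrite ?lerDl ?lerDr.
Qed.

Theorem ae_propagator_series : step_function g -> nonconstant g ->
  {ae mu, forall c : R, exists f : R -> R[i],
    (forall s : R, 0 < s -> s < 1 / (2 ^+ dd.+2 + 1) -> exists C : R, 0 <= C /\
       forall N x, normc (f x - \sum_(n <- box N) term c n x) <= C * N.+1%:R `^ (- s)) /\
    (forall s : R, 0 < s -> s < 1 / (2 ^+ dd.+2 + 1) -> hoelder_continuous (s / dd.+2%:R) f)}.
Proof.
move=> sg ncg; have [ys [beta [y0 [_ _ _ _ hg]]]] := step_function_fourier sg ncg.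
have [Ct [Ct0 ph1 ph2]] := phase_bounds.
have H (e : bool) (i : nat) : {ae mu, forall c : R, (i < size ys)%N ->
    diophantine ((-1) ^+ e * ((denq r)%:~R * c - (numq r)%:~R * ys`_i) / (2 * pi))}.
  have a0 : (-1) ^+ e * (denq r)%:~R / (2 * pi) != 0 :> R.
    rewrite !mulf_neq0 ?signr_eq0 ?intr_eq0 ?denq_neq0// invr_neq0// mulf_neq0//.
    by rewrite gt_eqF// pi_gt0.
  have := ae_diophantine (- ((-1) ^+ e * (numq r)%:~R * ys`_i / (2 * pi))) a0.
  apply: (@filterS _ _ (ae_filter_ringOfSetsType mu)).
  move=> c h _; rewrite [X in diophantine X](_ : _ =
   (-1) ^+ e * (denq r)%:~R / (2 * pi) * c + - ((-1) ^+ e * (numq r)%:~R * ys`_i / (2 * pi)))//.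
  by ring.
apply: filterS2 (ae_foralln (H true)) (ae_foralln (H false)) => c ht hf.
have hd (e : bool) y : y \in ys ->
    diophantine ((-1) ^+ e * ((denq r)%:~R * c - (numq r)%:~R * y) / (2 * pi)).
  move=> yin; case: e; [have := ht (index y ys)|have := hf (index y ys)];
    by rewrite index_mem nth_index//; apply.
have p1 : 0 < (1 / (2 ^+ dd.+2 + 1) : R) <= 1.
  have q : 1 <= 2 ^+ dd.+2 + 1 :> R by rewrite lerDr exprn_ge0.
  by rewrite divr_gt0 ?(lt_le_trans ltr01 q)//= ler_pdivrMr ?mul1r// (lt_le_trans ltr01 q).
apply: (series_hoelder (t := term c) (theta := phase) (Ct := Ct) (C1 := normc (fourier_coef g 0))) => //.
- exact: termD.
- exact: term_sum_le hg hd.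
- by move=> x; rewrite /term /propagator_term normcM normc_expi mulr1.
Qed.

End PropagatorSeries.

(** * Covering numbers, variation and box dimension of graphs *)

Section BoxDimension.
Variable R : realType.
Implicit Types (E : set (R * R)) (rho e P w : R) (u : R -> R).

Lemma covering_number_le E e n (p : 'I_n -> R * R) :
  E `<=` \bigcup_i euclidean_ball (p i) e -> (covering_number E e <= n%:R%:E)%E.
Proof. by move=> cov; apply: ge_ereal_inf; exists n%:R%:E => //; exists n => //; exists p. Qed.

Lemma covering_number_ge0 E e : (0 <= covering_number E e)%E.
Proof. by apply: le_ereal_inf_tmp => _ [n _ <-]; rewrite lee_fin. Qed.

Lemma fractal_dim_le E rho (C e0 : R) : 0 < C -> 0 < e0 ->
  (forall e, 0 < e -> e < e0 -> (covering_number E e <= (C * e `^ (- rho))%:E)%E) ->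
  (fractal_dim E <= rho%:E)%E.
Proof.
move=> C0 e00 H; apply/lee_addgt0Pr => eta eta0.
(* Below the last bound [|ln C| < eta ln (1 / e)], so the constant [C] costs at most [eta] in the
   exponent. *)
pose e1 : R := Num.min e0 (Num.min 1 (expR (- (`|ln C| / eta)))).
have e10 : 0 < e1 by rewrite /e1 !lt_min e00 ltr01 expR_gt0.
apply: ge_ereal_inf.
exists (ereal_sup ((fun e : R => lne (covering_number E e) / (ln (1 / e))%:E)%E @`
  [set e : R | 0 < e < e1])).
  exists [set e : R | 0 < e < e1] => //.
  near=> e => /=; apply/andP; split; near: e; [exact: nbhs_right_gt|exact: nbhs_right_lt].
apply: ge_ereal_sup => _ [e /= /andP[ep ee1] <-].
move: ee1; rewrite /e1 !lt_min => /and3P[ee0 ee1 ee2].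
have L0 : 0 < ln (1 / e) by rewrite ln_gt0// ltr_pdivlMr// mul1r.
rewrite inver gt_eqF// lee_pdivrMr//.
have X0 : 0 < C * e `^ (- rho) by rewrite mulr_gt0// powR_gt0.
rewrite (@le_trans _ _ (lne (C * e `^ (- rho))%:E))//.
  rewrite lee_lne ?H//.
    by rewrite in_itv/= covering_number_ge0 leey.
  by rewrite in_itv/= lee_fin ltW//= leey.
rewrite lne_EFin// lnM ?posrE ?powR_gt0// ln_powR -EFinD -EFinM lee_fin.
rewrite div1r lnV// mulrDl mulrN -mulNr addrC lerD2l//.
have : `|ln C| / eta < - ln e.
  by rewrite ltrNr -ltr_expR lnK.
rewrite ltr_pdivrMr// => h; rewrite (le_trans (ler_norm _))// ltW//.
by rewrite mulrC.
Unshelve. all: by end_near. Qed.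

Lemma fractal_dim_lt E rho : (fractal_dim E < rho%:E)%E ->
  exists2 e0 : R, 0 < e0 & forall e, 0 < e -> e < e0 ->
    exists n (p : 'I_n -> R * R), E `<=` \bigcup_i euclidean_ball (p i) e /\
      n%:R <= e `^ (- rho).
Proof.
move=> /ereal_inf_lt[_ [V V0 <-]] hV.
move: V0 => [d /= d0 hd]; exists (Num.min d 1); first by rewrite lt_min d0/=.
move=> e ep; rewrite lt_min => /andP[ed e1].
have Ve : V e by apply: hd => //=; rewrite sub0r normrN gtr0_norm.
have L0 : 0 < ln (1 / e) by rewrite ln_gt0// ltr_pdivlMr// mul1r.
have : (lne (covering_number E e) / (ln (1 / e))%:E < rho%:E)%E.
  by apply: le_lt_trans hV; apply: ereal_sup_ubound; exists e.
rewrite inver gt_eqF// lte_pdivrMr// -EFinM => h.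
have : (covering_number E e < (e `^ (- rho))%:E)%E.
  rewrite -lte_lne; last 2 first.
  - by rewrite in_itv/= covering_number_ge0 leey.
  - by rewrite in_itv/= lee_fin powR_ge0 leey.
  rewrite lne_EFin ?powR_gt0// ln_powR (lt_le_trans h)// lee_fin div1r lnV//.
  by rewrite mulrN mulNr.
by move=> /ereal_inf_lt[_ [n [p hp] <-]]; rewrite lte_fin => hn; exists n, p; split => //; exact: ltW.
Qed.

(* A ball meets the graph over at most two consecutive subintervals, and over
   each of them at most one of the points at heights spaced by [2 e]. *)
Lemma variation_le_cover u P e w (x0 : R) m n (p : 'I_n -> R * R) :
  continuous u -> 0 < e -> 2 * e <= w -> 0 <= x0 -> x0 + m%:R * w <= P ->
  graph_on `[0, P] u `<=` \bigcup_i euclidean_ball (p i) e ->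
  \sum_(i < m) `|u (x0 + i.+1%:R * w) - u (x0 + i%:R * w)| <= 4 * e * n%:R.
Proof.
move=> cu e0 we x00 xP cov.
pose a (i : nat) := x0 + i%:R * w.
have w0 : 0 < w by rewrite (lt_le_trans _ we)// mulr_gt0.
have aS i : a i.+1 = a i + w by rewrite /a -natr1 mulrDl mul1r addrA.
have a_ge i : 0 <= a i by rewrite addr_ge0// mulr_ge0// ltW.
have a_le i j : (i <= j)%N -> a i <= a j.
  by move=> ij; rewrite lerD2l ler_wpM2r ?ler_nat// ltW.
pose del i := `|u (a i.+1) - u (a i)|.
(* By the intermediate value theorem the graph over the [i]-th subinterval takes [k i] heights
   spaced by [2 e], and [2 e k i] exceeds [del i]. *)
pose k i := (Num.truncn (del i / (2 * e))).+1.
pose lo i := Num.min (u (a i)) (u (a i.+1)).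
have e20 : 0 < 2 * e by rewrite mulr_gt0.
have tex i j : exists t : R, (j < k i)%N -> a i <= t <= a i.+1 /\ u t = lo i + j%:R * (2 * e).
  have [jk|] := boolP (j < k i)%N; last by exists 0.
  have aa : a i <= a i.+1 by exact: a_le.
  have jd : j%:R * (2 * e) <= del i.
    rewrite -ler_pdivlMr// -truncn_ge_nat; first exact: jk.
    exact: divr_ge0 (normr_ge0 _) (ltW e20).
  have [|t] := @IVT R u (a i) (a i.+1) (lo i + j%:R * (2 * e)) aa (continuous_subspaceT cu).
    rewrite lerDl mulr_ge0 ?(ltW e20)//=.
    rewrite (le_trans (lerD (lexx _) jd))// /lo /del.
    case: (leP (u (a i)) (u (a i.+1))) => h; first by rewrite ger0_norm ?subr_ge0// addrC subrK.
    by rewrite ltr0_norm ?subr_lt0// opprB addrC subrK.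
  by rewrite in_itv /= => ht ut; exists t.
pose t i := projT1 (choice (tex i)); pose ht i := projT2 (choice (tex i)).
have t_in i j : (j < k i)%N -> a i <= t i j <= a i.+1 by move=> jk; have [] := ht i j jk.
have u_t i j : (j < k i)%N -> u (t i j) = lo i + j%:R * (2 * e).
  by move=> jk; have [] := ht i j jk.
have bex i j : exists b : option 'I_n, (i < m)%N -> (j < k i)%N ->
    exists2 b', b = Some b' & euclidean_ball (p b') e (t i j, u (t i j)).
  have [im|] := boolP (i < m)%N; last by exists None.
  have [jk|] := boolP (j < k i)%N; last by exists None.
  have : graph_on `[0, P] u (t i j, u (t i j)).
    exists (t i j) => //=; rewrite in_itv/=; have /andP[h1 h2] := t_in i j jk.
    rewrite (le_trans (a_ge i) h1)/= (le_trans h2)// (le_trans (a_le _ _ im))//.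
  by move=> /cov[b' _ hb]; exists (Some b') => _ _; exists b'.
pose b i := projT1 (choice (bex i)); pose hb i := projT2 (choice (bex i)).
pose S := [seq (i, j) | i <- iota 0 m, j <- iota 0 (k i)].
have memS i j : (i, j) \in S = (i < m)%N && (j < k i)%N.
  apply/allpairsPdep/andP => [[i' [j' [+ + [-> ->]]]]|[im jk]].
    by rewrite !mem_iota !add0n.
  by exists i, j; rewrite !mem_iota !add0n.
have uS : uniq S.
  by apply: allpairs_uniq_dep => [|i _|[i j] [i' j'] _ _ [-> ->]]; rewrite ?iota_uniq.
(* The parity of [i] tells adjacent subintervals apart, so a ball and this bit determine the
   point. *)
pose phi (ij : nat * nat) := (b ij.1 ij.2, odd ij.1).
have close q x y : euclidean_ball q e x -> euclidean_ball q e y ->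
    `|x.1 - y.1| < 2 * e /\ `|x.2 - y.2| < 2 * e.
  have half z : euclidean_ball q e z -> `|z.1 - q.1| < e /\ `|z.2 - q.2| < e.
    move=> hz; split; apply: le_lt_trans hz; rewrite -sqrtr_sqr ler_wsqrtr//.
      by rewrite lerDl sqr_ge0.
    by rewrite lerDr sqr_ge0.
  move=> /half[x1 x2] /half[y1 y2]; split.
    rewrite (le_lt_trans (ler_distD q.1 _ _))// (distrC q.1) mulr2n mulrDl mul1r.
    exact: ltrD.
  rewrite (le_lt_trans (ler_distD q.2 _ _))// (distrC q.2) mulr2n mulrDl mul1r.
  exact: ltrD.
have far i i' j j' : (i.+1 < i')%N -> (j < k i)%N -> (j' < k i')%N ->
    2 * e <= `|t i j - t i' j'|.
  move=> ii jk jk'; have /andP[_ h2] := t_in i j jk; have /andP[h1 _] := t_in i' j' jk'.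
  have := a_le _ _ ii; rewrite aS => h3.
  by rewrite distrC ger0_norm; lra.
have phi_inj : {in S &, injective phi}.
  move=> [i j] [i' j']; rewrite !memS => /andP[im jk] /andP[im' jk'] [eb eo].
  have [b1 e1 h1] := hb i j im jk; have [b2 e2 h2] := hb i' j' im' jk'.
  move: eb; rewrite -/(b i) -/(b i') in e1 e2 *; rewrite e1 e2 => -[eb]; rewrite -eb in h2.
  have [/= c1 c2] := close _ _ _ h1 h2.
  have ii : i = i'.
    case: (ltngtP i i') => // lt.
      have : (i.+1 < i')%N.
        by rewrite ltn_neqAle lt andbT; apply: contra_eqN eo => /eqP <- /=; case: odd.
      by move=> /far /(_ jk jk'); rewrite leNgt c1.
    have : (i'.+1 < i)%N.
      by rewrite ltn_neqAle lt andbT; apply: contra_eqN eo => /eqP <- /=; case: odd.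
    by move=> /far /(_ jk' jk); rewrite distrC leNgt c1.
  rewrite -ii in jk' c2 *; move: c2; rewrite !u_t// opprD addrACA subrr add0r -mulrBl.
  rewrite normrM (gtr0_norm e20) gtr_pMl// -[j%:R]/(j%:Z%:~R) -[j'%:R]/(j'%:Z%:~R) -rmorphB.
  rewrite -intr_norm -[1]/(1%:~R) ltr_int => c2.
  by congr (_, _); move: c2; clear; lia.
have sS : (size S <= n * 2)%N.
  rewrite -(size_map phi) -[X in (_ <= X * 2)%N]card_ord.
  pose T := [seq (Some i, o) | i <- enum 'I_n, o <- [:: true; false]].
  have -> : (#|'I_n| * 2 = size T)%N by rewrite size_allpairs -cardE.
  apply: uniq_leq_size; first by rewrite map_inj_in_uniq.
  move=> _ /mapP[[i j] + ->]; rewrite memS => /andP[im jk].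
  have [b' eb _] := hb i j im jk; apply/allpairsP; exists (b', odd i) => /=.
  by rewrite mem_enum; split => //; [case: odd|rewrite /phi /= -eb].
have sSE : size S = (\sum_(i < m) k i)%N.
  rewrite size_allpairs_dep; rewrite -(big_mkord xpredT k) /index_iota subn0.
  by rewrite sumnE big_map; apply: eq_bigr => i _; rewrite size_iota.
have : \sum_(i < m) del i <= 2 * e * (\sum_(i < m) k i)%:R.
  rewrite natr_sum mulr_sumr ler_sum// => i _; rewrite mulrC -ler_pdivrMr//.
  by rewrite ltW// truncnS_gt.
rewrite -sSE => /le_trans; apply.
rewrite (@le_trans _ _ (2 * e * (n * 2)%:R))//.
  by rewrite ler_wpM2l ?(ltW e20)// ler_nat.
by rewrite natrM le_eqVlt; apply/orP; left; apply/eqP; ring.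
Qed.

(** In each column of width [e / 2] the function stays within [H = O(e^alpha)] of its value at the
    left end. Centres spaced by [e / 2] are needed: [O(1 / e)] columns with [O(e^(alpha - 1))]
    centres each. *)
Lemma hoelder_fractal_dim_le u P (C alpha : R) : 0 < P -> 0 <= C -> 0 < alpha < 1 ->
  (forall x y, `|u x - u y| <= C * `|x - y| `^ alpha) ->
  (fractal_dim (graph_on `[0%R, P] u) <= (2 - alpha)%:E)%E.
Proof.
move=> P0 C0 /andP[a0 a1] hu.
apply: (@fractal_dim_le _ _ ((2 * P + 1) * (4 * C + 1)) 1) => //.
  by rewrite mulr_gt0// ltr_wpDl// ?mulr_ge0// ltW.
move=> e e0 e1; pose D := e / 2; have D0 : 0 < D by rewrite divr_gt0.
pose H := C * D `^ alpha; have H0 : 0 <= H by rewrite mulr_ge0// powR_ge0.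
pose n := (Num.truncn (P / D)).+1; pose m := (Num.truncn (2 * H / D)).+1.
have quot_itv x : 0 <= x ->
    (Num.truncn (x / D))%:R * D <= x < (Num.truncn (x / D))%:R * D + D.
  move=> x0; have xD : 0 <= x / D by rewrite divr_ge0// ltW.
  rewrite -ler_pdivlMr// truncn_le xD/= -[X in _ < _ + X]mul1r -mulrDl natr1.
  by rewrite -ltr_pdivrMr// truncnS_gt.
pose p (k : 'I_(n * m)) := ((k %/ m)%:R * D, u ((k %/ m)%:R * D) - H + (k %% m)%:R * D).
have cov : graph_on `[0, P] u `<=` \bigcup_i euclidean_ball (p i) e.
  move=> _ [x /= + <-]; rewrite in_itv/= => /andP[x0 xP].
  have /andP[i1 i2] := quot_itv x x0; set i := Num.truncn (x / D) in i1 i2.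
  have v0 : `|u x - u (i%:R * D)| <= H.
    rewrite (le_trans (hu _ _))// ler_wpM2l// ge0_ler_powR ?nnegrE ?(ltW a0) ?(ltW D0)//.
    by rewrite ger0_norm; lra.
  move: v0; rewrite ler_norml => /andP[v1 v2].
  have v3 : 0 <= u x - u (i%:R * D) + H by lra.
  have /andP[j1 j2] := quot_itv _ v3; set j := Num.truncn _ in j1 j2.
  have ni : (i < n)%N by rewrite ltnS le_truncn// ler_wpM2r// invr_ge0 ltW.
  have mj : (j < m)%N.
    by rewrite ltnS le_truncn// ler_wpM2r ?invr_ge0 ?(ltW D0)//; lra.
  have km : (i * m + j < n * m)%N.
    apply: (@leq_trans (i.+1 * m)); last by rewrite leq_mul2r ni orbT.
    by rewrite mulSn addnC ltn_add2r.
  exists (Ordinal km) => //; rewrite /p /euclidean_ball /=.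
  rewrite divnMDl// (divn_small mj) addn0 modnMDl (modn_small mj).
  rewrite -[ltRHS](ger0_norm (ltW e0)) -sqrtr_sqr ltr_sqrt ?exprn_gt0//.
  have eD : e = 2 * D by rewrite /D; field.
  have b1 : (x - i%:R * D) ^+ 2 <= D ^+ 2.
    by rewrite lerXn2r ?nnegrE ?(ltW D0)//; lra.
  have b2 : (u x - (u (i%:R * D) - H + j%:R * D)) ^+ 2 <= D ^+ 2.
    by rewrite lerXn2r ?nnegrE ?(ltW D0)//; lra.
  have b3 : 0 < D ^+ 2 by rewrite exprn_gt0.
  by rewrite eD exprMn; lra.
rewrite (le_trans (covering_number_le cov))// lee_fin natrM.
have eV : 1 <= e^-1 by rewrite invf_ge1// ltW.
have hn : n%:R <= (2 * P + 1) * e^-1.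
  have : (Num.truncn (P / D))%:R <= P / D by rewrite truncn_le divr_ge0// ltW.
  have PD : P / D = 2 * P * e^-1 by rewrite /D; field; rewrite gt_eqF.
  have -> : n%:R = (Num.truncn (P / D))%:R + 1 :> R by rewrite natr1.
  by move: (Num.truncn _) => T; rewrite PD mulrDl mul1r; move: eV; lra.
have hm : m%:R <= (4 * C + 1) * e `^ (alpha - 1).
  have h1 : (Num.truncn (2 * H / D))%:R <= 2 * H / D.
    by rewrite truncn_le; apply: divr_ge0; [exact: mulr_ge0|exact: ltW].
  have h2 : 2 * H / D <= 4 * C * e `^ (alpha - 1).
    rewrite /H -mulrA -mulrA.
    have -> : D `^ alpha / D = D `^ (alpha - 1).
      by rewrite powR_addr// powR_inv1// ltW.
    have : D `^ (alpha - 1) <= 2 * e `^ (alpha - 1).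
      rewrite /D powRM ?(ltW e0)// mulrC ler_wpM2r ?powR_ge0//.
      rewrite -[2^-1]powR_inv1// -powRrM mulN1r opprB ler1_powR//; last by lra.
      by rewrite ler1n.
    move=> /(ler_wpM2l C0); move: (C * D `^ _) => Q; move: (e `^ _) => Z; lra.
  have h3 : 1 <= e `^ (alpha - 1).
    rewrite -opprB powRN invf_ge1 ?powR_gt0// -[leRHS](powRr0 e).
    by rewrite ger_powR ?e0 ?ltW//; lra.
  have -> : m%:R = (Num.truncn (2 * H / D))%:R + 1 :> R by rewrite natr1.
  by move: (Num.truncn _) h1 => T h1; rewrite mulrDl mul1r; lra.
rewrite (le_trans (ler_pM _ _ hn hm))// mulrACA ler_wpM2l//.
  by rewrite mulr_ge0// addr_ge0// mulr_ge0// ltW.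
rewrite -(powR_inv1 (ltW e0)) -powR_addr// (_ : -1 + _ = - (2 - alpha))//.
by ring.
Qed.

End BoxDimension.

(** * Orthogonality of exponentials on grids and over periods *)

Section Orthogonality.
Variable R : realType.
Notation mu := (@lebesgue_measure R).

(** The character [e^{2 pi i v j / K}] of [Z / K]. Means over a period are replaced by means over
    [K] equally spaced points, on which orthogonality is exact as long as frequencies differ by less
    than [K]. *)
Definition wave (K : nat) (v : int) (j : nat) : R[i] :=
  expi (2 * pi * (v%:~R * (j%:R / K%:R))).

Lemma wave0 K j : wave K 0 j = 1.
Proof. by rewrite /wave mul0r mulr0 expi0. Qed.

Lemma waveB K v w j : wave K (v - w) j = wave K v j * (wave K w j)^*%C.
Proof. by rewrite /wave -expiN -expiD rmorphB; congr expi; rewrite /=; ring. Qed.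

Lemma sum_wave K v : (0 < K)%N -> (absz v < K)%N ->
  \sum_(j < K) wave K v j = if v == 0 then K%:R else 0.
Proof.
move=> K0 vK; have KR : 0 < K%:R :> R by rewrite ltr0n.
case: eqVneq => [->|v0].
  by under eq_bigr do rewrite wave0; rewrite sumr_const card_ord.
pose z := expi (2 * pi * (v%:~R / K%:R) : R).
have zE j : wave K v j = z ^+ j by rewrite -expiM_nat; congr expi; ring.
under eq_bigr do rewrite zE.
have z1 : z - 1 != 0.
  apply/eqP => z1; have : K%:R^-1 <= normc (z - 1).
    apply: normc_expiB1_ge => k; rewrite -[X in _ <= `|X|](mulfK (lt0r_neq0 KR)).
    rewrite normrM (@ger0_norm _ K%:R^-1) ?invr_ge0 ?(ltW KR)// ler_peMl ?invr_ge0 ?(ltW KR)//.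
    rewrite mulrBl divfK ?lt0r_neq0// -[K%:R]/(K%:Z%:~R) -rmorphM -rmorphB -intr_norm.
    rewrite -[1]/(1%:~R) ler_int.
    have : v - k * K%:Z != 0.
      apply/negP => /eqP /subr0_eq vE; move: v0 vK; rewrite vE mulf_eq0 negb_or.
      by move=> /andP[k0 _]; rewrite abszM ltnNge leq_pmull// absz_gt0.
    by move: (v - _); clear; lia.
  by rewrite z1 normc0 leNgt invr_gt0 KR.
apply: (mulfI z1); rewrite mulr0 -subrX1 /z -expiM_nat.
rewrite (_ : _ * _ = 2 * pi * v%:~R) ?expi_2pi_int ?subrr//.
by field; rewrite lt0r_neq0.
Qed.

Lemma sum_wave_inner (I J : eqType) (K : nat) (s : seq I) (t : seq J)
    (a : I -> R[i]) (b : J -> R[i]) (v : I -> int) (w : J -> int) : (0 < K)%N ->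
  (forall i j, i \in s -> j \in t -> (absz (v i - w j) < K)%N) ->
  \sum_(x < K) (\sum_(i <- s) a i * wave K (v i) x) *
    (\sum_(j <- t) b j * wave K (w j) x)^*%C =
  K%:R * \sum_(i <- s) \sum_(j <- t) a i * (b j)^*%C * (v i == w j)%R%:R.
Proof.
move=> K0 vw.
under eq_bigr => x _.
  rewrite rmorph_sum mulr_suml; under eq_bigr => i _.
    rewrite mulr_sumr; under eq_bigr => j _ do
      rewrite rmorphM/= mulrACA -waveB.
    over.
  over.
rewrite exchange_big mulr_sumr /= big_seq [RHS]big_seq; apply: eq_bigr => i si.
rewrite exchange_big mulr_sumr /= big_seq [RHS]big_seq; apply: eq_bigr => j tj.
rewrite -mulr_sumr sum_wave ?vw// subr_eq0 mulrCA; congr (_ * _).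
by case: eqP; rewrite ?mulr1 ?mulr0.
Qed.

(** Use [|a_i a_j| <= (|a_i|^2 + |a_j|^2) / 2]; by symmetry both halves give the same sum, in which
    [|a_i|^2] occurs as often as the value [v i] is taken. *)
Lemma normc_qform_le (I : eqType) (s : seq I) (a : I -> R[i]) (v : I -> int) (D : R) :
  (forall i, i \in s -> (count (fun j => v j == v i) s)%:R <= D) ->
  normc (\sum_(i <- s) \sum_(j <- s) a i * (a j)^*%C * (v i == v j)%R%:R)
    <= D * \sum_(i <- s) normc (a i) ^+ 2.
Proof.
move=> hD; rewrite (le_trans (normc_sum _ _ _))//.
have sumE i : \sum_(j <- s) (v i == v j)%:R = (count (fun j => v j == v i) s)%:R :> R.
  by rewrite -sum1_count natr_sum [RHS]big_mkcond; apply: eq_bigr => j _; rewrite eq_sym; case: eqP.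
rewrite (@le_trans _ _ (\sum_(i <- s) \sum_(j <- s)
    ((normc (a i) ^+ 2 + normc (a j) ^+ 2) / 2 * (v i == v j)%:R)))//.
  apply: ler_sum => i _; rewrite (le_trans (normc_sum _ _ _))// ler_sum// => j _.
  rewrite !normcM normc_conj normc_nat ler_wpM2r//.
  by have := sqr_ge0 (normc (a i) - normc (a j)); rewrite sqrrB; lra.
have half (F : I -> I -> R) : \sum_(i <- s) \sum_(j <- s) ((F i j + F j i) / 2 * (v i == v j)%:R)
    = \sum_(i <- s) \sum_(j <- s) (F i j * (v i == v j)%:R).
  have sw : \sum_(i <- s) \sum_(j <- s) (F j i * (v i == v j)%:R) =
      \sum_(i <- s) \sum_(j <- s) (F i j * (v i == v j)%:R).
    by rewrite exchange_big; apply: eq_bigr => i _; apply: eq_bigr => j _; rewrite eq_sym.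
  transitivity ((\sum_(i <- s) \sum_(j <- s) (F i j * (v i == v j)%:R) +
      \sum_(i <- s) \sum_(j <- s) (F j i * (v i == v j)%:R)) / 2); last first.
    by rewrite sw; move: (\sum_(i <- s) _) => A; lra.
  rewrite -big_split mulr_suml; apply: eq_bigr => i _ /=.
  by rewrite -big_split mulr_suml; apply: eq_bigr => j _ /=; ring.
rewrite (half (fun i j => normc (a i) ^+ 2)) mulr_sumr.
rewrite big_seq [leRHS]big_seq ler_sum// => i si; rewrite -mulr_sumr sumE mulrC.
by rewrite ler_wpM2r ?sqr_ge0// hD.
Qed.

Lemma sum_sqr_wave_le (I : eqType) (K : nat) (s : seq I) (a : I -> R[i]) (v : I -> int) (D : R) :
  (0 < K)%N -> (forall i j, i \in s -> j \in s -> (absz (v i - v j) < K)%N) ->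
  (forall i, i \in s -> (count (fun j => v j == v i) s)%:R <= D) ->
  \sum_(x < K) normc (\sum_(i <- s) a i * wave K (v i) x) ^+ 2
    <= K%:R * (D * \sum_(i <- s) normc (a i) ^+ 2).
Proof.
move=> K0 vK hD.
have E : (\sum_(x < K) normc (\sum_(i <- s) a i * wave K (v i) x) ^+ 2)%:C =
   K%:R * \sum_(i <- s) \sum_(j <- s) a i * (a j)^*%C * (v i == v j)%R%:R.
  rewrite -(sum_wave_inner a a K0 vK) rmorph_sum.
  by apply: eq_bigr => x _; rewrite mulc_conj.
have S0 : 0 <= \sum_(x < K) normc (\sum_(i <- s) a i * wave K (v i) x) ^+ 2.
  by rewrite sumr_ge0// => x _; exact: sqr_ge0.
rewrite -[leLHS](ger0_norm S0) -normc_real E normcM normc_nat ler_wpM2l//.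
exact: normc_qform_le.
Qed.

Lemma cintegral_expi_period (a Q : R) (v : int) : 0 < Q ->
  cintegral `[a, a + Q] (fun x => expi (2 * pi * v%:~R / Q * x)) =
  if v == 0 then Q%:C else 0.
Proof.
move=> Q0; have aQ : a < a + Q by rewrite ltrDl.
case: eqVneq => [->|v0].
  rewrite mulr0 mul0r /cintegral.
  have ec : \int[mu]_(x in `[a, a + Q]) cos (0 * x) = Q.
    have dF (x : R) : is_derive x 1 (fun x : R => x) (cos (0 * x)).
      by apply: is_derive_eq; rewrite mul0r cos0.
    by rewrite (Rintegral_FTC aQ (@continuous_cosM R 0) dF) addrAC subrr add0r.
  have es : \int[mu]_(x in `[a, a + Q]) sin (0 * x) = 0.
    have dF (x : R) : is_derive x 1 (fun x : R => 0 : R) (sin (0 * x)).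
      by apply: is_derive_eq; rewrite mul0r sin0.
    by rewrite (Rintegral_FTC aQ (@continuous_sinM R 0) dF) subrr.
  by rewrite /= ec es.
set n : R := 2 * pi * v%:~R / Q.
have n0 : n != 0.
  by rewrite /n !mulf_neq0 ?invr_neq0 ?intr_eq0 ?(lt0r_neq0 Q0)// lt0r_neq0// pi_gt0.
have E : expi (n * (a + Q)) = expi (n * a).
  by rewrite mulrDr {2}/n divfK ?lt0r_neq0// expi_period.
have dFc (x : R) : is_derive x 1 (fun x : R => sin (n * x) / n : R) (cos (n * x)).
  by apply: is_derive_eq; rewrite /GRing.scale/= ?mulr1 ?mul1r; field.
have dFs (x : R) : is_derive x 1 (fun x : R => - cos (n * x) / n : R) (sin (n * x)).
  by apply: is_derive_eq; rewrite /GRing.scale/= ?mulr1 ?mul1r; field.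
rewrite /cintegral /= (Rintegral_FTC aQ (@continuous_cosM R n) dFc) (Rintegral_FTC aQ (@continuous_sinM R n) dFs).
by move: E => [-> ->]; rewrite !subrr.
Qed.

(** The analogue for integrals over a full period. It serves in the variable [c] for the
    coincidences of frequencies and in [x] for the convergence in L^2. *)
Lemma integral_sqr_expi_le (I : eqType) (s : seq I) (b : I -> R[i]) (v : I -> int)
    (D a Q : R) : 0 < Q ->
  (forall i, i \in s -> (count (fun j => v j == v i) s)%:R <= D) ->
  mu.-integrable `[a, a + Q]
     (EFin \o (fun x => normc (\sum_(i <- s) b i * expi (2 * pi * (v i)%:~R / Q * x)) ^+ 2)) /\
  (\int[mu]_(x in `[a, (a + Q)%R])
     ((normc (\sum_(i <- s) b i * expi (2 * pi * (v i)%:~R / Q * x))%R ^+ 2)%:E)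
   <= (Q * (D * \sum_(i <- s) normc (b i) ^+ 2))%:E)%E.
Proof.
move=> Q0 hD.
pose h x := \sum_(i <- s) b i * expi (2 * pi * (v i)%:~R / Q * x).
pose S := [seq (i, j) | i <- s, j <- s].
pose z (p : I * I) := b p.1 * (b p.2)^*%C.
pose e (p : I * I) (x : R) := expi (2 * pi * (v p.1 - v p.2)%:~R / Q * x).
have cM (c : R[i]) (u : R) : (c * expi u)^*%C = c^*%C * expi (- u) by rewrite rmorphM expiN.
have hE x : (normc (h x) ^+ 2)%:C = \sum_(p <- S) z p * e p x.
  rewrite -mulc_conj /h /S big_allpairs rmorph_sum mulr_suml.
  apply: eq_bigr => i _; rewrite mulr_sumr; apply: eq_bigr => j _.
  rewrite -[X in _ * X = _]/((b j * expi _)^*%C) cM mulrACA -expiD; congr (_ * expi _).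
  by rewrite rmorphB/=; ring.
have [ih ch] := cintegrable_sum S z (fun p => expi_cintegrable a (a + Q) (2 * pi * (v p.1 - v p.2)%:~R / Q)).
have chE : cintegral `[a, a + Q] (fun x => \sum_(p <- S) z p * e p x) =
    Q%:C * \sum_(i <- s) \sum_(j <- s) b i * (b j)^*%C * (v i == v j)%R%:R.
  rewrite ch /S big_allpairs mulr_sumr; apply: eq_bigr => i _; rewrite mulr_sumr.
  apply: eq_bigr => j _ /=; rewrite cintegral_expi_period// subr_eq0 mulrC /z /=.
  by case: eqP; rewrite ?mulr1 ?mulr0 ?mul0r.
have [iR _] : mu.-integrable `[a, a + Q] (EFin \o (fun x => normc (h x) ^+ 2)) /\ True.
  split=> //; have [iR _] := ih; apply: eq_integrable iR; first exact: measurable_itv.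
  by move=> x _ /=; rewrite -/(e _ _) -hE.
split; first exact: iR.
have -> : (\int[mu]_(x in `[a, (a + Q)%R]) ((normc (h x) ^+ 2)%:E) =
    (\int[mu]_(x in `[a, (a + Q)%R]) (normc (h x) ^+ 2)%R)%R%:E)%E.
  rewrite /Rintegral fineK//; apply: integrable_fin_num => //; exact: measurable_itv.
rewrite lee_fin.
have -> : (\int[mu]_(x in `[a, a + Q]) (normc (h x) ^+ 2)) =
   complex.Re (cintegral `[a, a + Q] (fun x => \sum_(p <- S) z p * e p x)).
  by rewrite /cintegral /=; apply: eq_Rintegral => x _; rewrite -hE.
rewrite chE (le_trans (ler_norm _))// (le_trans (normc_Re_le _))// normcM normc_real gtr0_norm//.
by rewrite ler_wpM2l ?(ltW Q0)//; exact: normc_qform_le.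
Qed.

End Orthogonality.

(** * Coincidences among the values of an integer polynomial *)

Section Collisions.
Variables (p : {poly int}) (d : nat).
Hypothesis size_p : size p = d.+3.

Lemma count_roots_le (q : {poly int}) (s : seq int) (m : nat) :
  q != 0 -> (size q <= m.+1)%N -> uniq s -> (count (root q) s <= m)%N.
Proof.
move=> q0 sq us; rewrite -size_filter -ltnS (leq_trans _ sq)//.
by apply: max_poly_roots; rewrite ?filter_all ?filter_uniq.
Qed.

Lemma count_value_le (s : seq int) w : uniq s ->
  (count (fun n => p.[n] == w) s <= d.+2)%N.
Proof.
move=> us; have sq : size (p - w%:P) = d.+3.
  by rewrite size_polyDl ?size_polyN size_p// size_polyC; case: (w != 0).
rewrite (eq_count (a2 := root (p - w%:P))).
  by apply: count_roots_le => //; rewrite -?size_poly_eq0 sq.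
by move=> n; rewrite rootE !hornerE subr_eq0.
Qed.

(** Otherwise [p] would be affine along the multiples of [e], and [p(e X)] minus an affine
    polynomial would have [d + 3] roots while its degree is [d + 2]. *)
Lemma shift_diff_neq0 (e w : int) : e != 0 -> p \Po ('X + e%:P) - p - w%:P != 0.
Proof.
move=> e0; apply/eqP => q0.
have step x : p.[x + e] = p.[x] + w.
  have : (p \Po ('X + e%:P) - p - w%:P).[x] = 0 by rewrite q0 horner0.
  by rewrite !hornerE horner_comp !hornerE => /eqP; rewrite -addrA -opprD subr_eq0 => /eqP.
have lin (j : nat) : p.[e * j%:Z] = p.[0] + w * j%:Z.
  elim: j => [|j IH]; first by rewrite !mulr0 addr0.
  by rewrite -addn1 PoszD !mulrDr !mulr1 step IH addrA.
pose q := p \Po (e *: 'X) - (w *: 'X + p.[0]%:P).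
have sc : size (p \Po (e *: 'X)) = d.+3.
  by rewrite size_comp_poly2 ?size_p// size_scale// size_polyX.
have s2 : (size (w *: 'X + p.[0]%:P)%R <= 2)%N.
  rewrite (leq_trans (size_polyD _ _))// geq_max size_polyC.
  rewrite (leq_trans (size_scale_leq _ _)) ?size_polyX//=.
  by case: (_ != 0).
have sq : size q = d.+3.
  by rewrite /q size_polyDl ?size_polyN sc// (leq_ltn_trans s2).
have := @count_roots_le q [seq j%:Z | j <- iota 0 d.+3] d.+2.
rewrite -size_poly_eq0 sq leqnn => /(_ isT isT).
rewrite map_inj_uniq ?iota_uniq; last by move=> i j [].
move=> /(_ isT); rewrite (eq_in_count (a2 := predT)) ?count_predT ?size_map ?size_iota ?ltnn//.
move=> _ /mapP[j _ ->] /=; rewrite rootE /q hornerD hornerN horner_comp hornerD !hornerZ !hornerX hornerC lin.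
by apply/eqP; ring.
Qed.

Lemma count_shift_le (s : seq int) (e w : int) : e != 0 -> uniq s ->
  (count (fun n => (p.[n + e] - p.[n])%R == w) s <= d.+2)%N.
Proof.
move=> e0 us; rewrite (eq_count (a2 := root (p \Po ('X + e%:P) - p - w%:P))).
  apply: count_roots_le => //; first exact: shift_diff_neq0.
  rewrite (leq_trans (size_polyD _ _))// geq_max size_polyN size_polyC.
  apply/andP; split; last by case: (w != 0).
  rewrite (leq_trans (size_polyD _ _))// geq_max size_polyN size_p leqnn andbT.
  by rewrite size_comp_poly2 ?size_p// size_XaddC.
by move=> n; rewrite rootE !hornerE horner_comp !hornerE subr_eq0.
Qed.

(* The difference [i - j] divides [p.[i] - p.[j]]. *)
Lemma count_value_diff_le (s t : seq int) (v : int) : uniq s -> uniq t -> v != 0 ->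
  (count (fun ij => (p.[ij.1] - p.[ij.2])%R == v) [seq (i, j) | i <- s, j <- t]
    <= d.+2 * (2 * size (divisors (absz v))))%N.
Proof.
move=> us ut v0.
pose E := [seq e%:Z | e <- divisors (absz v)] ++ [seq - e%:Z | e <- divisors (absz v)].
have sE : size E = (2 * size (divisors (absz v)))%N by rewrite size_cat !size_map mul2n addnn.
pose A e := [seq (n + e, n) | n <- [seq n <- t | p.[n + e] - p.[n] == v]].
rewrite -sE -size_filter.
have sA e : e != 0 -> (size (A e) <= d.+2)%N.
  by move=> e0; rewrite size_map size_filter count_shift_le.
rewrite (@leq_trans (size (flatten [seq A e | e <- E])))//.
  apply: uniq_leq_size.
    rewrite filter_uniq// allpairs_uniq// => -[i j] [i' j'] _ _ [-> ->] //.
  move=> [i j]; rewrite mem_filter /= => /andP[/eqP hv /allpairsP[[i' j'] /= [i's j't [ei ej]]]].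
  subst i' j'; apply/flattenP; exists (A (i - j)).
    apply: map_f; rewrite /E mem_cat.
    have dv : (i - j %| v)%Z by rewrite -hv dvdz_horner_sub.
    have dn : (absz (i - j))%N \in divisors (absz v) by rewrite -dvdn_divisors ?absz_gt0// dvdzE in dv *.
    case: (lerP 0 (i - j)) => h; apply/orP; [left|right]; apply/mapP; exists (absz (i - j)) => //.
      by move: h; clear; lia.
    by move: h; clear; lia.
  apply/mapP; exists j; last by rewrite addrC subrK.
  by rewrite mem_filter addrCA subrr addr0 hv eqxx.
rewrite size_flatten /shape -map_comp sumnE big_map.
rewrite (@leq_trans (\sum_(e <- E) d.+2)%N)//; last first.
  by rewrite big_const_seq count_predT iter_addn_0.
rewrite big_seq [leqRHS]big_seq leq_sum// => e eE; apply: sA.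
have dpos (m : nat) : m \in divisors (absz v) -> m != 0%N.
  by rewrite -dvdn_divisors ?absz_gt0// => /dvdn_gt0; rewrite absz_gt0 lt0n; apply.
by move: eE; rewrite mem_cat => /orP[]/mapP[m /dpos m0 ->]; rewrite ?oppr_eq0.
Qed.

(** The leading coefficient is a nonzero integer, hence at least 1 in absolute value, and beyond
    [M0] the lower order terms are at most half of [|n|^(d + 2)]. *)
Lemma poly_growth (R : realType) : exists C M0 : nat,
  [/\ (0 < C)%N, (0 < M0)%N,
    (forall n : int, (0 < absz n)%N -> (absz p.[n] <= C * absz n ^ d.+2)%N) &
    (forall n : int, (M0 <= absz n)%N -> (absz n ^ d.+2 <= 2 * absz p.[n])%N)].
Proof.
pose pR : {poly R} := map_poly intr p.
have spR : size pR = d.+3 by rewrite size_map_inj_poly//; exact: intr_inj.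
have pRE (n : int) : pR.[n%:~R] = p.[n]%:~R by rewrite /pR horner_map.
pose a := lead_coef pR.
have aE : a = (lead_coef p)%:~R by rewrite /a lead_coef_map_inj//; exact: intr_inj.
have a1 : 1 <= `|a|.
  rewrite aE -intr_norm -[1]/(1%:~R) ler_int.
  have : lead_coef p != 0 by rewrite lead_coef_eq0 -size_poly_eq0 size_p.
  by move: (lead_coef p) => u; clear; lia.
pose q := pR - a *: 'X^(d.+2).
have sq : (size q <= d.+2)%N.
  apply/leq_sizeP => j; rewrite leq_eqVlt => /orP[/eqP <-|dj].
    by rewrite coefB coefZ coefXn eqxx mulr1 /a /lead_coef spR subrr.
  rewrite coefB coefZ coefXn (gtn_eqF dj) mulr0 subr0.
  by apply: nth_default; rewrite spR.
have [Cp [Cp0 hp]] := poly_abs_le (eq_leq spR).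
have [Cq [Cq0 hq]] := poly_abs_le sq.
have nE (n : int) : `|n%:~R| = (absz n)%:R :> R by rewrite -intr_norm.
exists (Num.truncn Cp).+1, (Num.truncn (2 * Cq)).+1; split => // n n0.
  rewrite -(ler_nat R) natrM natrX -!nE -pRE.
  rewrite (le_trans (hp _ `|n%:~R| _ _))//; first by rewrite nE ler1n.
  by rewrite ler_wpM2r ?exprn_ge0// ltW// truncnS_gt.
rewrite -(ler_nat R) natrM natrX -!nE -pRE.
set y := `|n%:~R|; have y1 : 1 <= y by rewrite /y nE ler1n (leq_trans _ n0).
have yq : 2 * Cq <= y by rewrite ltW// (lt_le_trans (truncnS_gt _))// /y nE ler_nat.
have E : pR.[n%:~R] = q.[n%:~R] + a * n%:~R ^+ d.+2 by rewrite /q !hornerE subrK.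
have h1 := hq n%:~R y y1 (lexx _).
have h2 : y ^+ d.+2 <= `|a * n%:~R ^+ d.+2|.
  by rewrite normrM normrX -/y ler_peMl// exprn_ge0// (le_trans ler01).
have h3 : 2 * (Cq * y ^+ d.+1) <= y ^+ d.+2.
  by rewrite mulrA [leRHS]exprS ler_wpM2r// exprn_ge0// (le_trans ler01).
have h4 : `|a * n%:~R ^+ d.+2| <= `|pR.[n%:~R]| + `|q.[n%:~R]|.
  by rewrite -[X in `|X| <= _](addKr q.[n%:~R]) -E addrC ler_normB.
by move: h1 h2 h3 h4; clear; lra.
Qed.

End Collisions.

(** * The increments at scale [M] and their energy *)

Section FixedScale.
Variables (R : realType) (p : {poly int}) (d C M0 : nat).
Hypothesis size_p : size p = d.+3.
Hypothesis C_gt0 : (0 < C)%N.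
Hypothesis M0_gt0 : (0 < M0)%N.
Hypothesis p_le : forall n : int, (0 < absz n)%N -> (absz p.[n] <= C * absz n ^ d.+2)%N.
Hypothesis p_ge : forall n : int, (M0 <= absz n)%N -> (absz n ^ d.+2 <= 2 * absz p.[n])%N.

Definition dyadic_block (M : nat) : seq int := [seq n%:Z | n <- index_iota M.+1 (2 * M).+1].

Let norm_intr (n : int) : `|n%:~R| = (absz n)%:R :> R.
Proof. by rewrite -intr_norm. Qed.

Lemma mem_dyadic_block M n : n \in dyadic_block M -> exists2 m : nat, n = m%:Z & (M < m <= 2 * M)%N.
Proof. by move=> /mapP[m]; rewrite mem_index_iota ltnS => h ->; exists m. Qed.

Lemma dyadic_block_uniq M : uniq (dyadic_block M).
Proof. by rewrite map_inj_uniq ?iota_uniq// => i j []. Qed.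

Lemma size_dyadic_block M : size (dyadic_block M) = M.
Proof. by rewrite size_map size_iota subSS mul2n -addnn addnK. Qed.

(* The step of the increments at scale M is the period divided by [steps M];
   the constant is such that [|p.[n]| <= steps M / 2] for [n <= 2 M]. *)
Definition steps (M : nat) : nat := (2 * C * (2 * M) ^ d.+2)%N.

(** The factor acquired by the term of frequency [p.[n]] when passing to the increment over one
    [steps M]-th of the period. *)
Definition mult (M : nat) (n : int) : R[i] := expi (2 * pi * (p.[n]%:~R / (steps M)%:R)) - 1.

Lemma steps_gt0 M : (0 < M)%N -> (0 < steps M)%N.
Proof. move=> M_gt0; have : (0 < (2 * M) ^ d.+2)%N by rewrite expn_gt0 muln_gt0 M_gt0.
by rewrite /steps; move: (_ ^ _)%N => u u0; rewrite !muln_gt0 C_gt0. Qed.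

Lemma steps_ge M : (M ^ d.+2 <= steps M)%N.
Proof.
have H : (0 < 2 ^ d.+2)%N by rewrite expn_gt0.
rewrite /steps expnMn mulnA leq_pmull//; move: (2 ^ _)%N H => u u0.
by rewrite !muln_gt0 C_gt0.
Qed.

Lemma mult_le M n (B : R) : `|p.[n]%:~R| <= B -> normc (mult M n) <= 2 * pi * (B / (steps M)%:R).
Proof.
move=> h; rewrite (le_trans (normc_expiB1_le _))// normrM (@ger0_norm _ (2 * pi)); last first.
  by rewrite mulr_ge0// pi_ge0.
rewrite ler_wpM2l ?mulr_ge0 ?pi_ge0// normrM (@ger0_norm _ _^-1) ?invr_ge0//.
by rewrite ler_wpM2r// invr_ge0.
Qed.

Lemma mult_le_power M n : (0 < M)%N -> (0 < absz n)%N ->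
  normc (mult M n) <= 2 * pi * ((absz n)%:R ^+ d.+2 / M%:R ^+ d.+2).
Proof.
move=> M_gt0 n0; have M0R : 0 < M%:R ^+ d.+2 :> R by rewrite exprn_gt0 ?ltr0n.
have s0 : 0 < (steps M)%:R :> R by rewrite ltr0n steps_gt0.
rewrite (le_trans (@mult_le M n (C%:R * (absz n)%:R ^+ d.+2) _))//.
  by rewrite -intr_norm -[_ * _]/(_ * _) -natrX -natrM -[X in X <= _]/((absz p.[n])%:R) ler_nat p_le.
rewrite ler_wpM2l ?mulr_ge0 ?pi_ge0// mulrAC mulrC ler_wpM2l ?exprn_ge0//.
rewrite ler_pdivrMr// ler_pdivlMl// -natrX -natrM ler_nat /steps expnMn mulnCA.
have : (0 < 2 ^ d.+2)%N by rewrite expn_gt0.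
move: (2 ^ _)%N (M ^ _)%N => u v u0.
rewrite (_ : u * (2 * C * v) = v * C * (u * 2))%N; last by ring.
by rewrite leq_pmulr// muln_gt0 u0.
Qed.

(** On the block [p.[n] / steps M] has absolute value between a positive constant and 1/2, hence
    stays away from every integer. The test polynomial can thus divide by [mult] at bounded cost. *)
Lemma mult_ge M n : (M0 <= M)%N -> n \in dyadic_block M ->
  (4 * C * 2 ^ d.+2)%:R^-1 <= normc (mult M n).
Proof.
move=> M0M /mem_dyadic_block[m -> /andP[Mm mM]].
have M_gt0 : (0 < M)%N by rewrite (leq_trans M0_gt0).
have s0 : 0 < (steps M)%:R :> R by rewrite ltr0n steps_gt0.
have lo : (steps M <= absz p.[m%:Z] * (4 * C * 2 ^ d.+2))%N.
  have := @p_ge m%:Z (leq_trans M0M (ltnW Mm)); rewrite absz_nat => hm.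
  have hM : (M ^ d.+2 <= m ^ d.+2)%N by rewrite leq_exp2r// ltnW.
  have h := leq_mul (leq_trans hM hm) (leqnn (2 * C * 2 ^ d.+2)).
  rewrite /steps expnMn (leq_trans _ (leq_trans h _))//.
    by rewrite [X in (_ <= X)%N]mulnC mulnA.
  by rewrite (_ : 4 = 2 * 2)%N// -!mulnA mulnCA.
have hi : (2 * absz p.[m%:Z] <= steps M)%N.
  rewrite /steps -mulnA leq_mul2l/= (leq_trans (p_le _))//; last first.
    by rewrite absz_nat leq_mul2l leq_exp2r// mM orbT.
  by rewrite absz_nat (leq_trans _ Mm).
have u20 : (0 < 2 ^ d.+2)%N by rewrite expn_gt0.
have u40 : (0 < 4 * C * 2 ^ d.+2)%N by rewrite muln_gt0 muln_gt0 C_gt0 u20.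
have c0 : (4 * C * 2 ^ d.+2)%:R^-1 <= (2 : R)^-1.
  rewrite lef_pV2 ?posrE ?ltr0n// ler_nat.
  by rewrite -mulnA (_ : 4 = 2 * 2)%N// -mulnA leq_pmulr// muln_gt0 muln_gt0 C_gt0 u20.
apply: normc_expiB1_ge => k; have [->|k0] := eqVneq k 0.
  rewrite subr0 normrM norm_intr (@ger0_norm R (steps M)%:R^-1) ?invr_ge0 ?(ltW s0)//.
  rewrite ler_pdivlMr// ler_pdivrMl ?ltr0n//.
  by rewrite mulrC -natrM ler_nat.
have k1 : 1 <= `|k%:~R| :> R.
  by rewrite -intr_norm -[1]/(1%:~R) ler_int; move: k0; clear; lia.
have xh : `|p.[m%:Z]%:~R / (steps M)%:R| <= 2^-1 :> R.
  rewrite normrM norm_intr (@ger0_norm R (steps M)%:R^-1) ?invr_ge0 ?(ltW s0)//.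
  rewrite ler_pdivrMr// ler_pdivlMl// -natrM ler_nat.
  exact: hi.
have := ler_normB (p.[m%:Z]%:~R / (steps M)%:R - k%:~R) (p.[m%:Z]%:~R / (steps M)%:R : R).
rewrite addrAC subrr add0r normrN.
move: c0 k1 xh; move: (_%:R^-1) `|k%:~R| `|_ / _| `|_ - _| => u1 u2 u3 u4; lra.
Qed.

(** For [0 < |n| <= M] the multiplier is [O((|n| / M)^(d + 2))], so each of these [O(M)] terms is
    [O(1 / M^2)]. For [|n| > M] the multiplier is at most 2, and the tail of the sum of [1 / n^2] is
    [O(1 / M)]. *)
Lemma increments_energy_le (a : int -> R[i]) (B : R) : 0 <= B ->
  (forall n : int, n != 0 -> normc (a n) <= B / (absz n)%:R) -> normc (a 0) <= B ->
  exists2 C1 : R, 0 <= C1 & forall M N : nat, (0 < M)%N ->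
    \sum_(n <- box N) (normc (a n) * normc (mult M n)) ^+ 2 <= C1 / M%:R.
Proof.
move=> B0 ha ha0; have pi0 : 0 <= pi :> R := pi_ge0 R.
pose Z := B ^+ 2 * (2 * pi * (absz p.[0])%:R) ^+ 2.
pose A := B ^+ 2 * (2 * pi + 2) ^+ 2.
have A0 : 0 <= A by rewrite mulr_ge0 ?sqr_ge0.
have Z0 : 0 <= Z by rewrite mulr_ge0 ?sqr_ge0.
exists (Z + 8 * A); first by rewrite addr_ge0// mulr_ge0.
move=> M N M_gt0; have MR : 0 < M%:R :> R by rewrite ltr0n.
have M1 : 1 <= M%:R :> R by rewrite ler1n.
pose F (n : nat) : R := if (n <= M)%N then A / M%:R ^+ 2 else A * n%:R `^ (- (1 + 1)).
have F0 n : 0 <= F n.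
  by rewrite /F; case: ifP => _; rewrite mulr_ge0 ?powR_ge0 ?invr_ge0 ?exprn_ge0.
have small n : (0 < absz n)%N -> (normc (a n) * normc (mult M n)) ^+ 2 <= F (absz n).
  move=> n0; have n0' : n != 0 by rewrite -absz_gt0.
  have nR : 0 < (absz n)%:R :> R by rewrite ltr0n.
  have bound (y : R) : normc (a n) * normc (mult M n) <= B * ((2 * pi + 2) * y) ->
      (normc (a n) * normc (mult M n)) ^+ 2 <= A * y ^+ 2.
    have q0 : 0 <= normc (a n) * normc (mult M n) by rewrite mulr_ge0 ?normc_ge0.
    move=> h; have q1 := le_trans q0 h.
    by rewrite /A -!exprMn -mulrA; apply: lerXn2r h; rewrite nnegrE.
  rewrite /F; case: ifP => nM.
    rewrite -[_^-1]exprVn; apply: bound.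
    rewrite (le_trans (ler_pM (normc_ge0 _) (normc_ge0 _) (ha _ n0') (mult_le_power M_gt0 n0)))//.
    rewrite -[leLHS]mulrA; apply: (ler_wpM2l B0); rewrite mulrCA.
    rewrite (@le_trans _ _ (2 * pi * M%:R^-1))//; last first.
      by rewrite ler_wpM2r ?invr_ge0// lerDl.
    rewrite ler_wpM2l ?mulr_ge0//.
    rewrite (exprS (absz n)%:R) -mulrA mulKf ?lt0r_neq0// (exprS M%:R) invfM mulrCA.
    rewrite -[leRHS]mulr1 ler_wpM2l ?invr_ge0// ler_pdivrMr ?exprn_gt0// mul1r.
    by rewrite lerXn2r ?nnegrE// ler_nat.
  have -> : (absz n)%:R `^ (- (1 + 1)) = ((absz n)%:R^-1) ^+ 2 :> R.
    by rewrite powRN (_ : 1 + 1 = 2%:R)// powR_mulrn// exprVn.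
  apply: bound; have : normc (mult M n) <= 2.
    by rewrite /mult -[X in _ - X]expi0 normc_expi_le2.
  move=> /(ler_pM (normc_ge0 _) (normc_ge0 _) (ha _ n0'))/le_trans; apply.
  rewrite -mulrA ler_wpM2l// mulrC ler_wpM2r ?invr_ge0//.
  by rewrite lerDr mulr_ge0.
have zero : (normc (a 0) * normc (mult M 0)) ^+ 2 <= Z / M%:R.
  have h : normc (mult M 0) <= 2 * pi * (absz p.[0])%:R / (steps M)%:R.
    by rewrite -mulrA; apply: mult_le; rewrite -intr_norm.
  have s1 : M%:R <= (steps M)%:R :> R.
    by rewrite ler_nat (leq_trans _ (steps_ge M))// -[X in (X <= _)%N]expn1 leq_pexp2l.
  have s0 : 0 < (steps M)%:R :> R by rewrite (lt_le_trans MR).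
  rewrite (@le_trans _ _ ((B * (2 * pi * (absz p.[0])%:R / M%:R)) ^+ 2))//.
    rewrite lerXn2r ?nnegrE ?mulr_ge0 ?normc_ge0 ?invr_ge0//.
    rewrite ler_pM ?normc_ge0// (le_trans h)// ler_wpM2l ?mulr_ge0//.
    by rewrite lef_pV2 ?posrE.
  rewrite mulrA exprMn exprMn ler_wpM2l ?mulr_ge0 ?sqr_ge0//.
  by rewrite exprVn lef_pV2 ?posrE ?exprn_gt0// ler_eXnr.
rewrite big_box mulrDl lerD//.
rewrite (@le_trans _ _ (\sum_(1 <= n < (maxn N M).+1) 2 * F n))//.
  rewrite [leRHS](big_cat_nat (n := N.+1))//= ?ltnS ?leq_maxl//.
  rewrite -[leLHS]addr0 lerD//; last by rewrite sumr_ge0// => n _; rewrite mulr_ge0.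
  rewrite big_nat [leRHS]big_nat ler_sum// => n /andP[n0 _].
  rewrite [leRHS](_ : _ = F n + F n); last by rewrite mulr_natl mulr2n.
  apply: lerD.
    by have := small n%:Z; rewrite absz_nat; apply.
  by have := small (- n%:Z); rewrite abszN absz_nat; apply.
rewrite -mulr_sumr (_ : 8 * A / M%:R = 2 * (A / M%:R + 3 * A / M%:R)); last by ring.
rewrite ler_wpM2l// (big_cat_nat (n := M.+1))//= ?ltnS ?leq_maxr// lerD//.
  rewrite (@le_trans _ _ (\sum_(1 <= i < M.+1) A / M%:R ^+ 2))//.
    by rewrite big_nat [leRHS]big_nat ler_sum// => n /andP[_ nM]; rewrite /F -ltnS nM.
  rewrite sumr_const_nat subn1 -[_ *+ _]mulr_natr -mulrA ler_wpM2l//.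
  by rewrite expr2 invfM -mulrA mulVf ?mulr1// lt0r_neq0.
rewrite (@le_trans _ _ (A * \sum_(M.+1 <= n < (maxn N M).+1) n%:R `^ (- (1 + 1))))//.
  by rewrite mulr_sumr big_nat [leRHS]big_nat ler_sum// => n /andP[nM _]; rewrite /F leqNgt nM.
have := @sum_powR_tail R 1 M.+1 (maxn N M).+1; rewrite ltr01 lexx divr1 => /(_ isT isT) h.
rewrite [leRHS](_ : _ = A * (3 * M%:R^-1)); last by ring.
apply: (ler_wpM2l A0); rewrite (le_trans h)// ler_wpM2l//.
by rewrite powR_inv1// lef_pV2 ?posrE// ler_nat.
Qed.

End FixedScale.

Lemma count_allpairs (I J : Type) (P : pred (I * J)) (s : seq I) (t : seq J) :
  count P [seq (i, j) | i <- s, j <- t] = (\sum_(i <- s) count (fun j => P (i, j)) t)%N.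
Proof.
elim: s => [|i s IH]; first by rewrite big_nil.
by rewrite /= count_cat IH big_cons count_map.
Qed.

(** * The fourth moment of the test polynomial *)

Section FourthMoment.
Variables (R : realType) (p : {poly int}) (d C : nat).
Hypothesis size_p : size p = d.+3.
Hypothesis C_gt0 : (0 < C)%N.
Hypothesis p_le : forall n : int, (0 < absz n)%N -> (absz p.[n] <= C * absz n ^ d.+2)%N.

Lemma dyadic_block_value_le M n : n \in dyadic_block M -> (2 * absz p.[n] <= steps d C M)%N.
Proof.
move=> /mem_dyadic_block[m -> /andP[Mm mM]].
rewrite /steps -mulnA leq_mul2l/= (leq_trans (p_le _))//; last first.
  by rewrite absz_nat leq_mul2l leq_exp2r// mM orbT.
by rewrite absz_nat (leq_trans _ Mm).
Qed.

(* The moment counts the solutions of p(i) - p(j) = p(k) - p(l); each nonzero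
   common value is a multiple of i - j, hence attained few times. *)
Lemma fourth_moment_le (eps : R) : 0 < eps -> exists2 C2 : R, 0 <= C2 &
  forall (M K : nat) (tau : int -> R[i]) (B : R), (0 < M)%N -> (2 * steps d C M < K)%N ->
  0 <= B -> (forall n, n \in dyadic_block M -> normc (tau n) <= B) ->
  \sum_(x < K) normc (\sum_(n <- dyadic_block M) tau n * wave R K p.[n] x) ^+ 4
    <= K%:R * (B ^+ 4 * (C2 * M%:R `^ (2 + eps))).
Proof.
move=> eps0; pose D2 : R := d.+2%:R.
have D20 : 0 < D2 by rewrite ltr0n.
have eD : 0 < eps / D2 by rewrite divr_gt0.
have [Cd [Cd0 hd]] := divisor_bound eD.
pose G : R := (2 * C * 2 ^ d.+2)%:R `^ (eps / D2).
have G0 : 0 <= G by exact: powR_ge0.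
exists (2 * (D2 ^+ 2 + D2 * 2 * Cd * G)).
  by rewrite mulr_ge0// addr_ge0 ?sqr_ge0// !mulr_ge0// ltW.
move=> M K tau B M_gt0 sK B0 htau; set I := dyadic_block M.
have K0 : (0 < K)%N by rewrite (leq_ltn_trans _ sK).
have M1 : 1 <= M%:R :> R by rewrite ler1n.
have MR : 0 < M%:R :> R by rewrite ltr0n.
pose S := [seq (i, j) | i <- I, j <- I].
pose a (q : int * int) := tau q.1 * (tau q.2)^*%C.
pose v (q : int * int) := p.[q.1] - p.[q.2].
pose T x := \sum_(n <- I) tau n * wave R K p.[n] x.
(* The value 0 is taken by up to [O(M)] pairs, out of reach of the divisor bound; its contribution
   to [|T|^2] is the constant [A0], treated apart. *)
pose S' := [seq q <- S | v q != 0].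
pose A0 := \sum_(q <- S | v q == 0) a q.
pose A1 x := \sum_(q <- S') a q * wave R K (v q) x.
have memS q : q \in S -> q.1 \in I /\ q.2 \in I.
  by move=> /allpairsP[[i j] [/= iI jI ->]].
have sizeS : size S = (M * M)%N by rewrite size_allpairs size_dyadic_block.
have a_le q : q \in S -> normc (a q) <= B ^+ 2.
  move=> /memS[h1 h2]; rewrite normcM normc_conj expr2.
  by rewrite ler_pM ?normc_ge0 ?htau.
have TE x : (normc (T x) ^+ 2)%:C = A0 + A1 x.
  rewrite -mulc_conj /T rmorph_sum mulr_suml.
  under eq_bigr => i _.
    rewrite mulr_sumr; under eq_bigr => j _ do rewrite rmorphM/= mulrACA -waveB.
    over.
  transitivity (\sum_(q <- S) a q * wave R K (v q) x); first by rewrite /S big_allpairs.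
  rewrite (bigID (fun q => v q == 0))/=.
  rewrite /A1 big_filter; congr (_ + _); apply: eq_bigr => q /eqP ->.
  by rewrite wave0 mulr1.
have T4 x : normc (T x) ^+ 4 <= 2 * normc A0 ^+ 2 + 2 * normc (A1 x) ^+ 2.
  rewrite (exprM _ 2 2) -[normc (T x) ^+ 2]ger0_norm ?sqr_ge0// -normc_real TE.
  rewrite (@le_trans _ _ ((normc A0 + normc (A1 x)) ^+ 2))//.
    by rewrite lerXn2r ?nnegrE ?addr_ge0 ?normc_ge0 ?normcD_le.
  by have := sqr_ge0 (normc A0 - normc (A1 x)); move: (normc A0) (normc (A1 x)) => y z; lra.
have A0_le : normc A0 <= B ^+ 2 * (D2 * M%:R).
  rewrite (le_trans (normc_sum _ _ _))//.
  rewrite (@le_trans _ _ (\sum_(q <- S | v q == 0) B ^+ 2))//.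
    rewrite big_seq_cond [leRHS]big_seq_cond ler_sum// => q /andP[qS _]; exact: a_le.
  rewrite big_const_seq iter_addr_0 -[X in X <= _]mulr_natr ler_wpM2l ?sqr_ge0//.
  rewrite -natrM ler_nat count_allpairs.
  rewrite (@leq_trans (\sum_(i <- I) d.+2)%N)//.
    apply: leq_sum => i _; rewrite (eq_count (a2 := fun j => p.[j] == p.[i])).
      exact: count_value_le size_p _ _ (dyadic_block_uniq _).
    by move=> j; rewrite /v /= subr_eq0 eq_sym.
  by rewrite big_const_seq count_predT iter_addn_0 size_dyadic_block.
have vle q : q \in S -> (absz (v q) <= steps d C M)%N.
  move=> /memS[/dyadic_block_value_le h1 /dyadic_block_value_le h2].
  by rewrite /v; move: p.[q.1] p.[q.2] (steps d C M) h1 h2 => x y z; clear; lia.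
pose D := D2 * 2 * Cd * G * M%:R `^ eps.
have A1_le : \sum_(x < K) normc (A1 x) ^+ 2 <= K%:R * (D * \sum_(q <- S') normc (a q) ^+ 2).
  apply: sum_sqr_wave_le => //.
    move=> q q'; rewrite !mem_filter => /andP[_ /vle h1] /andP[_ /vle h2].
    by move: (v q) (v q') (steps d C M) h1 h2 sK => x y z; clear; lia.
  move=> q; rewrite mem_filter => /andP[q0 qS].
  have c1 : (count (fun q' => v q' == v q) S' <= d.+2 * (2 * size (divisors (absz (v q)))))%N.
    apply: leq_trans (count_value_diff_le size_p (dyadic_block_uniq M) (dyadic_block_uniq M) q0).
    by rewrite count_filter; apply: sub_count => q' /= /andP[].
  rewrite (le_trans (_ : _ <= (d.+2 * (2 * size (divisors (absz (v q)))))%:R))//.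
    by rewrite ler_nat.
  rewrite natrM natrM /D -!mulrA ler_wpM2l ?ler0n// ler_wpM2l ?ler0n//.
  rewrite (le_trans (hd _ _)) ?absz_gt0// ler_wpM2l ?(ltW Cd0)//.
  have -> : M%:R `^ eps = (M ^ d.+2)%:R `^ (eps / D2) :> R.
    by rewrite natrX -powR_mulrn// -powRrM mulrC divfK// gt_eqF.
  rewrite /G -powRM// -natrM ge0_ler_powR ?nnegrE ?(ltW eD)// ler_nat.
  by rewrite (leq_trans (vle _ qS))// /steps expnMn mulnA.
have S'_le : \sum_(q <- S') normc (a q) ^+ 2 <= B ^+ 4 * (M%:R * M%:R).
  rewrite (@le_trans _ _ (\sum_(q <- S') B ^+ 4))//.
    rewrite big_seq [leRHS]big_seq ler_sum// => q; rewrite mem_filter => /andP[_ qS].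
    rewrite (exprM _ 2 2) lerXn2r ?nnegrE ?normc_ge0 ?sqr_ge0//; exact: a_le.
  rewrite big_const_seq iter_addr_0 -[X in X <= _]mulr_natr ler_wpM2l ?exprn_ge0//.
  by rewrite -natrM ler_nat -sizeS (leq_trans (count_size _ _))// size_filter count_size.
have Dp : 0 <= D by rewrite !mulr_ge0 ?powR_ge0// ltW.
rewrite (@le_trans _ _ (\sum_(x < K) (2 * normc A0 ^+ 2 + 2 * normc (A1 x) ^+ 2)))//.
  by apply: ler_sum => x _; exact: T4.
rewrite big_split/= -mulr_sumr sumr_const card_ord -[_ *+ K]mulr_natl -mulr_sumr.
have h1 : normc A0 ^+ 2 <= B ^+ 4 * (D2 ^+ 2 * M%:R `^ (2 + eps)).
  rewrite (@le_trans _ _ ((B ^+ 2 * (D2 * M%:R)) ^+ 2))//.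
    by rewrite lerXn2r ?nnegrE ?normc_ge0 ?mulr_ge0 ?sqr_ge0// ltW.
  rewrite exprMn -exprM ler_wpM2l ?exprn_ge0// exprMn ler_wpM2l ?sqr_ge0//.
  by rewrite -powR_mulrn// ler_powR// lerDl ltW.
have h2 : \sum_(x < K) normc (A1 x) ^+ 2 <= K%:R * (B ^+ 4 * (D2 * 2 * Cd * G * M%:R `^ (2 + eps))).
  rewrite (le_trans A1_le)// ler_wpM2l//.
  rewrite (le_trans (ler_wpM2l Dp S'_le))// /D powR_addr// powR_mulrn//.
  by rewrite le_eqVlt; apply/orP; left; apply/eqP; rewrite expr2; ring.
have h1' := ler_wpM2l (ler0n R K) h1.
have -> : K%:R * (B ^+ 4 * (2 * (D2 ^+ 2 + D2 * 2 * Cd * G) * M%:R `^ (2 + eps))) =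
   2 * (K%:R * (B ^+ 4 * (D2 ^+ 2 * M%:R `^ (2 + eps)))) +
   2 * (K%:R * (B ^+ 4 * (D2 * 2 * Cd * G * M%:R `^ (2 + eps)))) by ring.
rewrite lerD//; last by rewrite ler_wpM2l.
by rewrite ler_wpM2l.
Qed.

End FourthMoment.

(** * From small means to smallness at infinitely many scales *)

Section AlmostEverywhereSelection.
Variable R : realType.
Notation mu := (@lebesgue_measure R).

(** By Chebyshev, on a window of length [Q] the set where [X M > delta] has measure at most
    [C / (delta M)]; the set where this happens for all [M >= m] is contained in each of them, hence
    null. As [1 / M] is not summable, this method yields infinitely many good [M], not all large
    ones. *)
Lemma ae_frequently_le (X : nat -> R -> R) (Q C delta : R) (M1 : nat) :
  0 < Q -> 0 < delta -> 0 <= C -> (forall M c, 0 <= X M c) ->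
  (forall M a, (M1 <= M)%N -> (0 < M)%N ->
     mu.-integrable `[a, a + Q] (EFin \o X M) /\
     (\int[mu]_(x in `[a, (a + Q)%R]) (X M x)%:E <= (C / M%:R)%:E)%E) ->
  {ae mu, forall c : R, forall m : nat, exists2 M : nat, (m <= M)%N & X M c <= delta}.
Proof.
move=> Q0 d0 C0 X0 H; apply: ae_foralln => m.
have null a : mu.-negligible [set c : R | a <= c <= a + Q /\ forall M, (m <= M)%N -> delta < X M c].
  apply: (@negligible_le_inv _ _ (C / delta)) => k.
  pose M := (maxn m M1 + k.+1)%N.
  have mM : (m <= M)%N by rewrite (leq_trans (leq_maxl _ _) (leq_addr _ _)).
  have M1M : (M1 <= M)%N by rewrite (leq_trans (leq_maxr _ _) (leq_addr _ _)).
  have kM : (k.+1 <= M)%N by rewrite leq_addl.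
  have M0 : (0 < M)%N by rewrite (leq_trans _ kM).
  have [iX hX] := H M a M1M M0.
  have mD : measurable (`[a, a + Q]%classic : set (measurableTypeR R)) by exact: measurable_itv.
  have mX : measurable_fun `[a, a + Q] (EFin \o X M) by exact: measurable_int iX.
  exists (`[a, a + Q]%classic `&` [set c | (delta%:E <= `|(EFin \o X M) c|)%E]); split.
  - have := emeasurable_fun_c_infty mD (measurableT_comp (@abse_measurable R setT) mX).
    by apply.
  - move=> c [/= ac hc]; split; first by rewrite /= in_itv.
    by rewrite /= lee_fin ger0_norm// ltW// hc.
  have := le_integral_comp_abse mu mD (f := id) (g := EFin \o X M) (a := delta).
  move=> /(_ (@measurable_id _ _ _)) h.
  have {}h : (delta%:E * mu (`[a, (a + Q)%R]%classic `&` [set c | (delta%:E <= `|(EFin \o X M) c|)%E])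
      <= \int[mu]_(x in `[a, (a + Q)%R]) `|(EFin \o X M) x|)%E by apply: h => //.
  have h2 : (\int[mu]_(x in `[a, (a + Q)%R]) `|(EFin \o X M) x| <= (C / M%:R)%:E)%E.
    apply: le_trans hX; rewrite le_eqVlt; apply/orP; left; apply/eqP.
    by apply: eq_integral => x _ /=; rewrite ger0_norm.
  have := le_trans h h2; rewrite -lee_pdivlMl// => /le_trans; apply.
  rewrite -EFinM lee_fin mulrCA mulrA ler_wpM2l ?divr_ge0 ?(ltW d0)//.
  by rewrite lef_pV2 ?posrE ?ltr0n// ler_nat.
pose A a := [set c : R | a <= c <= a + Q /\ forall M, (m <= M)%N -> delta < X M c].
apply: (@negligibleS _ _ _ mu (\bigcup_(n : nat) A (n%:R * Q) `|` \bigcup_(n : nat) A (- (n.+1%:R * Q)))).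
  move=> c /= hc.
  have {}hc M : (m <= M)%N -> delta < X M c.
    by move=> mM; rewrite ltNge; apply/negP => h; apply: hc; exists M.
  pose n := Num.truncn (`|c| / Q).
  have cQ : 0 <= `|c| / Q by rewrite divr_ge0// ltW.
  have n1 : n%:R * Q <= `|c| by rewrite -ler_pdivlMr// truncn_le.
  have n2 : `|c| <= n.+1%:R * Q by rewrite -ler_pdivrMr// ltW// truncnS_gt.
  have [c0|c0] := leP 0 c; [left|right]; exists n => //; split => //.
    move: n1 n2; rewrite ger0_norm// -natr1 mulrDl mul1r => -> ->; done.
  move: n1 n2; rewrite ltr0_norm// -natr1 mulrDl mul1r => n1 n2.
  by apply/andP; split; lra.
by apply: negligibleU; apply: negligible_bigcup => n; exact: null.
Qed.

End AlmostEverywhereSelection.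

(** * The diagonal of the correlation with the test polynomial *)

Section DiagonalTerms.
Variables (R : realType) (p : {poly int}) (d C M0 : nat).
Hypothesis size_p : size p = d.+3.
Hypothesis C_gt0 : (0 < C)%N.
Hypothesis M0_gt0 : (0 < M0)%N.
Hypothesis p_le : forall n : int, (0 < absz n)%N -> (absz p.[n] <= C * absz n ^ d.+2)%N.
Hypothesis p_ge : forall n : int, (M0 <= absz n)%N -> (absz n ^ d.+2 <= 2 * absz p.[n])%N.

Lemma geometric_block_bounded (t : R) : 0 < `|t| < 2 * pi ->
  exists G : R, forall M : nat, normc (\sum_(n <- dyadic_block M) expi (n%:~R * t)) <= G.
Proof.
move=> /andP[t0 t1]; have pi2 : 0 < 2 * pi :> R by rewrite mulr_gt0// pi_gt0.
pose x := t / (2 * pi).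
have xt : 2 * pi * x = t by rewrite mulrC divfK// gt_eqF.
have x0 : 0 < `|x| by rewrite normrM (@gtr0_norm _ (_^-1)) ?invr_gt0// divr_gt0.
have x1 : `|x| < 1 by rewrite normrM (@gtr0_norm _ (_^-1)) ?invr_gt0// ltr_pdivrMr// mul1r.
pose delta := Num.min `|x| (1 - `|x|).
have d0 : 0 < delta by rewrite /delta lt_min x0 subr_gt0.
have hx : delta <= normc (expi t - 1).
  rewrite -xt; apply: normc_expiB1_ge => k; have [->|k0] := eqVneq k 0.
    by rewrite subr0 /delta ge_min lexx.
  have k1 : 1 <= `|k%:~R| :> R.
    by rewrite -intr_norm -[1]/(1%:~R) ler_int; move: k0; clear; lia.
  rewrite /delta ge_min; apply/orP; right.
  by have := ler_normB x (x - k%:~R); rewrite subKr; lra.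
exists (2 / delta) => M.
rewrite /dyadic_block big_map /index_iota subSS mul2n -addnn addnK.
have -> : \sum_(j <- iota M.+1 M) expi (j%:Z%:~R * t) =
    expi (M.+1%:R * t) * \sum_(i < M) expi (i%:R * t).
  rewrite -[M.+1 in LHS]addn0 iotaDl big_map mulr_sumr -(big_mkord xpredT (fun i => expi (M.+1%:R * t) * expi (i%:R * t))).
  rewrite /index_iota subn0; apply: eq_bigr => i _; rewrite -expiD -mulrDl.
  by rewrite -[(M.+1 + i)%:Z%:~R]/((M.+1 + i)%:R) natrD.
rewrite normcM normc_expi mul1r ler_pdivlMr//.
by rewrite (le_trans _ (geometric_expi_le t M))// ler_wpM2l// normc_ge0.
Qed.

Variables (gh : int -> R[i]) (ys : seq R) (beta : R -> R[i]) (y0 : R).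
Hypothesis ys_uniq : uniq ys.
Hypothesis ys_in : forall y, y \in ys -> 0 <= y < 2 * pi.
Hypothesis y0_in : y0 \in ys.
Hypothesis ghE : forall n : int, n != 0 ->
  gh n = (n%:~R)^-1 * \sum_(y <- ys) beta y * expi (- (n%:~R * y)).

(** The factor [j] cancels the [1 / j] of the Fourier coefficient, and the exponential makes the
    contribution of the jump at [y0] constant in [j]. *)
Definition weight (j : int) : R[i] := j%:~R * expi (j%:~R * y0).

(** The jump at [y0] gives [beta y0] for each of the [M] indices. Any other jump gives a geometric
    sum of angle [y0 - y], bounded because distinct points of [[0, 2 pi)] do not differ by a
    multiple of [2 pi]. *)
Lemma diagonal_sum : exists C3 : R, forall M : nat,
  normc (\sum_(j <- dyadic_block M) gh j * weight j - M%:R * beta y0) <= C3.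
Proof.
have H y : exists G : R, y \in ys -> y != y0 ->
    forall M : nat, normc (\sum_(n <- dyadic_block M) expi (n%:~R * (y0 - y))) <= G.
  have [yin|] := boolP (y \in ys); last by exists 0.
  have [->|yy0] := eqVneq y y0; first by exists 0.
  have [|G hG] := @geometric_block_bounded (y0 - y).
    rewrite normr_gt0 subr_eq0 eq_sym yy0/= ltr_norml.
    have /andP[h1 h2] := ys_in yin; have /andP[h3 h4] := ys_in y0_in.
    by apply/andP; split; lra.
  by exists G => _ _.
pose G := projT1 (choice H); have hG := projT2 (choice H).
exists (\sum_(y <- ys | y != y0) normc (beta y) * G y) => M.
have -> : \sum_(j <- dyadic_block M) gh j * weight j =
    \sum_(y <- ys) beta y * \sum_(j <- dyadic_block M) expi (j%:~R * (y0 - y)).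
  under [RHS]eq_bigr do rewrite mulr_sumr.
  rewrite exchange_big/= big_seq [RHS]big_seq; apply: eq_bigr => j /mem_dyadic_block[m jm /andP[Mm _]].
  have j0 : j != 0 by rewrite jm -lt0n (leq_ltn_trans _ Mm).
  rewrite ghE// /weight mulrACA mulVf ?intr_eq0// mul1r mulr_suml.
  by apply: eq_bigr => y _; rewrite -mulrA -expiD; congr (_ * expi _); ring.
rewrite (bigD1_seq y0)//= subrr.
under eq_bigr do rewrite mulr0 expi0.
rewrite big_const_seq count_predT size_dyadic_block iter_addr_0 mulr_natr mulr_natl.
rewrite addrAC subrr add0r (le_trans (normc_sum _ _ _))//.
rewrite big_seq_cond [leRHS]big_seq_cond ler_sum// => y /andP[yin yy0].
by rewrite normcM ler_wpM2l ?normc_ge0// hG.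
Qed.

End DiagonalTerms.

(** * Coincidences of frequencies, averaged over [c] *)

Section OffDiagonalTerms.
Variables (R : realType) (p : {poly int}) (d C M0 : nat).
Hypothesis size_p : size p = d.+3.
Hypothesis C_gt0 : (0 < C)%N.
Hypothesis M0_gt0 : (0 < M0)%N.
Hypothesis p_le : forall n : int, (0 < absz n)%N -> (absz p.[n] <= C * absz n ^ d.+2)%N.
Hypothesis p_ge : forall n : int, (M0 <= absz n)%N -> (absz n ^ d.+2 <= 2 * absz p.[n])%N.

(** The two-sided growth of [p] makes [|n|] comparable to [M]. The upper bound frees the collisions
    from the truncation [N]; the lower one makes the Fourier coefficient at [n] of order [1 / M]. *)
Lemma collision_bounds M n j : (M0 <= M)%N -> (2 * absz p.[0] < M)%N ->
  j \in dyadic_block M -> p.[n] = p.[j] ->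
  [/\ (absz n <= 4 * C * M)%N, n != 0 & (M <= 2 * C * absz n)%N].
Proof.
move=> M0M pM /mem_dyadic_block[m jm /andP[Mm mM]] pnj.
have M_gt0 : (0 < M)%N by rewrite (leq_trans M0_gt0).
have Cd : (C <= C ^ d.+2)%N by rewrite -[X in (X <= _)%N]expn1 leq_pexp2l.
have d2 : (2 <= 2 ^ d.+2)%N by rewrite -[X in (X <= _)%N]expn1 leq_pexp2l.
have lo : (M ^ d.+2 <= 2 * absz p.[n])%N.
  rewrite pnj; apply: leq_trans (p_ge _); last by rewrite jm absz_nat (leq_trans M0M)// ltnW.
  by rewrite jm absz_nat leq_exp2r// ltnW.
have hi : (2 * absz p.[n] <= 2 * (C * (2 * M) ^ d.+2))%N.
  rewrite pnj leq_mul2l/= (leq_trans (p_le _))//.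
    by rewrite jm absz_nat (leq_trans _ Mm).
  by rewrite jm absz_nat leq_mul2l leq_exp2r// mM orbT.
have n0 : n != 0.
  apply: contraTneq lo => ->; rewrite -ltnNge (leq_trans pM)//.
  by rewrite -[X in (X <= _)%N]expn1 leq_pexp2l.
split=> //.
  have [nM|Mn] := leqP M0 (absz n); last first.
    rewrite (leq_trans (ltnW Mn))// (leq_trans M0M)// leq_pmull// muln_gt0.
    by rewrite C_gt0.
  rewrite -(@leq_exp2r _ _ d.+2)// (leq_trans (p_ge nM)) ?(leq_trans hi)//.
  rewrite (_ : 4 * C * M = 2 * (C * (2 * M)))%N; last by ring.
  by rewrite [leqRHS]expnMn (expnMn C); apply: leq_mul => //; exact: leq_mul.
rewrite -(@leq_exp2r _ _ d.+2)// (leq_trans lo)// (leq_trans (leq_mul (leqnn 2) (p_le _))) ?absz_gt0//.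
by rewrite !expnMn mulnA leq_mul// leq_mul.
Qed.

Definition collisions M : seq (int * int) :=
  [seq q <- [seq (j, n) | j <- dyadic_block M, n <- box (4 * C * M)] |
    (q.1 != q.2) && (p.[q.2] == p.[q.1])].

Lemma mem_collisions M (j n : int) : (j, n) \in collisions M ->
  [/\ j \in dyadic_block M, j != n & p.[n] = p.[j]].
Proof.
rewrite mem_filter => /andP[/andP[jn /eqP e] /allpairsP[[j' n'] [j'I _ [jE _]]]].
by split; rewrite // jE.
Qed.

Lemma size_collisions M : (size (collisions M) <= d.+2 * M)%N.
Proof.
rewrite size_filter count_allpairs (@leq_trans (\sum_(j <- dyadic_block M) d.+2)%N)//.
  apply: leq_sum => j _; apply: leq_trans (count_value_le size_p p.[j] (box_uniq (4 * C * M))).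
  by apply: sub_count => n /= /andP[].
by rewrite big_const_seq count_predT iter_addn_0 size_dyadic_block.
Qed.

Lemma big_box_support (V : zmodType) (u : int -> V) (A N : nat) : (A <= N)%N ->
  (forall n : int, (A < absz n)%N -> u n = 0) ->
  \sum_(n <- box N) u n = \sum_(n <- box A) u n.
Proof.
move=> AN u0; apply/eqP; rewrite -subr_eq0 big_boxB//.
rewrite !big_nat !big1 ?addr0// => n /andP[An _]; apply: u0.
  by rewrite abszN absz_nat.
by rewrite absz_nat.
Qed.

Lemma collision_sum (V : pzRingType) (u : int -> int -> V) M N :
  (M0 <= M)%N -> (2 * absz p.[0] < M)%N -> (4 * C * M <= N)%N ->
  \sum_(n <- box N) \sum_(j <- dyadic_block M) u n j * (p.[n] == p.[j])%R%:R =
  \sum_(j <- dyadic_block M) u j j + \sum_(q <- collisions M) u q.2 q.1.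
Proof.
move=> M0M pM CN.
rewrite (big_box_support CN); last first.
  move=> n hn; rewrite big_seq big1// => j jI; case: eqP => [pnj|]; last by rewrite mulr0.
  by have [] := collision_bounds M0M pM jI pnj; rewrite leqNgt hn.
have -> : \sum_(q <- collisions M) u q.2 q.1 = \sum_(j <- dyadic_block M)
    \sum_(n <- box (4 * C * M)) if (j != n) && (p.[n] == p.[j]) then u n j else 0.
  by rewrite /collisions big_filter big_mkcond big_allpairs.
rewrite exchange_big -big_split/=.
rewrite big_seq [RHS]big_seq; apply: eq_bigr => j jI.
have jb : j \in box (4 * C * M).
  by rewrite mem_box; have [] := collision_bounds M0M pM jI (erefl p.[j]).
rewrite (bigD1_seq j) ?box_uniq//= eqxx mulr1; congr (_ + _).
rewrite big_mkcond; apply: eq_bigr => n _; rewrite eq_sym.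
by case: (j == n) => //=; case: (_ == _); rewrite ?mulr1 ?mulr0.
Qed.

Variables (om : int -> int) (kk ll : int).
Hypothesis ll0 : ll != 0.
Hypothesis pE : forall n, p.[n] = ll * n - kk * om n.

(* On a collision the frequency determines the difference of the two indices. *)
Lemma collision_multiplicity M q : q \in collisions M ->
  (count (fun q' : int * int => om q'.2 - om q'.1 == om q.2 - om q.1)%R (collisions M) <= d.+2)%N.
Proof.
have rel j n : (j, n) \in collisions M -> ll * (n - j) = kk * (om n - om j).
  by move=> /mem_collisions[_ _]; rewrite !pE => /eqP; rewrite subr_eq addrAC -subr_eq => /eqP h;
    rewrite !mulrBr; move: h; lia.
case: q => j n qc; have [_ jn _] := mem_collisions qc; have r := rel _ _ qc.
pose e := n - j.
have e0 : e != 0 by rewrite subr_eq0 eq_sym.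
apply: leq_trans (count_shift_le size_p 0 e0 (dyadic_block_uniq M)).
rewrite -!size_filter.
set S := [seq q' <- collisions M | _]; set T := [seq j' <- dyadic_block M | _].
have Se j' n' : (j', n') \in S -> [/\ (j', n') \in collisions M & n' = j' + e].
  rewrite mem_filter /= => /andP[/eqP he q'c]; split => //.
  have := rel _ _ q'c; rewrite he -r => /(mulfI ll0); rewrite -/e => <-.
  by rewrite addrC subrK.
rewrite -(size_map fst S); apply: uniq_leq_size.
  rewrite map_inj_in_uniq; last first.
    by move=> [j1 n1] [j2 n2] /Se[_ ->] /Se[_ ->] /= ->.
  rewrite filter_uniq// filter_uniq// allpairs_uniq ?box_uniq ?dyadic_block_uniq//.
  by move=> [? ?] [? ?] _ _ [-> ->].
move=> _ /mapP[[j' n'] /Se[q'c n'E] ->] /=; rewrite mem_filter; rewrite n'E in q'c.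
have [j'I _ e'] := mem_collisions q'c.
by rewrite e' subrr eqxx.
Qed.

Notation mu := (@lebesgue_measure R).
Variables (gh : int -> R[i]) (y0 Bg : R).
Hypothesis Bg0 : 0 <= Bg.
Hypothesis gh_le : forall n : int, n != 0 -> normc (gh n) <= Bg / (absz n)%:R.

(** The multipliers depend on an index only through the value of [p] and cancel on a collision. What
    remains is a trigonometric polynomial in [c] with integer frequencies. *)
Definition offdiag (M : nat) (c : R) : R[i] :=
  \sum_(q <- collisions M) M%:R^-1 * (gh q.2 * weight y0 q.1) * expi (c * (om q.2 - om q.1)%:~R).

Lemma normc_weight (j : int) : normc (weight y0 j) = (absz j)%:R.
Proof.
rewrite /weight normcM normc_expi mulr1 -[j%:~R](rmorph_int (real_complex R)) normc_real.
by rewrite -intr_norm.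
Qed.

(** There are [O(M)] collisions with coefficients [O(1 / M)], and at most [d + 2] of them share a
    frequency in [c]; orthogonality over the period [2 pi] gives [O(1 / M)]. *)
Lemma offdiag_integral_le : exists2 C4 : R, 0 <= C4 &
  forall M a, (maxn M0 (2 * absz p.[0]).+1 <= M)%N -> (0 < M)%N ->
  mu.-integrable `[a, a + 2 * pi] (EFin \o (fun c => normc (offdiag M c) ^+ 2)) /\
  (\int[mu]_(c in `[a, (a + 2 * pi)%R]) (normc (offdiag M c) ^+ 2)%:E <= (C4 / M%:R)%:E)%E.
Proof.
have pi2 : 0 < 2 * pi :> R by rewrite mulr_gt0// pi_gt0.
exists (2 * pi * (d.+2%:R * (d.+2%:R * (4 * C%:R * Bg) ^+ 2))).
  by rewrite mulr_ge0 ?(ltW pi2)// mulr_ge0// mulr_ge0// sqr_ge0.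
move=> M a; rewrite geq_max => /andP[M0M pM] M_gt0.
have MR : 0 < M%:R :> R by rewrite ltr0n.
pose b (q : int * int) : R[i] := M%:R^-1 * (gh q.2 * weight y0 q.1).
pose v (q : int * int) := om q.2 - om q.1.
have hD q : q \in collisions M -> (count (fun q' => v q' == v q) (collisions M))%:R <= d.+2%:R :> R.
  by move=> /collision_multiplicity; rewrite ler_nat.
have [] := integral_sqr_expi_le b (D := d.+2%:R) a pi2 hD.
have E c : normc (\sum_(q <- collisions M) b q * expi (2 * pi * (v q)%:~R / (2 * pi) * c)) ^+ 2
    = normc (offdiag M c) ^+ 2.
  congr (normc _ ^+ 2); apply: eq_bigr => q _; congr (_ * expi _).
  rewrite -/(v q); move: (v q)%:~R (2 * pi) pi2 => u Q Q0; field.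
  by rewrite gt_eqF.
under [X in EFin \o X]eq_fun do rewrite E.
under eq_integral do rewrite E.
move=> h1 h2; split; first exact: h1.
rewrite (le_trans h2)// lee_fin -!mulrA ler_wpM2l// ler_wpM2l ?pi_ge0// ler_wpM2l//.
have bq q : q \in collisions M -> normc (b q) ^+ 2 <= (4 * C%:R * Bg / M%:R) ^+ 2.
  case: q => j n /mem_collisions[jI jn pnj].
  have [_ n0 nM] := collision_bounds M0M pM jI pnj.
  have [m jm /andP[_ mM]] := mem_dyadic_block jI.
  have nR : 0 < (absz n)%:R :> R by rewrite ltr0n absz_gt0.
  rewrite lerXn2r ?nnegrE ?normc_ge0 ?mulr_ge0 ?invr_ge0//.
  rewrite /b normcM normc_natV normcM normc_weight /= jm absz_nat mulrC ler_pM2r ?invr_gt0//.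
  rewrite (le_trans (ler_wpM2r _ (gh_le n0)))// mulrC mulrA -mulrA [Bg / _]mulrC mulrA ler_wpM2r//.
  rewrite ler_pdivrMr// -natrM -natrM ler_nat (leq_trans mM)//.
  by rewrite (leq_trans (leq_mul (leqnn 2) nM))// !mulnA.
rewrite (@le_trans _ _ (\sum_(q <- collisions M) (4 * C%:R * Bg / M%:R) ^+ 2))//.
  by rewrite big_seq [leRHS]big_seq ler_sum.
rewrite big_const_seq count_predT iter_addr_0 -[X in X <= _]mulr_natl.
rewrite (le_trans (ler_wpM2r (sqr_ge0 _) (_ : _ <= (d.+2 * M)%:R))) ?ler_nat ?size_collisions//.
rewrite natrM le_eqVlt; apply/orP; left; apply/eqP.
move: (d.+2%:R : R) => D; move: (C%:R : R) => C'; field.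
by rewrite lt0r_neq0.
Qed.

End OffDiagonalTerms.

(** * Lower bound for the mean increment *)

Section IncrementsMean.
Variables (R : realType) (p : {poly int}) (d C M0 : nat).
Hypothesis size_p : size p = d.+3.
Hypothesis C_gt0 : (0 < C)%N.
Hypothesis M0_gt0 : (0 < M0)%N.
Hypothesis p_le : forall n : int, (0 < absz n)%N -> (absz p.[n] <= C * absz n ^ d.+2)%N.
Hypothesis p_ge : forall n : int, (M0 <= absz n)%N -> (absz n ^ d.+2 <= 2 * absz p.[n])%N.
Variables (om : int -> int) (gh : int -> R[i]) (y0 Bg : R) (ys : seq R) (beta : R -> R[i]).
Hypothesis Bg0 : 0 <= Bg.
Hypothesis gh_le : forall n : int, n != 0 -> normc (gh n) <= Bg / (absz n)%:R.
Hypothesis gh0_le : normc (gh 0) <= Bg.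
Hypothesis ys_uniq : uniq ys.
Hypothesis ys_in : forall y, y \in ys -> 0 <= y < 2 * pi.
Hypothesis y0_in : y0 \in ys.
Hypothesis beta0 : beta y0 != 0.
Hypothesis ghE : forall n : int, n != 0 ->
  gh n = (n%:~R)^-1 * \sum_(y <- ys) beta y * expi (- (n%:~R * y)).

(** When [K] is a multiple of [steps M], this is the increment of the partial sum over [box N], from
    the [x]-th of [K] equally spaced points of the period, over one [steps M]-th of the period. *)
Definition increment (M N K : nat) (c : R) (x : nat) : R[i] :=
  \sum_(n <- box N) gh n * expi (c * (om n)%:~R) * mult R p d C M n * wave R K p.[n] x.

(* The conjugates of the coefficients of the test polynomial. *)
Let test_coef (M : nat) (c : R) (j : int) : R[i] :=
  M%:R^-1 * (weight y0 j * expi (- (c * (om j)%:~R))) / mult R p d C M j.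

Let test (M K : nat) (c : R) (x : nat) : R[i] :=
  \sum_(j <- dyadic_block M) (test_coef M c j)^*%C * wave R K p.[j] x.

Let Bt : R := 2 * (4 * C * 2 ^ d.+2)%:R.

Let mult_gt0 M j : (M0 <= M)%N -> j \in dyadic_block M -> 0 < normc (mult R p d C M j).
Proof.
move=> M0M jI; apply: lt_le_trans (mult_ge R C_gt0 M0_gt0 p_le p_ge M0M jI).
by rewrite invr_gt0 ltr0n muln_gt0 muln_gt0 C_gt0 expn_gt0.
Qed.

Let test_coef_le M c j : (M0 <= M)%N -> j \in dyadic_block M -> normc (test_coef M c j) <= Bt.
Proof.
move=> M0M jI; have m0 := mult_gt0 M0M jI.
have M_gt0 : (0 < M)%N by rewrite (leq_trans M0_gt0).
have MR : 0 < M%:R :> R by rewrite ltr0n.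
have mg := mult_ge R C_gt0 M0_gt0 p_le p_ge M0M jI.
have [m jm /andP[_ mM]] := mem_dyadic_block jI.
rewrite /test_coef normcM normcM normc_natV normcM normc_expi mulr1 normc_weight normcV.
rewrite /Bt ler_pM ?invr_ge0 ?mulr_ge0 ?invr_ge0 ?normc_ge0//.
  by rewrite mulrC ler_pdivrMr// jm absz_nat -natrM ler_nat.
rewrite -[leRHS]invrK lef_pV2 ?posrE//.
by rewrite invr_gt0 ltr0n muln_gt0 muln_gt0 C_gt0 expn_gt0.
Qed.

Lemma increment_test_sum M N K c : (M0 <= M)%N -> (2 * absz p.[0] < M)%N ->
  (4 * C * M <= N)%N -> (0 < K)%N -> (forall n, n \in box N -> (2 * absz p.[n] < K)%N) ->
  \sum_(x < K) increment M N K c x * (test M K c x)^*%C =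
  K%:R * (M%:R^-1 * (\sum_(j <- dyadic_block M) gh j * weight y0 j)
    + offdiag p C om gh y0 M c).
Proof.
move=> M0M pM CN K0 hK.
have subI j : j \in dyadic_block M -> j \in box N.
  by move=> jI; rewrite mem_box; have [h _ _] := collision_bounds C_gt0 M0_gt0 p_le p_ge M0M pM jI (erefl p.[j]);
    rewrite (leq_trans h).
rewrite sum_wave_inner//; last first.
  move=> n j nN /subI jN; move: (hK _ nN) (hK _ jN).
  by move: p.[n] p.[j] => u v; clear; lia.
congr (_ * _).
pose u n j := gh n * expi (c * (om n)%:~R) * mult R p d C M n * test_coef M c j.
transitivity (\sum_(n <- box N) \sum_(j <- dyadic_block M) u n j * (p.[n] == p.[j])%R%:R).
  by apply: eq_bigr => n _; apply: eq_bigr => j _; rewrite conjcK.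
rewrite (collision_sum C_gt0 M0_gt0 p_le p_ge u M0M pM CN); congr (_ + _).
  rewrite mulr_sumr big_seq [RHS]big_seq; apply: eq_bigr => j jI.
  have m0 : mult R p d C M j != 0.
    by apply: contraTneq (mult_gt0 M0M jI) => ->; rewrite normc0 ltxx.
  rewrite /u /test_coef; set e := expi (c * _); set e' := expi (- _); set m := mult _ _ _ _ _ _.
  rewrite [LHS](_ : _ = M%:R^-1 * (gh j * weight y0 j) * (e' * e) * (m / m)); last by ring.
  by rewrite expiNK mulfV// !mulr1.
rewrite /offdiag big_seq [RHS]big_seq; apply: eq_bigr => -[j n] /mem_collisions[jI _ pnj].
have m0 : mult R p d C M j != 0.
  by apply: contraTneq (mult_gt0 M0M jI) => ->; rewrite normc0 ltxx.
have mE : mult R p d C M n = mult R p d C M j by rewrite /mult pnj.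
rewrite /u /test_coef /= mE; set e := expi (c * _); set e' := expi (- _); set m := mult _ _ _ _ _ _.
rewrite [LHS](_ : _ = M%:R^-1 * (gh n * weight y0 j) * (e * e') * (m / m)); last by ring.
by rewrite mulfV// mulr1 -expiD -mulrBr rmorphB.
Qed.

(* On the diagonal the increments correlate with the test polynomial, whose
   fourth moment is small; the mean of the increments is therefore not small. *)
Lemma increments_mean_ge (eps : R) : 0 < eps -> exists2 c1 : R, 0 < c1 &
  exists M2 : nat, forall M N K c, (M2 <= M)%N -> (4 * C * M <= N)%N ->
  (2 * steps d C M < K)%N -> (forall n, n \in box N -> (2 * absz p.[n] < K)%N) ->
  normc (offdiag p C om gh y0 M c) <= normc (beta y0) / 4 ->
  K%:R * (c1 * M%:R `^ (- (1 / 2 + eps))) <= \sum_(x < K) normc (increment M N K c x).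
Proof.
move=> eps0.
have [C1 C10 hC1] := increments_energy_le C_gt0 p_le Bg0 gh_le gh0_le.
have [C2 C20 hC2] := fourth_moment_le size_p p_le eps0.
have [C3 hC3] := diagonal_sum ys_uniq ys_in y0_in ghE.
pose delta := normc (beta y0) / 4.
have delta0 : 0 < delta.
  rewrite divr_gt0// lt_neqAle normc_ge0 andbT eq_sym.
  by apply: contra_neq beta0 => /eq0_normc.
have Bt0 : 0 <= Bt by rewrite /Bt mulr_ge0.
pose C5 := d.+2%:R * C1 + Bt ^+ 4 * C2 + 1.
have C50 : 0 < C5.
  by rewrite /C5 ltr_wpDl// addr_ge0 ?mulr_ge0 ?exprn_ge0.
exists (2 * delta ^+ 2 / C5); first exact: (divr_gt0 (mulr_gt0 (ltr0Sn R 1) (exprn_gt0 2 delta0)) C50).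
(* Beyond the last threshold the bounded error of the diagonal sum, divided by [M], is at most
   [delta]. *)
exists (maxn (maxn M0 (2 * absz p.[0]).+1) (Num.truncn (C3 / delta)).+1).
move=> M N K c; rewrite !geq_max => /andP[/andP[M0M pM] C3M] CN sK hK hoff.
have M_gt0 : (0 < M)%N by rewrite (leq_trans M0_gt0).
have MR : 0 < M%:R :> R by rewrite ltr0n.
have K0 : (0 < K)%N by rewrite (leq_ltn_trans _ sK).
have KR : 0 < K%:R :> R by rewrite ltr0n.
pose S1 := \sum_(x < K) normc (increment M N K c x).
pose Y : R := M%:R `^ (1 / 2 + eps).
have Y0 : 0 < Y by rewrite powR_gt0.
(* The jump has modulus [4 delta]; the diagonal error and the off-diagonal terms take away at most
   [delta] each. *)
have corr : 2 * delta * K%:R <= \sum_(x < K) normc (increment M N K c x) * normc (test M K c x).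
  have h0 : K%:R * normc (M%:R^-1 * (\sum_(j <- dyadic_block M) gh j * weight y0 j)
      + offdiag p C om gh y0 M c) <= \sum_(x < K) normc (increment M N K c x) * normc (test M K c x).
    rewrite -[X in X * _]normc_nat -normcM -(increment_test_sum c M0M pM CN K0 hK).
    rewrite (le_trans (normc_sum _ _ _))// ler_sum// => x _.
    by rewrite normcM normc_conj.
  rewrite (le_trans _ h0)// mulrC ler_wpM2l//.
  set S := \sum_(j <- _) _.
  have h1 : normc (M%:R^-1 * S - beta y0) <= delta.
    rewrite (_ : _ - _ = M%:R^-1 * (S - M%:R * beta y0)); last first.
      by rewrite mulrBr mulKf// pnatr_eq0 -lt0n.
    rewrite normcM normc_natV ler_pdivrMl// (le_trans (hC3 M))// -ler_pdivrMr//.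
    by rewrite ltW// (lt_le_trans (truncnS_gt _))// ler_nat.
  have h2 : normc (beta y0) <= normc (M%:R^-1 * S + offdiag p C om gh y0 M c)
     + normc (offdiag p C om gh y0 M c) + normc (M%:R^-1 * S - beta y0).
    have := normcB_le (M%:R^-1 * S + offdiag p C om gh y0 M c) (offdiag p C om gh y0 M c).
    have := normcB_le (M%:R^-1 * S) (M%:R^-1 * S - beta y0).
    by rewrite subKr addrK; lra.
  have h3 : normc (beta y0) = 4 * delta by rewrite /delta; lra.
  by move: hoff; rewrite -/delta; lra.
have energy : \sum_(x < K) normc (increment M N K c x) ^+ 2 <= K%:R * (d.+2%:R * C1 / M%:R).
  apply: (@le_trans _ _ (K%:R * (d.+2%:R * \sum_(n <- box N)
     normc (gh n * expi (c * (om n)%:~R) * mult R p d C M n) ^+ 2))).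
    apply: sum_sqr_wave_le => //.
      move=> n j /hK hn /hK; move: hn; move: p.[n] p.[j] => u v; clear; lia.
    by move=> n _; rewrite ler_nat count_value_le// box_uniq.
  rewrite ler_wpM2l// -mulrA ler_wpM2l//.
  under eq_bigr do rewrite normcM normcM normc_expi mulr1.
  exact: hC1.
have fourth : \sum_(x < K) normc (test M K c x) ^+ 4 <= K%:R * (Bt ^+ 4 * (C2 * M%:R `^ (2 + eps))).
  by apply: hC2 => // j jI; rewrite normc_conj test_coef_le.
(* The value of [eta] balances the energy [O(1 / M)] against the fourth moment [O(M^(2 + eps))];
   [lam] makes the error term equal to [delta K], half of the correlation. *)
pose eta : R := M%:R `^ (3 / 2); pose lam := C5 * Y / (2 * delta).
have eta0 : 0 < eta by rewrite powR_gt0.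
have lam0 : 0 < lam := divr_gt0 (mulr_gt0 C50 Y0) (mulr_gt0 (ltr0Sn R 1) delta0).
(* AM-GM twice: [u v <= lam u + u v^2 / lam] and [2 u v^2 <= eta u^2 + v^4 / eta] *)
have pointwise (u v : R) : 0 <= u -> 0 <= v ->
    u * v <= lam * u + (eta * u ^+ 2 + v ^+ 4 / eta) / (2 * lam).
  move=> u0 v0.
  have h1 : v <= lam + v ^+ 2 / lam.
    rewrite -subr_ge0 (_ : _ - _ = ((v - lam / 2) ^+ 2 + 3 / 4 * lam ^+ 2) / lam); last first.
      by field; rewrite gt_eqF.
    by rewrite divr_ge0 ?(ltW lam0)// addr_ge0 ?sqr_ge0// mulr_ge0 ?sqr_ge0.
  have h2 : u * v ^+ 2 <= (eta * u ^+ 2 + v ^+ 4 / eta) / 2.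
    rewrite -subr_ge0 (_ : _ - _ = (eta * u - v ^+ 2) ^+ 2 / (2 * eta)); last first.
      by field; rewrite gt_eqF.
    by rewrite divr_ge0 ?sqr_ge0// mulr_ge0// ltW.
  rewrite (le_trans (ler_wpM2l u0 h1))// mulrDr mulrC lerD2l mulrA.
  have lV : 0 <= lam^-1 by rewrite invr_ge0 ltW.
  rewrite (le_trans (ler_wpM2r lV h2))// le_eqVlt; apply/orP; left; apply/eqP.
  by move: (eta * _ + _) => X; rewrite -mulrA -invfM.
have Ysplit1 : eta / M%:R <= Y.
  rewrite /eta /Y -(powR_inv1 (ltW MR)) -powR_addr// ler_powR ?ler1n//; lra.
have Ysplit2 : M%:R `^ (2 + eps) / eta <= Y.
  rewrite /eta /Y -powRN -powR_addr// ler_powR ?ler1n//; lra.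
have upper : \sum_(x < K) normc (increment M N K c x) * normc (test M K c x)
    <= lam * S1 + K%:R * (C5 * Y) / (2 * lam).
  apply: (@le_trans _ _ (\sum_(x < K) (lam * normc (increment M N K c x) +
     (eta * normc (increment M N K c x) ^+ 2 + normc (test M K c x) ^+ 4 / eta) / (2 * lam)))).
    by apply: ler_sum => x _; apply: pointwise; exact: normc_ge0.
  rewrite big_split/= -mulr_sumr lerD2l// -mulr_suml big_split/= -mulr_sumr -mulr_suml.
  have l2 : 0 <= (2 * lam)^-1 by rewrite invr_ge0; exact: (mulr_ge0 (ler0n R 2) (ltW lam0)).
  apply: (ler_wpM2r l2).
  have g1 : eta * (K%:R * (d.+2%:R * C1 / M%:R)) <= K%:R * (d.+2%:R * C1 * Y).
    rewrite (_ : eta * _ = K%:R * (d.+2%:R * C1 * (eta / M%:R))); last by ring.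
    by rewrite ler_wpM2l// ler_wpM2l// mulr_ge0.
  have g2 : K%:R * (Bt ^+ 4 * (C2 * M%:R `^ (2 + eps))) / eta <= K%:R * (Bt ^+ 4 * C2 * Y).
    rewrite (_ : _ / eta = K%:R * (Bt ^+ 4 * C2 * (M%:R `^ (2 + eps) / eta))); last by ring.
    by rewrite ler_wpM2l// ler_wpM2l// mulr_ge0// exprn_ge0.
  have g3 := le_trans (ler_wpM2l (ltW eta0) energy) g1.
  have eV : 0 <= eta^-1 by rewrite invr_ge0 ltW.
  have g4 := le_trans (ler_wpM2r eV fourth) g2.
  rewrite (le_trans (lerD g3 g4))// -mulrDr ler_wpM2l// -mulrDl ler_wpM2r ?(ltW Y0)//.
  by rewrite /C5 lerDl.
have := le_trans corr upper.
have -> : K%:R * (C5 * Y) / (2 * lam) = delta * K%:R.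
  by rewrite /lam; field; rewrite !gt_eqF.
move=> h; have {}h : delta * K%:R <= lam * S1 by lra.
rewrite powRN -/Y -/S1 -(ler_pM2l lam0) (le_trans _ h)// /lam.
by rewrite le_eqVlt; apply/orP; left; apply/eqP; field; rewrite !gt_eqF.
Qed.

End IncrementsMean.

(** * From grid increments to box dimension *)

Section GridVariation.
Variable R : realType.

Lemma sum_grid (V : zmodType) (F : nat -> V) (n L : nat) :
  \sum_(x < n * L) F x = \sum_(s < L) \sum_(q < n) F (q * L + s)%N.
Proof.
rewrite exchange_big /=; elim: n => [|n IH]; first by rewrite mul0n !big_ord0.
rewrite big_ord_recr -IH /= -!(big_mkord xpredT) mulSn addnC.
rewrite (big_cat_nat (n := (n * L)%N)) ?leq_addr//=; congr (_ + _).
rewrite -[X in \sum_(X <= _ < _) _]add0n big_addn addKn big_mkord.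
by apply: eq_bigr => s _; rewrite addnC.
Qed.

(** The grid of [n L] points splits by residue modulo [L] into [L] progressions of spacing [P / n].
    On each the increments form a variation, compared with a covering by balls of radius half the
    spacing. *)
Lemma grid_variation_le (u : R -> R) (P B : R) (n L Nb : nat) (c : 'I_Nb -> R * R) :
  continuous u -> (forall x, `|u x| <= B) -> 0 < P -> (0 < n)%N -> (0 < L)%N ->
  graph_on `[0, P] u `<=` \bigcup_i euclidean_ball (c i) (P / (2 * n%:R)) ->
  \sum_(x < n * L) `|u (P * ((x + L)%:R / (n * L)%:R)) - u (P * (x%:R / (n * L)%:R))|
    <= L%:R * (4 * (P / (2 * n%:R)) * Nb%:R + 2 * B).
Proof.
move=> cu uB P0 n0 L0 cov; have nR : 0 < n%:R :> R by rewrite ltr0n.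
have LR : 0 < L%:R :> R by rewrite ltr0n.
rewrite (sum_grid (fun x => `|u (P * ((x + L)%:R / (n * L)%:R)) - u (P * (x%:R / (n * L)%:R))|)).
rewrite (@le_trans _ _ (\sum_(s < L) (4 * (P / (2 * n%:R)) * Nb%:R + 2 * B)))//; last first.
  by rewrite sumr_const card_ord [leRHS]mulr_natl.
apply: ler_sum => s _.
pose x0 := P * (s%:R / (n * L)%:R); pose w := P / n%:R.
have x00 : 0 <= x0 by rewrite mulr_ge0 ?divr_ge0// ltW.
have x0w : x0 <= w.
  rewrite /x0 /w ler_wpM2l ?(ltW P0)// natrM ler_pdivrMr ?mulr_gt0// mulKf ?gt_eqF//.
  by rewrite ler_nat ltnW.
have pt q : P * ((q * L + s)%:R / (n * L)%:R) = x0 + q%:R * w.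
  by rewrite /x0 /w natrD !natrM; field; rewrite !gt_eqF.
have ptS q : P * ((q * L + s + L)%:R / (n * L)%:R) = x0 + q.+1%:R * w.
  by rewrite -pt addnAC -mulSnr.
under eq_bigr do rewrite ptS pt.
move: x0 x00 x0w {pt ptS} => x0 x00; case: n n0 nR cov @w => // n _ nR cov w x0w.
(* The last increment of a progression may leave [[0, P]], where the covering says nothing; it is
   bounded by [2 B]. *)
rewrite big_ord_recr /= lerD//.
  apply: (variation_le_cover cu _ _ x00 _ cov); first by rewrite divr_gt0 ?mulr_gt0.
    by rewrite /w le_eqVlt; apply/orP; left; apply/eqP; field; rewrite gt_eqF.
  rewrite (le_trans (lerD x0w (lexx _)))// /w -{1}[P / _]mul1r -mulrDl nat1r mulrC divfK ?gt_eqF//.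
by rewrite (le_trans (ler_normB _ _))// (le_trans (lerD (uB _) (uB _)))//; lra.
Qed.

(** If both dimensions were below [rho], coverings by [e^-rho] balls with [e] of order [1 / n] would
    bound the variation by [O(n^(rho - 1))], against the lower bound [n M^-(1/2 + eps)]. As [n] is
    of order [M^(d + 1)], this fails for large [M]. Only the sum of the increments of [u1] and [u2]
    is known to be large, hence the maximum. *)
Lemma fractal_dim_ge (u1 u2 : R -> R) (P B : R) (A d : nat) :
  continuous u1 -> continuous u2 -> (forall x, `|u1 x| <= B) -> (forall x, `|u2 x| <= B) ->
  0 < P -> (0 < A)%N ->
  (forall eps : R, 0 < eps -> exists2 c1 : R, 0 < c1 & forall m : nat, exists M L : nat,
     [/\ (m <= M)%N, (0 < M)%N, (0 < L)%N & let n := (A * M ^ d.+1)%N in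
      (n * L)%:R * (c1 * M%:R `^ (- (1 / 2 + eps))) <=
      \sum_(x < n * L) (`|u1 (P * ((x + L)%:R / (n * L)%:R)) - u1 (P * (x%:R / (n * L)%:R))|
         + `|u2 (P * ((x + L)%:R / (n * L)%:R)) - u2 (P * (x%:R / (n * L)%:R))|)]) ->
  ((2 - 1 / (2 * d.+1%:R))%:E <=
    maxe (fractal_dim (graph_on `[0%R, P] u1)) (fractal_dim (graph_on `[0%R, P] u2)))%E.
Proof.
move=> cu1 cu2 uB1 uB2 P0 A0 H; rewrite leNgt; apply/negP => hD.
have DR : 1 <= d.+1%:R :> R by rewrite ler1n.
have DR0 : 0 < d.+1%:R :> R by rewrite ltr0n.
have half : 1 / (2 * d.+1%:R) <= 1 / 2 :> R.
  by rewrite !div1r lef_pV2 ?posrE ?mulr_gt0// ler_peMr.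
(* With [rho >= 1] the boundary terms [4 B] are also [O(n^(rho - 1))]. *)
have [rho [rho1 rho2 hrho]] : exists rho : R, [/\ 1 <= rho, rho < 2 - 1 / (2 * d.+1%:R) &
    (maxe (fractal_dim (graph_on `[0%R, P] u1)) (fractal_dim (graph_on `[0%R, P] u2)) < rho%:E)%E].
  move: hD; set D := maxe _ _; case: D => [x| |] hx.
  - move: hx; rewrite lte_fin => hx.
    move: half hx; move: (1 / (2 * d.+1%:R)) => z hz hx.
    exists (Num.max 1 ((x + (2 - z)) / 2)); split; first by rewrite le_max lexx.
      by rewrite gt_max; apply/andP; split; lra.
    by rewrite lte_fin lt_max; apply/orP; right; lra.
  - by rewrite ltNge leey in hx.
  - exists 1; split => //; last exact: ltNyr.
    by move: half; move: (1 / (2 * d.+1%:R)) => z; lra.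
move: hrho; rewrite gt_max => /andP[/fractal_dim_lt[e1 e10 h1] /fractal_dim_lt[e2 e20 h2]].
(* Half of the slack: [(d + 1) (2 - rho) = 1/2 + 2 eps], so [n^(rho - 2)] is smaller than
   [M^-(1/2 + eps)] by a factor [M^-eps]. *)
pose eps := (d.+1%:R * (2 - rho) - 1 / 2) / 2 : R.
have eps0 : 0 < eps.
  rewrite divr_gt0// subr_gt0.
  have : d.+1%:R * (1 / (2 * d.+1%:R)) < d.+1%:R * (2 - rho) :> R.
    by rewrite ltr_pM2l//; move: rho2; move: (1 / (2 * d.+1%:R)) => z; lra.
  by rewrite (_ : _ * (1 / _) = 1 / 2)//; field; rewrite gt_eqF.
have [c1 c10 hc1] := H eps eps0.
have B0 : 0 <= B by rewrite (le_trans (normr_ge0 _) (uB1 0)).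
pose Hc := 8 * (P / 2) `^ (1 - rho) + 4 * B.
have Hc0 : 0 <= Hc by rewrite addr_ge0// mulr_ge0// powR_ge0.
pose e0 := Num.min e1 e2; have e00 : 0 < e0 by rewrite lt_min e10.
have [M [L [mM M0 L0 /=]]] := hc1 (maxn (Num.truncn ((Hc / c1) `^ eps^-1)).+1 (Num.truncn (P / (2 * e0))).+1).
set n := (A * M ^ d.+1)%N.
move: mM; rewrite geq_max => /andP[M1 M2] hsum.
have MR : 0 < M%:R :> R by rewrite ltr0n.
have nM : (M ^ d.+1 <= n)%N by rewrite leq_pmull.
have n0 : (0 < n)%N by rewrite (leq_trans _ nM)// expn_gt0 M0.
have nR : 0 < n%:R :> R by rewrite ltr0n.
have nR1 : 1 <= n%:R :> R by rewrite ler1n.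
have LR : 0 < L%:R :> R by rewrite ltr0n.
pose e : R := P / (2 * n%:R).
have ep : 0 < e by rewrite divr_gt0// mulr_gt0.
have ee0 : e < e0.
  have Mn : M%:R <= n%:R :> R.
    by rewrite ler_nat (leq_trans _ nM)// -[X in (X <= _)%N]expn1 leq_pexp2l.
  have : P / (2 * e0) < n%:R by rewrite (lt_le_trans (truncnS_gt _))// (le_trans _ Mn)// ler_nat.
  rewrite ltr_pdivrMr ?mulr_gt0// => h.
  rewrite /e ltr_pdivrMr ?mulr_gt0// (_ : e0 * _ = n%:R * (2 * e0))//; by ring.
have [ee1 ee2] : e < e1 /\ e < e2 by move: ee0; rewrite lt_min => /andP[].
have [N1 [p1 [cov1 hN1]]] := h1 e ep ee1.
have [N2 [p2 [cov2 hN2]]] := h2 e ep ee2.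
have v1 := grid_variation_le cu1 uB1 P0 n0 L0 cov1.
have v2 := grid_variation_le cu2 uB2 P0 n0 L0 cov2.
move: hsum; rewrite big_split/= => /le_trans /(_ (lerD v1 v2)).
rewrite -mulrDr -/e (_ : (n * L)%:R * _ = L%:R * (n%:R * (c1 * M%:R `^ (- (1 / 2 + eps))))); last first.
  by rewrite natrM; ring.
rewrite (ler_pM2l LR) => hle.
have b1 : 4 * e * N1%:R + 2 * B + (4 * e * N2%:R + 2 * B) <= 8 * (e * e `^ (- rho)) + 4 * B.
  have := ler_wpM2l (ltW ep) hN1; have := ler_wpM2l (ltW ep) hN2.
  by rewrite -!(mulrA 4); move: (e * N1%:R) (e * N2%:R) (e * e `^ _) => x y z; clear; lra.
have b2 : 8 * (e * e `^ (- rho)) + 4 * B <= Hc * n%:R `^ (rho - 1).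
  have -> : e * e `^ (- rho) = (P / 2) `^ (1 - rho) * n%:R `^ (rho - 1).
    have eE : e = P / 2 * n%:R^-1 by rewrite /e invfM mulrA.
    have P2 : 0 <= P / 2 by rewrite divr_ge0// ltW.
    have nV : 0 <= (n%:R^-1 : R) by rewrite invr_ge0 ltW.
    rewrite -{1}(powRr1 (ltW ep)) -powR_addr// eE (powRM _ P2 nV).
    by rewrite -(powR_inv1 (ltW nR)) -powRrM mulN1r opprB.
  have Z1 : 1 <= n%:R `^ (rho - 1) by rewrite -[leLHS](powRr0 n%:R) ler_powR// subr_ge0.
  have := ler_wpM2l B0 Z1; rewrite mulr1 /Hc.
  by move: (n%:R `^ _) (_ `^ (1 - rho)) => x y; clear; lra.
have := le_trans hle (le_trans b1 b2).
have -> : n%:R `^ (rho - 1) = n%:R * n%:R `^ (rho - 2).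
  by rewrite -{2}(powRr1 (ltW nR)) -powR_addr//; congr (_ `^ _); ring.
rewrite [Hc * _]mulrCA (ler_pM2l nR) => h3.
have h4 : n%:R `^ (rho - 2) <= M%:R `^ (- (1 / 2 + eps)) * M%:R `^ (- eps).
  rewrite -powR_addr//.
  have -> : - (1 / 2 + eps) + - eps = d.+1%:R * (rho - 2) by rewrite /eps; field.
  rewrite powRrM powR_mulrn ?(ltW MR)// -natrX -opprB !powRN lef_pV2 ?posrE ?powR_gt0 ?ltr0n ?expn_gt0 ?M0//.
  have r2 : 0 <= 2 - rho by have : 0 <= 1 / (2 * d.+1%:R) :> R; [rewrite divr_ge0|move: rho2; move: (1 / (2 * d.+1%:R)) => z; clear; lra].
  by rewrite ge0_ler_powR ?nnegrE// ler_nat.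
have := le_trans h3 (ler_wpM2l Hc0 h4).
rewrite mulrCA mulrC ler_pM2l ?powR_gt0// powRN.
have Me : 0 < M%:R `^ eps by rewrite powR_gt0.
rewrite ler_pdivlMr// mulrC -ler_pdivlMr// leNgt => /negP; apply.
have h5 : (Hc / c1) `^ eps^-1 < M%:R by rewrite (lt_le_trans (truncnS_gt _))// ler_nat.
have q0 : 0 <= Hc / c1 by rewrite divr_ge0// ltW.
rewrite [ltLHS](_ : _ = ((Hc / c1) `^ eps^-1) `^ eps); last first.
  by rewrite -powRrM mulVf ?gt_eqF// powRr1.
by rewrite gt0_ltr_powR// nnegrE ?powR_ge0// ltW.
Qed.

End GridVariation.

(** * Application to the series: period, L^2 convergence and dimension *)

Section Assembly.
Variable R : realType.
Notation mu := (@lebesgue_measure R).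

Lemma powR_tail_small (K s e : R) : 0 < s -> 0 < e ->
  exists N0 : nat, forall N, (N0 <= N)%N -> K * N.+1%:R `^ (- s) <= e.
Proof.
move=> s0 e0; have : (fun n : nat => K * n.+1%:R `^ (- s) : R) @ \oo --> (0 : R).
  by rewrite -[X in _ --> X](mulr0 K); apply: cvgMr; exact: powR_cvg0.
move=> /cvgrPdist_le/(_ e e0)[N0 _ h]; exists N0 => N N0N.
by have := h N N0N; rewrite /= sub0r normrN; apply: le_trans; exact: ler_norm.
Qed.

Lemma hoelder_continuous_continuous (u : R -> R) (K alpha : R) : 0 <= K -> 0 < alpha ->
  (forall x y, `|u x - u y| <= K * `|x - y| `^ alpha) -> continuous u.
Proof.
move=> K0 a0 hu x; apply/cvgrPdist_le => e e0.
have K1 : 0 < K + 1 by rewrite ltr_wpDl.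
have d0 : 0 < (e / (K + 1)) `^ alpha^-1 by rewrite powR_gt0// divr_gt0.
near=> y.
have xy : `|x - y| <= (e / (K + 1)) `^ alpha^-1.
  by near: y; apply: cvgr_dist_le d0; exact: cvg_id.
have h : `|x - y| `^ alpha <= e / (K + 1).
  rewrite (@le_trans _ _ (((e / (K + 1)) `^ alpha^-1) `^ alpha))//.
    by rewrite ge0_ler_powR ?nnegrE ?powR_ge0// ltW.
  by rewrite -powRrM mulVf ?gt_eqF// powRr1// divr_ge0// ltW.
rewrite (le_trans (hu x y))// (le_trans (ler_wpM2l K0 h))// mulrCA ger_pMr//.
by rewrite ler_pdivrMr// mul1r lerDl.
Unshelve. all: by end_near. Qed.

Variables (dd : nat) (omega : {poly int}) (g : R -> R[i]) (r : rat).
Hypothesis size_omega : size omega = dd.+3.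
Hypothesis r0 : r != 0.

Let P : R := 2 * pi * (denq r)%:~R.
Let gh := fourier_coef g.
Let om (n : int) : int := omega.[n].

(** Multiplied by [denq r], the frequencies [n - r omega(n)] are the values of an integer
    polynomial. This gives the period [2 pi denq r] and makes divisibility available for the
    coincidences. *)
Definition freq_poly : {poly int} := denq r *: 'X - numq r *: omega.

Let freq_polyE n : freq_poly.[n] = denq r * n - numq r * om n.
Proof. by rewrite !hornerE. Qed.

Lemma size_freq_poly : size freq_poly = dd.+3.
Proof.
have sk : size (numq r *: omega) = dd.+3 by rewrite size_scale ?numq_eq0.
rewrite /freq_poly addrC size_polyDl size_polyN sk//.
by apply: leq_ltn_trans (size_scale_leq _ _) _; rewrite size_polyX.
Qed.

Let denqR : 0 < (denq r)%:~R :> R.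
Proof. by rewrite ltr0z denq_gt0. Qed.

Let P0 : 0 < P.
Proof. by rewrite !mulr_gt0 ?pi_gt0. Qed.

Let phaseE n : phase R omega r n = 2 * pi * (freq_poly.[n])%:~R / P.
Proof.
rewrite /phase freq_polyE rmorphB !rmorphM /= /P ratr_quot /om.
have p0 : pi != 0 :> R by rewrite gt_eqF// pi_gt0.
move: ((denq r)%:~R : R) (lt0r_neq0 denqR) (pi : R) p0 => D D0 p p0; field.
by rewrite D0 p0.
Qed.

Lemma term_period c n x : term omega g r c n (x + P) = term omega g r c n x.
Proof.
rewrite termD phaseE divfK ?gt_eqF// mulrC.
by rewrite (expi_2pi_int R (freq_poly.[n])) mul1r.
Qed.

Lemma term_wave c n (K x : nat) :
  term omega g r c n (P * (x%:R / K%:R)) = gh n * expi (c * (om n)%:~R) * wave R K freq_poly.[n] x.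
Proof.
rewrite termE; congr (_ * expi _).
rewrite phaseE; move: (x%:R / K%:R : R) (freq_poly.[n]%:~R : R) (lt0r_neq0 P0) => t z.
by move: P => Q Q0; field.
Qed.

Lemma term_increment c n (C M L x : nat) : (0 < steps dd C M)%N -> (0 < L)%N ->
  let K := (steps dd C M * L)%N in
  term omega g r c n (P * ((x + L)%:R / K%:R)) - term omega g r c n (P * (x%:R / K%:R)) =
  gh n * expi (c * (om n)%:~R) * mult R freq_poly dd C M n * wave R K freq_poly.[n] x.
Proof.
move=> s0 L0 K; rewrite !term_wave -mulrBr -mulrA; congr (_ * _).
rewrite /mult mulrBl mul1r; congr (_ - _); rewrite /wave -expiD; congr expi.
have sR : 0 < (steps dd C M)%:R :> R by rewrite ltr0n.
have LR : 0 < L%:R :> R by rewrite ltr0n.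
rewrite /K natrM natrD.
move: ((steps dd C M)%:R : R) (L%:R : R) (lt0r_neq0 sR) (lt0r_neq0 LR) => S Z S0 Z0.
by field; rewrite S0 Z0.
Qed.

Lemma fourier_coef_le : step_function g -> nonconstant g -> exists2 Bg : R, 0 <= Bg &
  (forall n : int, n != 0 -> normc (gh n) <= Bg / (absz n)%:R) /\ normc (gh 0) <= Bg.
Proof.
move=> sg ncg; have [ys [beta [y0 [_ _ _ _ hg]]]] := step_function_fourier sg ncg.
pose B := \sum_(y <- ys) normc (beta y).
have B0 : 0 <= B by rewrite sumr_ge0// => y _; exact: normc_ge0.
exists (B + normc (gh 0)); first by rewrite addr_ge0 ?normc_ge0.
split; last by rewrite lerDr.
move=> n n0; rewrite /gh hg// normcM mulrC.
have -> : normc ((n%:~R : R[i])^-1) = (absz n)%:R^-1.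
  rewrite -[n%:~R](rmorph_int (real_complex R)) -fmorphV normc_real normfV.
  by rewrite -intr_norm.
rewrite ler_wpM2r ?invr_ge0// (le_trans (normc_sum _ _ _))// (@le_trans _ _ B)//.
  by rewrite ler_sum// => y _; rewrite normcM normc_expi mulr1.
by rewrite lerDl normc_ge0.
Qed.

Lemma ae_offdiag_small (C M0 : nat) (y0 Bg delta : R) : (0 < C)%N -> (0 < M0)%N ->
  (forall n : int, (0 < absz n)%N -> (absz freq_poly.[n] <= C * absz n ^ dd.+2)%N) ->
  (forall n : int, (M0 <= absz n)%N -> (absz n ^ dd.+2 <= 2 * absz freq_poly.[n])%N) ->
  0 <= Bg -> (forall n : int, n != 0 -> normc (gh n) <= Bg / (absz n)%:R) -> 0 < delta ->
  {ae mu, forall c : R, forall m : nat, exists2 M : nat, (m <= M)%N &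
     normc (offdiag freq_poly C om gh y0 M c) <= delta}.
Proof.
move=> C0 M00 hle hge Bg0 hgh d0.
have l0 : denq r != 0 := denq_neq0 r.
have [C4 C40 h] := offdiag_integral_le size_freq_poly C0 M00 hle hge l0 freq_polyE y0 Bg0 hgh.
have pi2 : 0 < 2 * pi :> R by rewrite mulr_gt0// pi_gt0.
have := @ae_frequently_le R (fun M c => normc (offdiag freq_poly C om gh y0 M c) ^+ 2)
  (2 * pi) C4 (delta ^+ 2) (maxn M0 (2 * absz freq_poly.[0]).+1) pi2 (exprn_gt0 2 d0) C40.
move=> /(_ (fun M c => sqr_ge0 _) h); apply: (@filterS _ _ (ae_filter_ringOfSetsType mu)).
move=> c hc m; have [M mM hM] := hc m; exists M => //.
by move: hM; rewrite ler_pXn2r ?nnegrE ?normc_ge0// ltW.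
Qed.

Variables (c : R) (f : R -> R[i]) (s Cf : R).
Hypothesis s0 : 0 < s.
Hypothesis s1 : s <= 1.
Hypothesis Cf0 : 0 <= Cf.
Hypothesis f_tail : forall N x,
  normc (f x - \sum_(n <- box N) term omega g r c n x) <= Cf * N.+1%:R `^ (- s).

Lemma series_periodic : periodic f P.
Proof.
move=> x; apply/eqP; rewrite -subr_eq0; apply/eqP/eq0_normc/eqP.
rewrite eq_le normc_ge0 andbT; apply/ler_addgt0Pr => e e0; rewrite add0r.
have [N hN] := powR_tail_small (2 * Cf) s0 e0.
apply: le_trans (hN N (leqnn N)).
apply: le_trans (normcB_trans _ _ (\sum_(n <- box N) term omega g r c n x)) _.
rewrite [X in _ + X]normcB mulr2n !mulrDl mul1r lerD ?f_tail//.
have := f_tail N (x + P).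
by under eq_bigr do rewrite term_period.
Qed.

Variables (alpha Kh : R).
Hypothesis alpha0 : 0 < alpha.
Hypothesis f_hoelder : forall x y : R, normc (f x - f y) <= Kh * `|x - y| `^ alpha.

Let Kh0 : 0 <= Kh.
Proof. by have := f_hoelder 1 0; rewrite subr0 normr1 powR1 mulr1; apply: le_trans; exact: normc_ge0. Qed.

Lemma continuous_Re_series : continuous (fun x => complex.Re (f x)).
Proof.
apply: (hoelder_continuous_continuous Kh0 alpha0) => x y.
by rewrite -raddfB (le_trans (normc_Re_le _)).
Qed.

Lemma continuous_Im_series : continuous (fun x => complex.Im (f x)).
Proof.
apply: (hoelder_continuous_continuous Kh0 alpha0) => x y.
by rewrite -raddfB (le_trans (normc_Im_le _)).
Qed.

Let f_le : exists2 B : R, 0 <= B & forall x, normc (f x) <= B.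
Proof.
exists (Cf + normc (gh 0)); first by rewrite addr_ge0 ?normc_ge0.
move=> x; have := f_tail 0 x; rewrite powR1 mulr1 /box /= big_seq1 => h.
rewrite -[f x](subrK (term omega g r c 0 x)) (le_trans (normcD_le _ _))// lerD//.
by rewrite termE normcM normcM !normc_expi !mulr1.
Qed.

(** The choices are made in the order [M], then [N] so large that the tails of [f] are negligible
    against [M^-(1/2 + eps)], then [L] so large that the grid resolves all frequencies up to [N].
    The sizes of [N] and [L] do not matter, because the bounds are for means over the grid. *)
Lemma series_fractal_dim_ge (C M0 : nat) (y0 Bg : R) (ys : seq R) (beta : R -> R[i]) :
  (0 < C)%N -> (0 < M0)%N ->
  (forall n : int, (0 < absz n)%N -> (absz freq_poly.[n] <= C * absz n ^ dd.+2)%N) ->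
  (forall n : int, (M0 <= absz n)%N -> (absz n ^ dd.+2 <= 2 * absz freq_poly.[n])%N) ->
  0 <= Bg -> (forall n : int, n != 0 -> normc (gh n) <= Bg / (absz n)%:R) ->
  normc (gh 0) <= Bg ->
  uniq ys -> (forall y, y \in ys -> 0 <= y < 2 * pi) -> y0 \in ys -> beta y0 != 0 ->
  (forall n : int, n != 0 ->
     gh n = (n%:~R)^-1 * \sum_(y <- ys) beta y * expi (- (n%:~R * y))) ->
  (forall m : nat, exists2 M : nat, (m <= M)%N &
     normc (offdiag freq_poly C om gh y0 M c) <= normc (beta y0) / 4) ->
  ((2 - 1 / (2 * dd.+2%:R))%:E <= maxe
     (fractal_dim (graph_on `[0%R, P] (fun x => complex.Re (f x))))
     (fractal_dim (graph_on `[0%R, P] (fun x => complex.Im (f x)))))%E.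
Proof.
move=> C0 M00 hle hge Bg0 hgh hgh0 uys ysin y0in b0 hg hoff.
have [B B0 hB] := f_le.
apply: (@fractal_dim_ge _ _ _ P B (2 * C * 2 ^ dd.+2)) => //.
- exact: continuous_Re_series.
- exact: continuous_Im_series.
- by move=> x; rewrite (le_trans (normc_Re_le _)).
- by move=> x; rewrite (le_trans (normc_Im_le _)).
- by rewrite muln_gt0 muln_gt0 C0 expn_gt0.
move=> eps eps0.
have [c1 c10 [M2 hc1]] := increments_mean_ge size_freq_poly C0 M00 hle hge om Bg0 hgh hgh0 uys ysin y0in b0 hg eps0.
exists (c1 / 2); first by rewrite divr_gt0.
move=> m; have [M mM hM] := hoff (maxn m (maxn M2 M0)).
move: mM; rewrite !geq_max => /and3P[mM M2M M0M].
have M_gt0 : (0 < M)%N by rewrite (leq_trans M00).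
have MR : 0 < M%:R :> R by rewrite ltr0n.
pose Y : R := M%:R `^ (- (1 / 2 + eps)).
have Y0 : 0 < Y by rewrite powR_gt0.
have [N0 hN0] := powR_tail_small (2 * Cf) s0 (divr_gt0 (mulr_gt0 c10 Y0) (ltr0Sn R 1)).
pose N := maxn N0 (4 * C * M).
(* The 3 gives [2 n < K], and the sum dominates every [2 |freq_poly.[n]|] with [n] in [box N]. *)
pose L := (3 + \sum_(n <- box N) 2 * absz freq_poly.[n])%N.
have L0 : (0 < L)%N by [].
have st0 := steps_gt0 dd C0 M_gt0.
have stE : (2 * C * 2 ^ dd.+2 * M ^ dd.+2)%N = steps dd C M by rewrite /steps expnMn mulnA.
exists M, L; split => //; rewrite /= stE; set n := steps dd C M.
pose K := (n * L)%N; rewrite -/K.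
have nK : (2 * n < K)%N.
  have L2 : (2 < L)%N by exact: leq_addr.
  by rewrite /K [(n * L)%N]mulnC ltn_pmul2r.
have hK j : j \in box N -> (2 * absz freq_poly.[j] < K)%N.
  move=> jN; rewrite (@leq_trans L)// ?leq_pmull// /L (bigD1_seq j) ?box_uniq//=.
  by rewrite addnCA -[X in (X < _)%N]addn0 ltn_add2l.
have KR : 0 < K%:R :> R by rewrite ltr0n (leq_ltn_trans _ nK).
have main := hc1 M N K c M2M (leq_maxr _ _) nK hK hM.
pose pt (x : nat) : R := P * (x%:R / K%:R).
have incE x : increment freq_poly dd C om gh M N K c x =
    \sum_(j <- box N) term omega g r c j (pt (x + L)%N) - \sum_(j <- box N) term omega g r c j (pt x).
  by rewrite -sumrB; apply: eq_bigr => j _; rewrite /pt /K term_increment.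
pose kap : R := Cf * N.+1%:R `^ (- s).
have kapE : 2 * kap <= c1 * Y / 2 by rewrite /kap mulrA hN0// leq_maxl.
have inc_le x : normc (increment freq_poly dd C om gh M N K c x) <=
    `|complex.Re (f (pt (x + L)%N)) - complex.Re (f (pt x))| +
    `|complex.Im (f (pt (x + L)%N)) - complex.Im (f (pt x))| + c1 * Y / 2.
  rewrite incE; set S1 := \sum_(j <- _) _; set S2 := \sum_(j <- _) _.
  have t1 := f_tail N (pt (x + L)%N); have t2 := f_tail N (pt x).
  rewrite -!raddfB.
  have t3 := normc_le_ReIm (f (pt (x + L)%N) - f (pt x)).
  have t4 := normcB_trans S1 S2 (f (pt (x + L)%N)).
  have t5 := normcB_trans (f (pt (x + L)%N)) S2 (f (pt x)).
  rewrite [normc (S1 - f _)]normcB in t4.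
  move: t1 t2 t3 t4 t5 kapE; rewrite -/S1 -/S2 -/kap.
  move: (normc _) (normc _) (normc _) (normc _) (normc _) `|_| `|_|.
  by move: kap (c1 * Y / 2) => k1 k2 a1 a2 a3 a4 a5 a6 a7; lra.
have := le_trans main (ler_sum _ (fun x _ => inc_le (nat_of_ord x))).
rewrite big_split/= sumr_const card_ord -[(c1 * Y / 2) *+ K]mulr_natl -/Y.
rewrite (_ : K%:R * (c1 * Y) = K%:R * (c1 / 2 * Y) + K%:R * (c1 * Y / 2)); last by field.
by rewrite lerD2r.
Qed.

Lemma box_tail_le (Bg : R) (h : int -> R) (N0 N : nat) : 0 <= Bg -> (N0 <= N)%N ->
  (forall n : int, (absz n <= N0)%N -> h n = 0) ->
  (forall n : int, (N0 < absz n)%N -> h n <= Bg * (absz n)%:R `^ (- (1 + 1))) ->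
  \sum_(n <- box N) h n <= 6 * Bg / N0.+1%:R.
Proof.
move=> Bg0 N0N h0 hle; rewrite big_box h0// add0r (big_cat_nat (n := N0.+1))//=.
rewrite big_nat big1 ?add0r; last first.
  by move=> i /andP[_ iN0]; rewrite !h0 ?addr0// abszN absz_nat -ltnS.
rewrite (@le_trans _ _ (2 * Bg * \sum_(N0.+1 <= n < N.+1) n%:R `^ (- (1 + 1))))//.
  rewrite mulr_sumr big_nat [leRHS]big_nat ler_sum// => n /andP[N0n _].
  have h1 := hle n%:Z; have h2 := hle (- n%:Z); rewrite abszN absz_nat in h1 h2.
  by have := lerD (h1 N0n) (h2 N0n); rewrite -mulrA; lra.
have := @sum_powR_tail R 1 N0.+1 N.+1; rewrite ltr01 lexx divr1 => /(_ isT isT) h1.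
have B2 : 0 <= 2 * Bg by rewrite mulr_ge0.
rewrite (le_trans (ler_wpM2l B2 h1))// powR_inv1//.
by rewrite le_eqVlt; apply/orP; left; apply/eqP; ring.
Qed.

(** The uniform bound [f_tail] controls only symmetric partial sums. A finite [A] containing
    [box N0] is completed to some [box N]; the added terms have [|n| > N0], and their sum is small
    in L^2 by orthogonality, each frequency having multiplicity at most [dd + 2]. *)
Lemma series_L2_sum (Bg : R) : 0 <= Bg ->
  (forall n : int, n != 0 -> normc (gh n) <= Bg / (absz n)%:R) ->
  L2_sum P (fun n x => term omega g r c n x) f.
Proof.
move=> Bg0 hgh.
have mD : measurable (`[0, P]%classic : set (measurableTypeR R)) by exact: measurable_itv.
have mRe : measurable_fun `[0, P] (fun x => complex.Re (f x)).
  by apply: measurable_funTS; apply: continuous_measurable_fun; exact: continuous_Re_series.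
have mIm : measurable_fun `[0, P] (fun x => complex.Im (f x)).
  by apply: measurable_funTS; apply: continuous_measurable_fun; exact: continuous_Im_series.
split => //.
pose S (A : seq int) (x : R) := \sum_(n <- A) term omega g r c n x.
pose b (n : int) : R[i] := gh n * expi (c * (om n)%:~R).
have termb n x : term omega g r c n x = b n * expi (2 * pi * (freq_poly.[n])%:~R / P * x).
  by rewrite termE phaseE.
have mS (A : seq int) : measurable_fun `[0, P] (fun x => complex.Re (S A x)) /\
    measurable_fun `[0, P] (fun x => complex.Im (S A x)).
  have [[iR iI] _] := cintegrable_sum A b (fun n => expi_cintegrable 0 P (2 * pi * (freq_poly.[n])%:~R / P)).
  have SE x : S A x = \sum_(n <- A) b n * expi (2 * pi * (freq_poly.[n])%:~R / P * x).
    by apply: eq_bigr => n _; exact: termb.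
  split; apply/measurable_EFinP.
    rewrite (_ : EFin \o _ = EFin \o (fun x => complex.Re (\sum_(n <- A) b n * expi (2 * pi * (freq_poly.[n])%:~R / P * x)))).
      exact: measurable_int iR.
    by apply/funext => x /=; rewrite SE.
  rewrite (_ : EFin \o _ = EFin \o (fun x => complex.Im (\sum_(n <- A) b n * expi (2 * pi * (freq_poly.[n])%:~R / P * x)))).
    exact: measurable_int iI.
  by apply/funext => x /=; rewrite SE.
have msq (h : R -> R[i]) : measurable_fun `[0, P] (fun x => complex.Re (h x)) ->
    measurable_fun `[0, P] (fun x => complex.Im (h x)) ->
    measurable_fun `[0, P] (fun x => normc (h x) ^+ 2).
  move=> m1 m2.
  rewrite (_ : (fun x => _) = (fun x => complex.Re (h x) ^+ 2 + complex.Im (h x) ^+ 2)).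
    by apply: measurable_funD; apply: measurable_funX.
  by apply/funext => x; rewrite sqr_normcE.
pose Z := 2 * Cf ^+ 2 * P + 2 * (P * (dd.+2%:R * (6 * Bg ^+ 2))).
have Z20 : 0 <= 2 * (P * (dd.+2%:R * (6 * Bg ^+ 2))).
  by apply: mulr_ge0 => //; apply: mulr_ge0 (ltW P0) _; rewrite mulr_ge0// mulr_ge0// sqr_ge0.
have main (N0 : nat) (A : {fset int}) : {subset box N0 <= A} ->
    (\int[mu]_(x in `[0%R, P]) ((normc (f x - S A x) ^+ 2)%:E) <= (Z * N0.+1%:R `^ (- s))%:E)%E.
  move=> subA.
  pose N := (N0 + \sum_(n <- A) absz n)%N.
  have N0N : (N0 <= N)%N by exact: leq_addr.
  have AN n : n \in (A : seq int) -> n \in box N.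
    move=> nA; rewrite mem_box /N (bigD1_seq n) ?fset_uniq//=.
    by rewrite addnCA leq_addr.
  pose T := [seq n <- box N | n \notin A].
  have FS x : S (box N) x - S A x = S T x.
    rewrite /S /T big_filter (bigID (fun n => n \in A))/= -[X in X + _ - _]big_filter.
    have -> : \sum_(i <- [seq i <- box N | i \in A]) term omega g r c i x =
        \sum_(n <- A) term omega g r c n x.
      apply: perm_big; apply: uniq_perm; rewrite ?filter_uniq ?box_uniq ?fset_uniq// => n.
      by rewrite mem_filter; apply/andP/idP => [[]//|nA]; split => //; exact: AN.
    by rewrite addrC addKr.
  have Tn n : n \in T -> (N0 < absz n)%N.
    rewrite mem_filter => /andP[nA _]; rewrite ltnNge -mem_box.
    by apply: contra nA; exact: subA.
  have uT : uniq T by rewrite filter_uniq// box_uniq.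
  have hD i : i \in T -> (count (fun j => freq_poly.[j] == freq_poly.[i]) T)%:R <= dd.+2%:R :> R.
    by move=> _; rewrite ler_nat (count_value_le size_freq_poly).
  have [_] := integral_sqr_expi_le b (v := fun n => freq_poly.[n]) 0 P0 hD.
  rewrite add0r => hI.
  have sumT : \sum_(n <- T) normc (b n) ^+ 2 <= 6 * Bg ^+ 2 / N0.+1%:R.
    rewrite /T big_filter big_mkcond.
    apply: (box_tail_le (sqr_ge0 Bg) N0N) => n hn.
      by case: ifP => // nA; have := subA n; rewrite mem_box hn => /(_ isT); move: nA => /negP.
    have n0 : n != 0 by rewrite -absz_gt0 (leq_ltn_trans _ hn).
    have bn : normc (b n) ^+ 2 <= Bg ^+ 2 * (absz n)%:R `^ (- (1 + 1)).
      rewrite powRN (_ : 1 + 1 = 2%:R)// powR_mulrn// -exprVn -exprMn.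
      rewrite lerXn2r ?nnegrE ?normc_ge0 ?mulr_ge0 ?invr_ge0//.
      by rewrite /b normcM normc_expi mulr1 hgh.
    case: ifP => // _; rewrite mulr_ge0 ?sqr_ge0 ?powR_ge0//.
  have NR : 1 <= N0.+1%:R :> R by rewrite ler1n.
  have kap : (Cf * N.+1%:R `^ (- s)) ^+ 2 <= Cf ^+ 2 * N0.+1%:R `^ (- s).
    rewrite exprMn ler_wpM2l ?sqr_ge0// expr2.
    have k1 : N.+1%:R `^ (- s) <= N0.+1%:R `^ (- s) :> R.
      rewrite !powRN lef_pV2 ?posrE ?powR_gt0//.
      by rewrite ge0_ler_powR ?nnegrE ?ler_nat// ltW.
    have k2 : N.+1%:R `^ (- s) <= 1 :> R.
      by rewrite -[leRHS](powRr0 N.+1%:R) ler_powR ?ler1n// oppr_le0 ltW.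
    by rewrite -[leRHS]mulr1 ler_pM ?powR_ge0.
  have pw x : normc (f x - S A x) ^+ 2 <= 2 * (Cf ^+ 2 * N0.+1%:R `^ (- s)) + 2 * normc (S T x) ^+ 2.
    have t1 : normc (f x - S A x) <= Cf * N.+1%:R `^ (- s) + normc (S T x).
      rewrite -FS (le_trans (normcB_trans _ _ (S (box N) x)))// lerD2r; exact: f_tail.
    have t2 : normc (f x - S A x) ^+ 2 <= (Cf * N.+1%:R `^ (- s) + normc (S T x)) ^+ 2.
      by rewrite lerXn2r ?nnegrE ?addr_ge0 ?normc_ge0 ?mulr_ge0 ?powR_ge0.
    have := sqr_ge0 (Cf * N.+1%:R `^ (- s) - normc (S T x)).
    by move: kap t2; move: (Cf * _) (normc (S T x)) => u v; lra.
  have mh1 : measurable_fun `[0, P] (fun x => normc (f x - S A x) ^+ 2).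
    have [m1 m2] := mS A; apply: msq.
      rewrite (_ : (fun x => _) = (fun x => complex.Re (f x) - complex.Re (S A x))).
        exact: measurable_funB.
      by apply/funext => x; rewrite raddfB.
    rewrite (_ : (fun x => _) = (fun x => complex.Im (f x) - complex.Im (S A x))).
      exact: measurable_funB.
    by apply/funext => x; rewrite raddfB.
  have mh2 : measurable_fun `[0, P] (fun x => normc (S T x) ^+ 2).
    by have [m1 m2] := mS T; exact: msq.
  pose k2 : R := 2 * (Cf ^+ 2 * N0.+1%:R `^ (- s)).
  have k20 : 0 <= k2 by rewrite !mulr_ge0 ?sqr_ge0 ?powR_ge0.
  apply: (@le_trans _ _ (\int[mu]_(x in `[0%R, P]) (k2%:E + 2%:E * (normc (S T x) ^+ 2)%:E))%E).
    apply: ge0_le_integral => //.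
    - by move=> x _; rewrite lee_fin sqr_ge0.
    - exact/measurable_EFinP.
    - by apply: emeasurable_funD => //; apply: measurable_funeM; exact/measurable_EFinP.
    - by move=> x _; rewrite -EFinM -EFinD lee_fin; exact: pw.
  rewrite ge0_integralD//; last 2 first.
  - by move=> x _; rewrite mule_ge0// lee_fin sqr_ge0.
  - by apply: measurable_funeM; exact/measurable_EFinP.
  have cE : (\int[mu]_(x in `[0%R, P]) k2%:E = (k2 * P)%:E)%E.
    transitivity (k2%:E * mu `[0%R, P]%classic)%E; first exact: integral_cst.
    by rewrite lebesgue_measure_itv/= lte_fin P0 -EFinB subr0 EFinM.
  rewrite cE.
  rewrite ge0_integralZl//; last 2 first.
  - exact/measurable_EFinP.
  - by move=> x _; rewrite lee_fin sqr_ge0.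
  have hI2 : (\int[mu]_(x in `[0%R, P]) (normc (S T x) ^+ 2)%:E <=
      (P * (dd.+2%:R * (6 * Bg ^+ 2 / N0.+1%:R)))%:E)%E.
    apply: le_trans (le_trans hI _).
      rewrite le_eqVlt; apply/orP; left; apply/eqP; apply: eq_integral => x _.
      by congr ((normc _ ^+ 2)%:E); apply: eq_bigr => n _; exact: termb.
    by rewrite lee_fin ler_wpM2l ?(ltW P0)// ler_wpM2l.
  have NV : N0.+1%:R^-1 <= N0.+1%:R `^ (- s) :> R.
    by rewrite -(powR_inv1 (ler0n R N0.+1)) ler_powR// lerN2.
  apply: (@le_trans _ _ ((k2 * P)%:E + (2 * (P * (dd.+2%:R * (6 * Bg ^+ 2 / N0.+1%:R))))%:E)%E).
    by rewrite [X in (_ <= _ + X)%E]EFinM leeD// lee_wpmul2l.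
  rewrite -EFinD lee_fin /k2 /Z [leRHS]mulrDl; apply: lerD.
    by rewrite le_eqVlt; apply/orP; left; apply/eqP; ring.
  have := ler_wpM2l Z20 NV; rewrite (_ : _ / N0.+1%:R = 2 * (P * (dd.+2%:R * (6 * Bg ^+ 2 / N0.+1%:R))))//.
  by ring.
have ge0 (A : {fset int}) : (0 <= \int[mu]_(x in `[0%R, P]) ((normc (f x - S A x) ^+ 2)%:E))%E.
  by apply: integral_ge0 => x _; rewrite lee_fin sqr_ge0.
have small (e : R) : 0 < e -> \forall A \near totally,
    (\int[mu]_(x in `[0%R, P]) ((normc (f x - S (A : {fset int}) x) ^+ 2)%:E) <= e%:E)%E.
  move=> e0; have [N0 hN0] := powR_tail_small Z s0 e0.
  exists [fset n in box N0]%fset => //= A /fsubsetP hA.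
  apply: (le_trans (main N0 A _)); last by rewrite lee_fin hN0.
  by move=> n nb; apply: hA; apply/imfsetP; exists n.
have fin (e : R) (A : {fset int}) :
    (\int[mu]_(x in `[0%R, P]) ((normc (f x - S A x) ^+ 2)%:E) <= e%:E)%E ->
    (\int[mu]_(x in `[0%R, P]) ((normc (f x - S A x) ^+ 2)%:E) \is a fin_num)%E.
  by move=> hA; rewrite ge0_fin_numE// (le_lt_trans hA)// ltry.
have FFt : Filter (@totally int) := totally_filter.
apply/fine_cvgP; split.
  by have := small 1 ltr01; apply: (@filterS _ _ totally_filter) => A; exact: fin.
apply/cvgrPdist_le => e e0; have := small e e0.
apply: (@filterS _ _ totally_filter) => A hA.
have hA' : fine (\int[mu]_(x in `[0%R, P]) ((normc (f x - S A x) ^+ 2)%:E)) <= e.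
  by have := hA; rewrite -{1}(fineK (fin _ _ hA)) lee_fin.
have h0 := fine_ge0 (ge0 A).
by rewrite sub0r normrN (ger0_norm h0).
Qed.

End Assembly.

Theorem theorem1p1 (R : realType) (d : nat) (omega : {poly int})
    (g : R -> R[i]) (r : rat) :
  (2 <= d)%N -> size omega = d.+1 ->
  step_function g -> nonconstant g ->
  r != 0 ->
  let P : R := 2 * pi * (denq r)%:~R in
  {ae lebesgue_measure, forall c : R,
    exists f : R -> R[i],
      [/\ periodic f P,
          L2_sum P (fun n x => propagator_term
              (fun m : int => (omega.[m])%:~R) g (c - ratr r * x) x n) f,
          forall alpha : R,
            0 < alpha -> alpha < 1 / (d%:R * (2 ^+ d + 1)) ->
            hoelder_continuous alpha f &
          let D := maxe
            (fractal_dim (graph_on `[0, P] (fun x => complex.Re (f x))))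
            (fractal_dim (graph_on `[0, P] (fun x => complex.Im (f x)))) in
          ((2 - 1 / (2 * d%:R))%:E <= D)%E /\
          (D <= (2 - 1 / (d%:R * (2 ^+ d + 1)))%:E)%E]}.
Proof.
case: d => [//|[//|dd]] _ so sg ncg r0 P.
have [Bg Bg0 [hgh hgh0]] := fourier_coef_le sg ncg.
have [ys [beta [y0 [uys ysin y0in b0 hg]]]] := step_function_fourier sg ncg.
have sp := @size_freq_poly dd omega r so r0.
have [C [M0 [C0 M00 hle hge]]] := poly_growth sp R.
have delta0 : 0 < normc (beta y0) / 4.
  rewrite divr_gt0// lt_neqAle normc_ge0 andbT eq_sym.
  by apply: contra_neq b0 => /eq0_normc.
have := ae_offdiag_small so r0 y0 C0 M00 hle hge Bg0 hgh delta0.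
have := ae_propagator_series so r0 sg ncg.
apply: (@filterS2 _ _ (ae_filter_ringOfSetsType _)) => c [f [ftail fhoelder]] hoff.
have D0 : 0 < dd.+2%:R :> R by rewrite ltr0n.
pose q : R := 2 ^+ dd.+2 + 1.
have q1 : 1 < q by rewrite /q ltrDr exprn_gt0.
have q0 : 0 < q by rewrite (lt_trans ltr01).
(* Half of the critical exponent; any admissible value would serve for periodicity, continuity,
   convergence in L^2 and the lower bound. *)
pose s : R := 1 / q / 2.
have s0 : 0 < s by rewrite !divr_gt0.
have sq : s < 1 / q by rewrite /s ltr_pdivrMr// mulr_natr mulr2n ltrDl divr_gt0.
have s1 : s <= 1.
  by rewrite (le_trans (ltW sq))// ler_pdivrMr// mul1r ltW.
have [Cf [Cf0 hf]] := ftail s s0 sq.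
have [Kh hKh] := fhoelder s s0 sq.
have sD : 0 < s / dd.+2%:R by rewrite divr_gt0.
have hoelder alpha : 0 < alpha -> alpha < 1 / (dd.+2%:R * q) -> hoelder_continuous alpha f.
  move=> a0 a1; have := fhoelder (alpha * dd.+2%:R); rewrite mulfK ?gt_eqF//; apply.
    by rewrite mulr_gt0.
  by rewrite -ltr_pdivlMr// -mulrA -invfM [_ * dd.+2%:R]mulrC.
exists f; split.
- exact: (series_periodic s0 hf).
- exact: (series_L2_sum so r0 s0 s1 Cf0 hf sD hKh Bg0 hgh).
- exact: hoelder.
split.
  exact: (series_fractal_dim_ge so r0 s0 Cf0 hf sD hKh C0 M00 hle hge Bg0 hgh hgh0 uys ysin y0in b0 hg hoff).
have P0 : 0 < P by rewrite mulr_gt0 ?ltr0z ?denq_gt0// mulr_gt0// pi_gt0.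
have upper (u : R -> R) : (forall x y, `|u x - u y| <= normc (f x - f y)) ->
    (fractal_dim (graph_on `[0%R, P] u) <= (2 - 1 / (dd.+2%:R * q))%:E)%E.
  move=> hu; apply/lee_addgt0Pr => e e0.
  pose a0 : R := 1 / (dd.+2%:R * q).
  have a00 : 0 < a0 by rewrite divr_gt0// mulr_gt0.
  (* The Hoelder exponents stay strictly below [a0], so the closed upper bound comes from letting
     the loss [e] tend to 0; the maximum keeps [al] positive. *)
  pose al := Num.max (a0 / 2) (a0 - e).
  have al0 : 0 < al by rewrite lt_max divr_gt0.
  have ala : al < a0 by rewrite gt_max; apply/andP; split; lra.
  have al1 : al < 1.
    rewrite (lt_le_trans ala)// ler_pdivrMr ?mulr_gt0// mul1r.
    by rewrite (le_trans (ltW q1))// ler_peMl ?(ltW q0)// ler1n.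
  have [K hK] := hoelder al al0 ala.
  have K0 : 0 <= K by have := hK 1 0; rewrite subr0 normr1 powR1 mulr1; apply: le_trans; exact: normc_ge0.
  apply: (@le_trans _ _ (2 - al)%:E).
    apply: (hoelder_fractal_dim_le P0 K0); first by rewrite al0.
    by move=> x y; rewrite (le_trans (hu x y)).
  rewrite -EFinD lee_fin -/a0.
  have : a0 - e <= al by rewrite le_max lexx orbT.
  by lra.
rewrite ge_max; apply/andP; split; apply: upper => x y; rewrite -raddfB.
  exact: normc_Re_le.
exact: normc_Im_le.
Qed.
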